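(* Let $(X,\mathcal{B},\mu)$ be a standard probability space, let $1 \le p \le \infty$ and suppose $f \in L^p_0$. Then there exist an ergodic invertible measure preserving transformation $T \in \mathcal{E}$ and a function $g \in L^{p-1}$ such that $f(x) = g(x) - g(Tx)$ for a.e. $x \in X$.
   Context: A standard probability space here means one isomorphic to $[0,1]$ with Lebesgue measure. For $0<p<\infty$, $L^p=\{f:X\to\mathbb{R}\ :\ f \text{ measurable and } \int_X |f|^p\,d\mu<\infty\}$; $L^\infty$ is the set of essentially bounded real measurable functions; $L^0$ is the set of all real-valued measurable functions on $(X,\mathcal{B},\mu)$. For $1\le p\le\infty$, $L^p_0=\{f\in L^p : \int_X f\,d\mu=0\}$. $\mathcal{E}$ is the family of ergodic invertible measure preserving transformations of $(X,\mathcal{B},\mu)$. When $p=1$, $L^{p-1}=L^0$; when $p=\infty$, $L^{p-1}=L^\infty$. *)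

(* Defs.v *)
From HB Require Import structures.
From mathcomp Require Import all_boot all_order all_algebra.
From mathcomp Require Import all_classical all_reals all_analysis.

Set Implicit Arguments.
Unset Strict Implicit.
Unset Printing Implicit Defensive.

Import Order.TTheory GRing.Theory Num.Theory.
Import numFieldNormedType.Exports.

Local Open Scope classical_set_scope.
Local Open Scope ring_scope.

(* The measure spaces are D1 with the restriction of mu1, and D2 with the
   restriction of mu2; N1 and N2 are the null sets that are discarded. *)
Definition isomorphic_mod0 (R : realType) (d1 d2 : measure_display)
    (T1 : measurableType d1) (T2 : measurableType d2)
    (mu1 : {measure set T1 -> \bar R}) (D1 : set T1)
    (mu2 : {measure set T2 -> \bar R}) (D2 : set T2) : Prop :=
  exists (N1 : set T1) (N2 : set T2) (phi : T1 -> T2) (psi : T2 -> T1),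
    [/\ [/\ measurable N1, N1 `<=` D1 & mu1 N1 = 0%E],
        [/\ measurable N2, N2 `<=` D2 & mu2 N2 = 0%E],
        [/\ set_fun (D1 `\` N1) (D2 `\` N2) phi,
            set_fun (D2 `\` N2) (D1 `\` N1) psi,
            (forall x, (D1 `\` N1) x -> psi (phi x) = x) &
            (forall y, (D2 `\` N2) y -> phi (psi y) = y)],
        measurable_fun (D1 `\` N1) phi /\ measurable_fun (D2 `\` N2) psi &
        forall B : set T2, measurable B -> B `<=` D2 `\` N2 ->
          mu1 ((D1 `\` N1) `&` phi @^-1` B) = mu2 B].

(* Authors equip [0, 1] either with its Borel sets or with its Lebesgue
   measurable sets (the Caratheodory sigma-algebra, which carries
   completed_lebesgue_measure); both are accepted. *)
Definition standard_probability_space (R : realType) (d : measure_display)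
    (X : measurableType d) (mu : probability X R) : Prop :=
  isomorphic_mod0 mu setT (@lebesgue_measure R) (`[0, 1] : set R) \/
  isomorphic_mod0 mu setT (@completed_lebesgue_measure R) (`[0, 1] : set R).

(* Lfun at exponent 0 is governed by the conventions x `^ 0 = 1 and 0^-1 = 0,
   hence the separate clause for L^0. For 0 < q < 1, Lfun still means that the
   integral of |g|^q is finite. *)
Definition Lclass (R : realType) (d : measure_display) (X : measurableType d)
    (mu : probability X R) (q : \bar R) (g : X -> R) : Prop :=
  if q == 0%E then measurable_fun setT g else g \in Lfun mu q.

Definition Lclass0 (R : realType) (d : measure_display) (X : measurableType d)
    (mu : probability X R) (p : \bar R) (f : X -> R) : Prop :=
  Lclass mu p f /\ (\int[mu]_x (f x)%:E = 0)%E.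

Definition invertible_measure_preserving (R : realType) (d : measure_display)
    (X : measurableType d) (mu : probability X R) (T : X -> X) : Prop :=
  [/\ measurable_fun setT T,
      exists2 S : X -> X, cancel T S /\ cancel S T & measurable_fun setT S &
      forall A : set X, measurable A -> mu (T @^-1` A) = mu A].

Definition ergodic (R : realType) (d : measure_display)
    (X : measurableType d) (mu : probability X R) (T : X -> X) : Prop :=
  forall A : set X, measurable A -> T @^-1` A = A ->
    mu A = 0%E \/ mu A = 1%E.

(* Main.v *)
(* [T] is a limit of automorphisms [T_n] permuting periodically the finite columns over a base
   [B_n], where [mu B_n] tends to 0. Let [s_n] be the sum of [f] over a column, put at its base
   point, and let [G_n] be minus the sum of [f] over the lower part of the column, so that
   [f = G_n - G_n o T_n + s_n o T_n]. Columns over points where [s_n] takes opposite signs are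
   concatenated in order to make the next sums [s_(n+1)] uniformly smaller. Doing this in a
   greedy order keeps the partial sums of [s_n] bounded by [sup |s_n|]; hence, if these bounds
   are summable, [G_n] converges uniformly to some [g], and [f = g - g o T].

   The sum of a test function over columns can be made small in [L^1] at the same time. As a
   function is cohomologous to its sums over columns, its integral over an invariant set is then
   small too; test functions coming from a separating sequence of sets make [T] ergodic.

   If [f] is unbounded, the first columns join to a point where [|f|] is large about [|f| / c]
   points where [f] is bounded and has the opposite sign, chosen so that the sum becomes bounded.
   The transfer function is then dominated by [|f|] at the base point of the column, and the
   integral of its power [p - 1] by that of [|f|^p]: this is where one exponent is lost. *)

Require Import Defs.
From HB Require Import structures.
From mathcomp Require Import all_boot all_order all_algebra.
From mathcomp Require Import all_classical all_reals all_analysis.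
From mathcomp Require Import measurable_realfun ess_sup_inf.
From mathcomp Require Import lra ring.

Set Implicit Arguments.
Unset Strict Implicit.
Unset Printing Implicit Defensive.

Import Order.TTheory GRing.Theory Num.Theory.
Import numFieldNormedType.Exports.

Local Open Scope classical_set_scope.
Local Open Scope ring_scope.

(** * Automorphisms and integrals *)
Section Automorphisms.
Context {R : realType} {d : measure_display} {X : measurableType d}.
Variable mu : probability X R.

(** The delicate point is that one concatenation must serve two purposes: it has to keep the sums of
    [f] uniformly small and to make those of a test function [h] small in mean. Mean zero turns
    signs into size: a bounded function of mean zero which is almost of one sign is small in [L^1].
    So points at which both functions have opposite signs are linked for as long as possible; what
    remains forces [h] or [f] to be almost of one sign, and in the second case [f] is so small in
    mean that [h] can be treated alone.

    Shrinking the base doubles the bound on the sums, but the number of later reductions by [3 / 4]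
    is free, so bounds [e0 / 2 ^ n] can be prescribed.

    Sets can be exchanged only up to null sets. Sums over columns are therefore handled as densities
    of image measures, which may be altered on null sets in order to keep bounds valid at every
    point.

    Standardness enters through three consequences only: disjoint sets of equal measure can be
    exchanged, sets can be cut into pieces of prescribed measures, and some sequence of sets
    separates. *)

Definition aut (T S : X -> X) : Prop :=
  [/\ measurable_fun setT T, measurable_fun setT S, cancel T S, cancel S T &
      forall A, measurable A -> mu (T @^-1` A) = mu A].

Lemma aut_id : aut id id.
Proof. by split=> //; exact: measurable_id. Qed.

Lemma aut_sym T S : aut T S -> aut S T.
Proof.
move=> [mT mS TS ST muT]; split=> // A mA.
have mSA : measurable (S @^-1` A) by rewrite -[_ @^-1` _]setTI; exact: mS.
rewrite -(muT _ mSA); congr (mu _); apply/seteqP; split=> x /=; by rewrite TS.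
Qed.

Lemma aut_comp T S T' S' : aut T S -> aut T' S' -> aut (T \o T') (S' \o S).
Proof.
move=> [mT mS TS ST muT] [mT' mS' TS' ST' muT']; split.
- exact: measurableT_comp.
- exact: measurableT_comp.
- by move=> x /=; rewrite TS TS'.
- by move=> x /=; rewrite ST' ST.
- move=> A mA; rewrite comp_preimage muT' ?muT//.
  by rewrite -[_ @^-1` _]setTI; exact: mT.
Qed.

Lemma aut_measurable T S A : aut T S -> measurable A -> measurable (T @^-1` A).
Proof. by move=> [mT _ _ _ _] mA; rewrite -[_ @^-1` _]setTI; exact: mT. Qed.

Lemma measurable_piecewise (I : countType) d' (Y : measurableType d')
    (lab : X -> I) (g : I -> X -> Y) :
  (forall i, measurable (lab @^-1` [set i])) ->
  (forall i, measurable_fun setT (g i)) ->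
  measurable_fun setT (fun x => g (lab x) x).
Proof.
move=> mlab mg _ A mA; rewrite setTI.
have -> : (fun x => g (lab x) x) @^-1` A =
    \bigcup_i (lab @^-1` [set i] `&` g i @^-1` A).
  apply/seteqP; split=> [x Ax|x [i _ [/= <-]]//].
  by exists (lab x).
apply: countable_bigcupT_measurable; first exact: countableP.
move=> i; apply: measurableI => //.
by rewrite -[_ @^-1` _]setTI; exact: mg.
Qed.

Lemma measure_label (lab : X -> nat) (A : set X) :
  (forall n, measurable (lab @^-1` [set n])) -> measurable A ->
  mu A = (\sum_(0 <= n <oo) mu (A `&` lab @^-1` [set n]))%E.
Proof.
move=> mlab mA.
rewrite -measure_semi_bigcup//.
- by congr (mu _); apply/seteqP; split=> [x Ax|x [n _ []]//]; exists (lab x).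
- by move=> n; apply: measurableI.
- apply/trivIsetP => i j _ _ ij; apply/seteqP; split=> // x [[_ /= xi] [_ /= xj]].
  by move: ij; rewrite -xi -xj eqxx.
- by apply: bigcupT_measurable => n; apply: measurableI.
Qed.

(** Measures are compared label by label: on label [n] the map [s] is [a n], and since [s] is a
    bijection the sets [lab \o s' = n] partition the target. *)
Lemma aut_piecewise (lab : X -> nat) (a a' : nat -> X -> X) (s s' : X -> X) :
  (forall n, measurable (lab @^-1` [set n])) ->
  (forall n, aut (a n) (a' n)) ->
  (forall x, s x = a (lab x) x) -> measurable_fun setT s' ->
  cancel s s' -> cancel s' s -> aut s s'.
Proof.
move=> mlab aa sE ms' ss' s's.
have ms : measurable_fun setT s.
  have -> : s = fun x => a (lab x) x by apply/funext.
  by apply: measurable_piecewise => // i; have [] := aa i.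
split=> // A mA.
have msA : measurable (s @^-1` A) by rewrite -[_ @^-1` _]setTI; exact: ms.
have mlab' n : measurable ((lab \o s') @^-1` [set n]).
  by rewrite comp_preimage -[_ @^-1` _]setTI; exact: ms'.
rewrite (measure_label mlab msA) (measure_label mlab' mA).
apply: eq_eseriesr => n _.
have [ma ma' aK a'K mua] := aa n.
rewrite -(mua (A `&` _)); last exact: measurableI.
congr (mu _); apply/seteqP; split=> x /= [].
  by move=> sxA xn; have -> : a n x = s x; [rewrite sE xn|rewrite ss'].
move=> axA axn; suff e : s' (a n x) = x.
  have xn : lab x = n by rewrite -{1}e.
  by rewrite sE xn.
by apply: (can_inj aK); rewrite -{1}axn -sE s's.
Qed.

End Automorphisms.

Section Integrals.
Context {R : realType} {d : measure_display} {X : measurableType d}.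
Variable mu : probability X R.

Lemma aut_ge0_integral T S (A : set X) (f : X -> \bar R) : aut mu T S ->
  measurable A -> measurable_fun setT f -> (forall x, 0 <= f x)%E ->
  (\int[mu]_(x in T @^-1` A) f (T x) = \int[mu]_(x in A) f x)%E.
Proof.
move=> [mT _ _ _ muT] mA mf f0.
have <- : (\int[pushforward mu T]_(x in A) f x = \int[mu]_(x in T @^-1` A) f (T x))%E.
  by rewrite ge0_integral_pushforward//; exact: measurable_funTS.
by apply: eq_measure_integral => B mB _; exact: muT.
Qed.

Implicit Types (f g : X -> R) (A : set X).

Definition integ (f : X -> R) : Prop := mu.-integrable setT (EFin \o f).

Lemma integ_sub f A : measurable A -> integ f -> mu.-integrable A (EFin \o f).
Proof. by move=> mA; apply: integrableS. Qed.

Lemma integ_measurable f : integ f -> measurable_fun setT f.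
Proof. by move/measurable_int; move/measurable_EFinP. Qed.

Lemma integ_bounded f M : measurable_fun setT f -> (forall x, `|f x| <= M) -> integ f.
Proof.
move=> mf fM; apply: measurable_bounded_integrable => //.
  by rewrite -ge0_fin_numE// fin_num_measure.
exists M; split; first by rewrite num_real.
by move=> y My x _ /=; apply: le_trans (fM x) (ltW My).
Qed.

Lemma integD f g : integ f -> integ g -> integ (fun x => f x + g x).
Proof. by move=> F G; have := integrableD measurableT F G. Qed.

Lemma integB f g : integ f -> integ g -> integ (fun x => f x - g x).
Proof. by move=> F G; have := integrableB measurableT F G. Qed.

Lemma integN f : integ f -> integ (fun x => - f x).
Proof. by move=> F; have := integrableN F. Qed.

Lemma integ_abs f : integ f -> integ (fun x => `|f x|).
Proof. by move=> F; have := integrable_abse F. Qed.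

Lemma integ_le f g : integ g -> measurable_fun setT f ->
  (forall x, `|f x| <= g x) -> integ f.
Proof.
move=> G mf fg; apply: (le_integrable measurableT _ _ G).
  exact/measurable_EFinP.
by move=> x _ /=; rewrite lee_fin (le_trans (fg x))// ler_norm.
Qed.

Lemma integ_indic f A : measurable A -> integ f -> integ (fun x => f x * \1_A x).
Proof.
move=> mA F; apply: (integ_le (integ_abs F)).
  by apply: measurable_funM; [exact: integ_measurable|exact: measurable_indic].
move=> x; rewrite normrM indicE; case: (x \in A) => /=; first by rewrite normr1 mulr1.
by rewrite normr0 mulr0.
Qed.

Lemma aut_integ T S f : aut mu T S -> integ f -> integ (f \o T).
Proof.
move=> aT F; have [mT _ _ _ _] := aT.
have /integrableP [mf fi] := F.
apply/integrableP; split.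
  by apply: (measurableT_comp mf mT).
have := @aut_ge0_integral T S setT (fun x => `|(f x)%:E|%E) aT measurableT.
rewrite preimage_setT => -> //; exact: measurableT_comp.
Qed.

Lemma aut_Rintegral T S f A : aut mu T S -> measurable A -> integ f ->
  \int[mu]_(x in T @^-1` A) f (T x) = \int[mu]_(x in A) f x.
Proof.
move=> aT mA F; have [mT _ _ _ muT] := aT.
rewrite /Rintegral; congr fine.
have mF : measurable_fun setT (EFin \o f) by case/integrableP : F.
have FT : mu.-integrable (T @^-1` A) ((EFin \o f) \o T).
  by apply: integrableS (aut_integ aT F) => //; exact: (aut_measurable aT).
have <- : (\int[pushforward mu T]_(x in A) (f x)%:E =
    \int[mu]_(x in T @^-1` A) (f (T x))%:E)%E.
  by rewrite (integral_pushforward mT mF FT).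
by apply: eq_measure_integral => B mB _; exact: muT.
Qed.

Lemma measurable_le_set f g : measurable_fun setT f -> measurable_fun setT g ->
  measurable [set x | f x <= g x].
Proof.
by move=> mf mg; rewrite -[X in measurable X]setTI; exact: measurable_fun_le.
Qed.

Lemma measurable_lt_set f g : measurable_fun setT f -> measurable_fun setT g ->
  measurable [set x | f x < g x].
Proof.
move=> mf mg; have -> : [set x | f x < g x] = ~` [set x | g x <= f x].
  by apply/seteqP; split=> x /=; rewrite ltNge => /negP.
by apply: measurableC; exact: measurable_le_set.
Qed.

Lemma Rintegral_split A f : measurable A -> integ f ->
  \int[mu]_x f x = \int[mu]_(x in A) f x + \int[mu]_(x in ~` A) f x.
Proof.
move=> mA If; rewrite -(setUv A) Rintegral_setU ?setUv//.
  exact: measurableC.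
exact/disj_setPCl.
Qed.

Lemma RintegralN A f : measurable A -> integ f ->
  \int[mu]_(x in A) - f x = - \int[mu]_(x in A) f x.
Proof.
move=> mA If; under eq_Rintegral do rewrite -mulN1r.
by rewrite RintegralZl ?mulN1r//; exact: integ_sub.
Qed.

End Integrals.

(** * Towers *)

Section Towers.
Context {R : realType} {d : measure_display} {X : measurableType d}.
Variable mu : probability X R.
Implicit Types (B : set X) (k : X -> X) (f g : X -> R).

(** Equivalently, [k] agrees with the automorphism [r' j] on the points of label [j]: it is
    piecewise measure preserving without being injective. Measurability and change of variables for
    sums over classes rest on this. *)
Definition labelling k (l : X -> nat) (r r' : nat -> X -> X) : Prop :=
  [/\ forall j, measurable (l @^-1` [set j]),
      forall j, aut mu (r j) (r' j) &
      forall x, r (l x) (k x) = x].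

(* [k] sends each point to the representative, in [B'], of its finite class; a labelling
   recovers the classes by means of countably many automorphisms. *)
Record tower B B' k : Prop := Tower {
  tower_meas : measurable B' ;
  tower_sub : B' `<=` B ;
  tower_fun : measurable_fun setT k ;
  tower_out : forall x, ~ B x -> k x = x ;
  tower_in : forall x, B x -> B' (k x) ;
  tower_fix : forall x, B' x -> k x = x ;
  tower_fin : forall b, finite_set (k @^-1` [set b]) ;
  tower_lab : exists l r r', labelling k l r r' }.

Lemma tower_idem B B' k x : tower B B' k -> k (k x) = k x.
Proof.
move=> t; have [Bx|Bx] := pselect (B x).
  by rewrite (tower_fix t)//; exact: (tower_in t).
by rewrite !(tower_out t).
Qed.

Lemma tower_id B : measurable B -> tower B B id.
Proof.
move=> mB; split=> //.
  by move=> b; rewrite preimage_id; exact: finite_set1.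
exists (fun=> 0%N), (fun=> id), (fun=> id); split=> // j.
by rewrite preimage_cst; case: ifP.
Qed.

(** Pairs of labels, coded as natural numbers, label the composite: [r2 j] undoes [k'], then [r i]
    undoes [k]. *)
Lemma tower_comp B B' B'' k k' : tower B B' k -> tower B' B'' k' ->
  tower B B'' (k' \o k).
Proof.
move=> t t'; split.
- exact: (tower_meas t').
- by apply: subset_trans (tower_sub t); exact: (tower_sub t').
- by apply: measurableT_comp; [exact: (tower_fun t')|exact: (tower_fun t)].
- move=> x Bx /=; rewrite (tower_out t)// (tower_out t')//.
  by move/(tower_sub t).
- by move=> x Bx; apply: (tower_in t'); exact: (tower_in t).
- move=> x B''x /=; rewrite (tower_fix t) ?(tower_fix t')//.
  exact: (tower_sub t').
- move=> b; have -> : (k' \o k) @^-1` [set b] =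
      \bigcup_(c in k' @^-1` [set b]) (k @^-1` [set c]).
    apply/seteqP; split=> [x /= <-|x [c /= <- <-]//].
    by exists (k x).
  by apply: bigcup_finite => [|c _]; [exact: (tower_fin t')|exact: (tower_fin t)].
have [l [r [r' [ml ar rl]]]] := tower_lab t.
have [l2 [r2 [r2' [ml2 ar2 rl2]]]] := tower_lab t'.
exists (fun x => pickle (l x, l2 (k x))).
exists (fun n => if @unpickle (nat * nat)%type n is Some ij then r ij.1 \o r2 ij.2 else id).
exists (fun n => if @unpickle (nat * nat)%type n is Some ij then r2' ij.2 \o r' ij.1 else id).
split.
- move=> n.
  have [[[i j]] e|ne] := pselect (exists ij : nat * nat, pickle ij = n).
    have -> : (fun x => pickle (l x, l2 (k x))) @^-1` [set n] =
        l @^-1` [set i] `&` k @^-1` (l2 @^-1` [set j]).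
      apply/seteqP; split=> x /=.
        rewrite -e => /(congr1 (@unpickle (nat * nat)%type)).
        by rewrite !pickleK => -[-> ->].
      by move=> [-> ->].
    apply: measurableI => //; rewrite -[_ @^-1` _]setTI.
    by apply: (tower_fun t).
  rewrite (_ : _ @^-1` _ = set0)//; apply/seteqP; split=> // x /= xn.
  by apply: ne; exists (l x, l2 (k x)).
- move=> n; case: unpickle => [[i j]|]; last exact: aut_id.
  exact: aut_comp.
- by move=> x; rewrite pickleK /= rl2 rl.
Qed.

Definition fsum k f (b : X) : R := \sum_(x \in k @^-1` [set b]) f x.

Lemma fsum_seq k f b (s : seq X) : uniq s ->
  (forall x, k x = b <-> x \in s) -> fsum k f b = \sum_(x <- s) f x.
Proof.
move=> us ks; rewrite fsbig_seq// /fsum; apply: eq_fsbigl.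
by apply/seteqP; split=> x /=; rewrite ks.
Qed.

(** A point of [B] outside [B'] has an empty fibre; a point outside [B] is alone in its fibre, and
    [f] vanishes there. *)
Lemma fsum_out B B' k f b : tower B B' k -> (forall x, ~ B x -> f x = 0) ->
  ~ B' b -> fsum k f b = 0.
Proof.
move=> t f0 B'b; have [Bb|Bb] := pselect (B b).
  rewrite /fsum (_ : _ @^-1` _ = set0) ?fsbig_set0//.
  apply/seteqP; split=> // y /= e; apply: B'b; rewrite -e.
  by have [By|By] := pselect (B y); [exact: (tower_in t)|move: (By); rewrite -(tower_out t By) e].
rewrite /fsum (_ : _ @^-1` _ = [set b]) ?fsbig_set1 ?f0//.
apply/seteqP; split=> y /=; last by move=> ->; exact: (tower_out t).
have [By|By] := pselect (B y); last by rewrite (tower_out t).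
by move=> e; exfalso; apply: B'b; rewrite -e; exact: (tower_in t).
Qed.

Lemma finite_natsum (J : set nat) (a : nat -> R) : finite_set J ->
  exists N, forall n, (N <= n)%N ->
    \sum_(j < n) a j * ((j : nat) \in J)%:R = \sum_(j \in J) a j.
Proof.
move=> fJ; exists (\max_(j <- finmap.enum_fset (fset_set J)) j)%N.+1 => n Nn.
rewrite (fsbig_ord _ n (fun j => a j * (j \in J)%:R)).
rewrite -(@fsbig_widen _ _ _ _ J).
- by apply: eq_fsbigr => j Jj; rewrite Jj mulr1.
- move=> j Jj /=; apply: leq_trans Nn; rewrite ltnS.
  by rewrite (bigD1_seq j) ?leq_maxl//= ?finmap.fset_uniq// in_fset_set// inE.
- by move=> j /= [_ Jj]; rewrite memNset// mulr0.
Qed.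

Section labelled.
Variables (B B' : set X) (k : X -> X) (t : tower B B' k).
Variables (l : X -> nat) (r r' : nat -> X -> X) (kl : labelling k l r r').

(** Injectivity of [r j] gives this. The labels occurring in the class of [b] can thus be read off
    without mentioning [k]. *)
Lemma labelP j b : l (r j b) = j <-> k (r j b) = b /\ l (r j b) = j.
Proof.
have [_ ar rl] := kl; split=> [lj|[]//]; split=> //.
have [_ _ rK _ _] := ar j.
by apply: (can_inj rK); rewrite -{1}lj rl.
Qed.

Lemma finite_labels b : finite_set [set j | l (r j b) = j].
Proof.
apply: (@sub_finite_set _ _ (l @` (k @^-1` [set b]))).
  by move=> j /= lj; exists (r j b) => //=; have [] := (labelP j b).1 lj.
by apply: finite_image; exact: (tower_fin t).
Qed.

Lemma fsum_label f b : fsum k f b = \sum_(j \in [set j | l (r j b) = j]) f (r j b).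
Proof.
have [_ _ rl] := kl.
apply: reindex_fsbig; split.
- by move=> j /= /labelP[].
- by move=> i j; rewrite !inE /= => li lj ij; rewrite -li -lj ij.
- by move=> x /= kx; exists (l x) => /=; rewrite -kx rl.
Qed.

(** Classes are finite, so the sums in the order of labels are eventually constant. Fibre sums
    become pointwise limits of finite sums of measurable functions, although no bound on the size of
    the classes is available. *)
Lemma fsum_partial f b : exists N, forall n, (N <= n)%N ->
  \sum_(j < n) f (r j b) * (l (r j b) == j)%:R = fsum k f b.
Proof.
have [N HN] := finite_natsum (fun j => f (r j b)) (finite_labels b).
exists N => n Nn; rewrite fsum_label -(HN n Nn).
apply: eq_bigr => j _; congr (_ * _%:R); congr nat_of_bool.
by apply/eqP/idP; rewrite inE.
Qed.

Lemma measurable_term f j : measurable_fun setT f ->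
  measurable_fun setT (fun b => f (r j b) * (l (r j b) == j)%:R).
Proof.
have [ml ar rl] := kl; have [mr _ _ _ _] := ar j.
move=> mf; apply: measurable_funM; first exact: measurableT_comp.
have -> : (fun b => (l (r j b) == j)%:R) = \1_(r j @^-1` (l @^-1` [set j])) :> (X -> R).
  apply/funext => b; rewrite indicE; congr (_%:R); congr nat_of_bool.
  by apply/eqP/idP; rewrite inE.
by apply: measurable_indic; apply: aut_measurable (ar j) _.
Qed.

Lemma measurable_fsum_lab f : measurable_fun setT f -> measurable_fun setT (fsum k f).
Proof.
move=> mf; apply: (@measurable_fun_cvg _ _ _ _
  (fun n b => \sum_(j < n) f (r j b) * (l (r j b) == j)%:R)).
  by move=> n; apply: measurable_sum => j; exact: measurable_term.
move=> b _; have [N HN] := fsum_partial f b.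
apply: cvg_near_cst; near=> n; apply: HN.
by near: n; exists N.
Unshelve. all: by end_near. Qed.

Lemma fsum_ge0 f b : (forall x, 0 <= f x) -> 0 <= fsum k f b.
Proof.
move=> f0; have [N HN] := fsum_partial f b; rewrite -(HN N)//.
by apply: sumr_ge0 => j _; rewrite mulr_ge0.
Qed.

(** The domain is cut by labels; on label [j] the automorphism [r j] moves the integral to [A], and
    the pieces add up because the integrands are nonnegative. *)
Lemma fsum_ge0_lab f A : measurable_fun setT f -> (forall x, 0 <= f x) ->
  measurable A ->
  (\int[mu]_(x in k @^-1` A) (f x)%:E = \int[mu]_(x in A) (fsum k f x)%:E)%E.
Proof.
move=> mf f0 mA.
have mkA : measurable (k @^-1` A).
  by rewrite -[_ @^-1` _]setTI; exact: (tower_fun t).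
have [ml ar rl] := kl.
have kAE : k @^-1` A = \bigcup_j (k @^-1` A `&` l @^-1` [set j]).
  by apply/seteqP; split=> [x kx|x [j _ []]//]; exists (l x).
rewrite [in LHS]kAE ge0_integral_bigcup => //=; first last.
- apply/trivIsetP => i j _ _ ij; apply/seteqP; split=> // x [[_ /= xi] [_ /= xj]].
  by move: ij; rewrite -xi -xj eqxx.
- by move=> x _; rewrite lee_fin.
- by apply: measurable_funTS; apply/measurable_EFinP.
- by move=> j; apply: measurableI.
transitivity (\sum_(0 <= j <oo) \int[mu]_(x in A) (f (r j x) * (l (r j x) == j)%:R)%:E)%E.
  apply: eq_eseriesr => j _.
  rewrite -(aut_ge0_integral (ar j)); last 3 first.
  - exact: measurableI.
  - exact/measurable_EFinP.
  - by move=> x; rewrite lee_fin.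
  rewrite (_ : r j @^-1` _ = A `&` [set x | l (r j x) = j]).
    rewrite integral_mkcondr; apply: eq_integral => x xA.
    rewrite /patch; case: ifPn => [|].
      by rewrite inE /= => ->; rewrite eqxx mulr1.
    by rewrite notin_setE /= => /eqP/negbTE ->; rewrite mulr0.
  apply/seteqP; split=> x /= [].
    by move=> kA lj; split=> //; have [<-] := (labelP j x).1 lj.
  by move=> Ax lj; split=> //; have [->] := (labelP j x).1 lj.
rewrite -integral_nneseries => //.
- apply: eq_integral => x _; have [N HN] := fsum_partial f x.
  apply: cvg_lim => //; apply: cvg_near_cst; near=> n.
  rewrite sumEFin big_mkord HN//; near: n; by exists N.
- move=> n; apply: measurable_funTS; apply/measurable_EFinP; exact: measurable_term.
- by move=> n x _; rewrite lee_fin mulr_ge0.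
Unshelve. all: by end_near. Qed.

Lemma fsumD f g b : fsum k (fun x => f x + g x) b = fsum k f b + fsum k g b.
Proof.
have [N1 H1] := fsum_partial f b; have [N2 H2] := fsum_partial g b.
have [N3 H3] := fsum_partial (fun x => f x + g x) b.
pose N := (N1 + N2 + N3)%N.
have N1N : (N1 <= N)%N by rewrite /N -addnA leq_addr.
have N2N : (N2 <= N)%N by rewrite /N addnAC leq_addl.
rewrite -(H1 N)// -(H2 N)// -(H3 N) ?leq_addl// -big_split; apply: eq_bigr => j _.
by rewrite mulrDl.
Qed.

Lemma fsumN f b : fsum k (fun x => - f x) b = - fsum k f b.
Proof.
have [N1 H1] := fsum_partial f b.
have [N3 H3] := fsum_partial (fun x => - f x) b.
pose N := (N1 + N3)%N.
rewrite -(H1 N) ?leq_addr// -(H3 N) ?leq_addl// -sumrN; apply: eq_bigr => j _.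
by rewrite mulNr.
Qed.

End labelled.

Lemma measurable_fsum B B' k f : tower B B' k -> measurable_fun setT f ->
  measurable_fun setT (fsum k f).
Proof. by move=> t; have [l [r [r' kl]]] := tower_lab t; move=> mf; exact: (measurable_fsum_lab t kl mf). Qed.

Lemma fsum_ge0_integral B B' k f A : tower B B' k -> measurable_fun setT f ->
  (forall x, 0 <= f x) -> measurable A ->
  (\int[mu]_(x in k @^-1` A) (f x)%:E = \int[mu]_(x in A) (fsum k f x)%:E)%E.
Proof. by move=> t; have [l [r [r' kl]]] := tower_lab t; move=> *; exact: (fsum_ge0_lab t kl). Qed.

(* [g] is the density of the image under [k] of the signed measure of density [f]. *)
Definition pushes k f g : Prop := integ mu g /\
  forall A, measurable A ->
    \int[mu]_(x in k @^-1` A) f x = \int[mu]_(x in A) g x.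

Lemma fsum_integ B B' k f : tower B B' k -> integ mu f -> integ mu (fsum k f).
Proof.
move=> t If; have mf := integ_measurable If.
have [l [r [r' kl]]] := tower_lab t.
apply: (@integ_le _ _ _ _ _ (fsum k (fun x => `|f x|))).
- have /integrableP[_ fi] := If.
  apply/integrableP; split.
    by apply/measurable_EFinP; apply: measurable_fsum t _; exact: measurableT_comp.
  rewrite (eq_integral (fun x => (fsum k (fun x => `|f x|) x)%:E)); last first.
    by move=> x _ /=; rewrite ger0_norm// (fsum_ge0 t kl).
  rewrite -(fsum_ge0_integral t)//.
    exact: measurableT_comp.
- exact: measurable_fsum t mf.
move=> b; have [N1 H1] := fsum_partial t kl f b.
have [N2 H2] := fsum_partial t kl (fun x => `|f x|) b.
rewrite -(H1 (N1 + N2)%N) ?leq_addr// -(H2 (N1 + N2)%N) ?leq_addl//.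
apply: le_trans (ler_norm_sum _ _ _) _; apply: ler_sum => j _.
by rewrite normrM [`|_%:R|]ger0_norm.
Qed.

Lemma pushes_fsum B B' k f : tower B B' k -> integ mu f -> pushes k f (fsum k f).
Proof.
move=> t If; have mf := integ_measurable If.
have [l [r [r' kl]]] := tower_lab t.
split=> [|A mA]; first exact: fsum_integ t If.
have mkA : measurable (k @^-1` A).
  by rewrite -[_ @^-1` _]setTI; exact: (tower_fun t).
have pos g : integ mu g -> (forall x, 0 <= g x) ->
    \int[mu]_(x in k @^-1` A) g x = \int[mu]_(x in A) fsum k g x.
  move=> Ig g0; rewrite /Rintegral (fsum_ge0_integral t)//; exact: integ_measurable Ig.
pose fp x := Num.max (f x) 0; pose fn x := Num.max (- f x) 0.
have fE : f = fun x => fp x + - fn x.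
  by apply/funext => x; rewrite /fp /fn; case: (leP (f x) 0); case: (leP (- f x) 0); lra.
have Ifp : integ mu fp.
  apply: (integ_le (integ_abs If)).
    by apply: measurable_maxr => //; exact: measurable_cst.
  by move=> x; rewrite /fp; case: (leP (f x) 0) => h; rewrite ?normr0.
have Ifn : integ mu fn.
  apply: (integ_le (integ_abs If)).
    by apply: measurable_maxr; [exact: measurableT_comp|exact: measurable_cst].
  by move=> x; rewrite /fn; case: (leP (- f x) 0) => h; rewrite ?normr0// normrN.
have fp0 x : 0 <= fp x by rewrite /fp le_max lexx orbT.
have fn0 x : 0 <= fn x by rewrite /fn le_max lexx orbT.
have sE : fsum k f = fun x => fsum k fp x - fsum k fn x.
  by apply/funext => x; rewrite [in LHS]fE (fsumD t kl) (fsumN t kl).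
rewrite [in LHS]fE RintegralB; first last.
- exact: integ_sub.
- exact: integ_sub.
- exact: mkA.
rewrite pos// pos// sE RintegralB//; apply: integ_sub => //; exact: fsum_integ t _.
Qed.

Lemma pushes_comp k k' f g h : measurable_fun setT k' ->
  pushes k f g -> pushes k' g h -> pushes (k' \o k) f h.
Proof.
move=> mk' [_ fg] [hi gh]; split=> // A mA.
by rewrite comp_preimage fg ?gh// -[_ @^-1` _]setTI; exact: mk'.
Qed.

Lemma pushes_unique k f g h : pushes k f g -> pushes k f h ->
  \forall x \ae mu, g x = h x.
Proof.
move=> [gi fg] [hi fh].
have /= := @integral_ae_eq _ _ _ mu setT measurableT (EFin \o h) (EFin \o g) gi.
case=> [||N [mN N0 sN]].
- by case/integrableP : hi.
- move=> E _ mE; have fin F : integ mu F -> (\int[mu]_(x in E) (F x)%:E)%E \is a fin_num.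
    by move=> Fi; apply: integrable_fin_num => //; exact: integ_sub.
  rewrite -(fineK (fin _ gi)) -(fineK (fin _ hi)); congr (_%:E).
  by have := fg _ mE; rewrite fh.
exists N; split=> //; apply: subset_trans sN => x /= gh; apply: contra_not gh.
by move=> /(_ I) [].
Qed.

Lemma pushesD k f g f' g' : measurable_fun setT k -> integ mu f -> integ mu g ->
  pushes k f f' -> pushes k g g' ->
  pushes k (fun x => f x + g x) (fun x => f' x + g' x).
Proof.
move=> mk If Ig [If' ff'] [Ig' gg']; split; first exact: integD.
move=> A mA; have mkA : measurable (k @^-1` A).
  by rewrite -[_ @^-1` _]setTI; exact: mk.
by rewrite !RintegralD//; [rewrite ff' ?gg'|exact: integ_sub..].
Qed.

(** The image of a signed measure has no larger total variation: on each of the sets [g >= 0] and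
    [g < 0], the integral of [|g|] is that of [f] or of [- f] over a preimage. *)
Lemma pushes_norm k f g : measurable_fun setT k -> integ mu f -> pushes k f g ->
  \int[mu]_x `|g x| <= \int[mu]_x `|f x|.
Proof.
move=> mk If [Ig fg].
pose P := [set x | 0 <= g x].
have mP : measurable P.
  apply: measurable_le_set; first exact: measurable_cst.
  exact: integ_measurable Ig.
have mCP : measurable (~` P) by exact: measurableC.
have mpre A : measurable A -> measurable (k @^-1` A).
  by move=> mA; rewrite -[_ @^-1` _]setTI; exact: mk.
rewrite (Rintegral_split mP (integ_abs Ig)) (Rintegral_split (mpre _ mP) (integ_abs If)).
apply: lerD.
  rewrite (@eq_Rintegral _ _ _ mu _ g); last by move=> x; rewrite inE => /= ?; rewrite ger0_norm.
  rewrite -fg// le_Rintegral//; [exact: mpre|exact: integ_sub (mpre _ mP) _| |].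
    by apply: integ_sub (integ_abs If); exact: mpre.
  by move=> x _; exact: ler_norm.
rewrite (@eq_Rintegral _ _ _ mu _ (fun x => - g x)); last first.
  by move=> x; rewrite inE => /= /negP; rewrite -ltNge => ?; rewrite ltr0_norm.
rewrite RintegralN// -fg// -RintegralN; [|exact: mpre|exact: If].
apply: le_Rintegral.
- exact: mpre.
- by apply: integ_sub (integN If); exact: mpre.
- by apply: integ_sub (integ_abs If); exact: mpre.
- by move=> x _; rewrite -normrN ler_norm.
Qed.

End Towers.

(** * Attaching points to a set *)

Section Assignments.
Context {R : realType} {d : measure_display} {X : measurableType d}.
Variable mu : probability X R.
Implicit Types (B C D U V : set X) (k : X -> X) (f g : X -> R).

(** The exchange is exact between [C0] and [D0] and says nothing about the null remainders, because
    standard spaces are identified with the interval only up to null sets. The involution [s] is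
    nevertheless an automorphism of all of [X]. *)
Record swap C D (s : X -> X) C0 D0 : Prop := Swap {
  swap_aut : aut mu s s ;
  swap_measl : measurable C0 ;
  swap_measr : measurable D0 ;
  swap_subl : C0 `<=` C ;
  swap_subr : D0 `<=` D ;
  swap_nulll : mu (C `\` C0) = 0%E ;
  swap_nullr : mu (D `\` D0) = 0%E ;
  swap_funl : forall x, C0 x -> D0 (s x) ;
  swap_funr : forall x, D0 x -> C0 (s x) }.

Definition swappable := forall C D, measurable C -> measurable D ->
  C `&` D = set0 -> mu C = mu D -> exists s C0 D0, swap C D s C0 D0.

(** Countably many pieces at once are needed for unbounded [f], whose values may occupy infinitely
    many levels; bounded functions need only finitely many. *)
Definition splittable := forall U (a : nat -> R), measurable U ->
  (forall i, 0 <= a i) -> (forall n, (\sum_(i < n) a i)%:E <= mu U)%E ->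
  exists V : nat -> set X,
    [/\ forall i, measurable (V i), trivIset setT V, forall i, V i `<=` U &
        forall i, mu (V i) = (a i)%:E].

Section assign.
Variables (B U : set X) (s : nat -> X -> X) (C0 D0 E : nat -> set X).
Hypotheses (mB : measurable B) (UB : U `<=` B)
  (sa : forall l, aut mu (s l) (s l))
  (mD : forall l, measurable (D0 l)) (mE : forall l, measurable (E l))
  (EC : forall l, E l `<=` C0 l) (CU : forall l, C0 l `<=` U)
  (DB : forall l, D0 l `<=` B) (DU : forall l x, D0 l x -> ~ U x)
  (sC : forall l x, C0 l x -> D0 l (s l x))
  (tD : forall i j x, D0 i x -> D0 j x -> i = j)
  (Efin : forall x, exists N, forall l, (N <= l)%N -> ~ E l x).

(* A point of [D0 l] joins the class of the point of [U] that [s l] exchanges it with, when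
   the latter is in [E l]. *)
Definition assigned l := D0 l `&` s l @^-1` E l.
(** Label [0] marks the points that stay put, [l.+1] those moved by [s l]; disjointness of the sets
    [D0 l] makes the label unambiguous. *)
Definition assign_lab x : nat :=
  if pselect (exists l, assigned l x) is left e then (projT1 (cid e)).+1 else 0%N.
Definition assign_map x :=
  if assign_lab x is l.+1 then s l x else x.
Definition assign_base := B `\` \bigcup_l assigned l.

Lemma assign_labS x l : assign_lab x = l.+1 <-> assigned l x.
Proof.
rewrite /assign_lab; case: pselect => [e|ne]; split.
- by case: cid => m /= am [<-].
- move=> al; case: cid => m /= am; congr S; apply: tD am.1 al.1.
- by [].
- by move=> al; exfalso; apply: ne; exists l.
Qed.

Lemma measurable_assigned l : measurable (assigned l).
Proof. by apply: measurableI => //; exact: aut_measurable. Qed.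

Lemma assign_lab0 x : assign_lab x = 0%N <-> ~ (\bigcup_l assigned l) x.
Proof.
split=> [e [l _ /assign_labS]|ne]; first by rewrite e.
case e : (assign_lab x) => [//|l]; exfalso; apply: ne; exists l => //.
exact/assign_labS.
Qed.

Lemma assignP b x : assign_base b ->
  (assign_map x = b <-> x = b \/ exists l, E l b /\ x = s l b).
Proof.
move=> bb; split.
  rewrite /assign_map; case e : (assign_lab x) => [|l]; first by left.
  move/assign_labS : e => [Dx Ex] sx; right; exists l; rewrite -sx; split=> //.
  by have [_ _ sK _ _] := sa l; rewrite sK.
move=> [->|[l [Eb ->]]].
  by rewrite /assign_map (assign_lab0 b).2//; case: bb.
have [_ _ sK _ _] := sa l.
have /assign_labS e : assigned l (s l b).
  by split; [apply: sC; exact: EC|rewrite /= sK].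
by rewrite /assign_map e sK.
Qed.

(** A moved point lands in [U], and points of [U] lie in no [D0 l], hence are not moved: a single
    move reaches the representative. Classes are finite because each point lies in [E l] for
    finitely many [l] only. *)
Lemma assign_tower : tower mu B assign_base assign_map.
Proof.
have mU : measurable (\bigcup_l assigned l).
  by apply: bigcupT_measurable; exact: measurable_assigned.
have ml j : measurable (assign_lab @^-1` [set j]).
  case: j => [|l].
    rewrite (_ : _ @^-1` _ = ~` \bigcup_l assigned l); first exact: measurableC.
    by apply/seteqP; split=> x /= /assign_lab0.
  rewrite (_ : _ @^-1` _ = assigned l); first exact: measurable_assigned.
  by apply/seteqP; split=> x /= /assign_labS.
pose r j := if j is l.+1 then s l else @id X.
have ar j : aut mu (r j) (r j).
  by case: j => [|l] /=; [exact: aut_id|exact: sa].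
have kE : assign_map = fun x => r (assign_lab x) x.
  by apply/funext => x; rewrite /assign_map /r; case: assign_lab.
have base0 x : ~ (\bigcup_l assigned l) x -> assign_map x = x.
  by move=> h; rewrite /assign_map (assign_lab0 x).2.
have Ub x : U x -> ~ (\bigcup_l assigned l) x.
  by move=> Ux [l _ [Dx _]]; exact: (DU Dx).
split.
- exact: measurableD.
- by move=> x [].
- rewrite kE; apply: measurable_piecewise => // j; by have [] := ar j.
- by move=> x Bx; apply: base0 => -[l _ [/DB]].
- move=> x Bx; have [[l _ al]|h] := pselect ((\bigcup_l assigned l) x).
    have /assign_labS e := al; rewrite /assign_map e.
    have Usx : U (s l x) by have [_ sE] := al; exact: CU (EC sE).
    by split; [exact: UB|exact: Ub].
  by rewrite base0.
- by move=> x [_]; exact: base0.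
- move=> b; have [bb|nb] := pselect (assign_base b \/ ~ B b); last first.
    rewrite (_ : _ @^-1` _ = set0); first exact: finite_set0.
    apply/seteqP; split=> // x /= xb; apply: nb.
    have [Bx|Bx] := pselect (B x).
      left; rewrite -xb /assign_map.
      case e : (assign_lab x) => [|l]; first by split=> //; exact/assign_lab0.
      have Usx : U (s l x) by move/assign_labS : e => [_ sE]; exact: CU (EC sE).
      by split; [exact: UB|exact: Ub].
    by right; rewrite -xb base0// => -[l _ [/DB]].
  case: bb => bb; last first.
    apply: (@sub_finite_set _ _ [set b]); last exact: finite_set1.
    move=> x /=; rewrite /assign_map; case e : (assign_lab x) => [//|l] sb.
    exfalso; apply: bb; rewrite -sb; apply: UB.
    by move/assign_labS : e => [_ sE]; exact: CU (EC sE).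
  have [N EN] := Efin b.
  apply: (@sub_finite_set _ _ ([set b] `|` (s ^~ b) @` `I_N)).
    move=> x /= /(assignP x bb)[->|[l [Eb ->]]]; [by left|right].
    by exists l => //=; rewrite ltnNge; apply/negP => /EN.
  by rewrite finite_setU; split; [exact: finite_set1|apply: finite_image; exact: finite_II].
exists assign_lab, r, r; split=> // x.
rewrite /assign_map /r; case: assign_lab => [//|l].
by have [_ _ sK _ _] := sa l; rewrite sK.
Qed.

Lemma fsum_assign f b (J : seq nat) : assign_base b -> uniq J ->
  (forall l, l \in J <-> E l b) ->
  fsum assign_map f b = f b + \sum_(l <- J) f (s l b).
Proof.
move=> bb uJ JE.
have inj : {in J &, injective (s ^~ b)}.
  move=> i j /JE/EC/sC Di /JE/EC/sC Dj ij; apply: tD Di _.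
  by rewrite ij.
rewrite (@fsum_seq _ _ _ _ _ _ (b :: [seq s l b | l <- J])).
- by rewrite big_cons big_map.
- rewrite /= map_inj_in_uniq// uJ andbT; apply/mapP => -[l /JE Eb e].
  apply: (DU (sC (EC Eb))); rewrite -e; exact: CU (EC Eb).
- move=> x; rewrite assignP// inE; split.
    move=> [->|[l [Eb ->]]]; first by rewrite eqxx.
    by apply/orP; right; apply/mapP; exists l => //; exact/JE.
  move=> /orP[/eqP|/mapP[l /JE Eb ->]]; first by left.
  by right; exists l.
Qed.

End assign.

End Assignments.

(** * Linking two sets *)

Section Linking.
Context {R : realType} {d : measure_display} {X : measurableType d}.
Variable mu : probability X R.
Implicit Types (B C D U V A Z : set X) (k : X -> X) (f g h : X -> R).

Local Notation m A := (fine (mu A)).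

Lemma fin_mu A : measurable A -> mu A \is a fin_num.
Proof. by move=> mA; exact: fin_num_measure. Qed.

Lemma mE A : measurable A -> mu A = (m A)%:E.
Proof. by move=> mA; rewrite fineK// fin_mu. Qed.

Lemma m_ge0 A : 0 <= m A. Proof. exact: fine_ge0. Qed.

Lemma m_le A C : measurable A -> measurable C -> A `<=` C -> m A <= m C.
Proof. by move=> mA mC AC; rewrite fine_le ?fin_mu// le_measure ?inE. Qed.

Lemma m_le1 A : measurable A -> m A <= 1.
Proof. by move=> mA; rewrite -lee_fin -mE// probability_le1. Qed.

Lemma mD A C : measurable A -> measurable C -> C `<=` A -> m (A `\` C) = m A - m C.
Proof.
move=> mA mC CA; rewrite measureD//; last by rewrite ltey_eq fin_mu.
by rewrite (setIidr CA) fineB ?fin_mu.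
Qed.

Lemma mU_le A C : measurable A -> measurable C -> m (A `|` C) <= m A + m C.
Proof.
move=> mA mC; rewrite -fineD ?fin_mu// fine_le ?fin_mu//.
- exact: measurableU.
- by rewrite fin_numD !fin_mu.
- exact: measureU2.
Qed.

Lemma integ_indicator A : measurable A -> integ mu (\1_A : X -> R).
Proof.
move=> mA; apply: (@integ_bounded _ _ _ mu _ 1); first exact: measurable_indic.
by move=> x; rewrite indicE; case: (x \in A); rewrite ?normr1// normr0.
Qed.

Lemma integZ f (c : R) : integ mu f -> integ mu (fun x => c * f x).
Proof. by move=> F; have := integrableZl measurableT c F. Qed.

Lemma Rintegral_indicator A : measurable A -> \int[mu]_x (\1_A x : R) = m A.
Proof. by move=> mA; rewrite /Rintegral integral_indic// setIT. Qed.

Lemma Rint_le f g : integ mu f -> integ mu g -> (forall x, f x <= g x) ->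
  \int[mu]_x f x <= \int[mu]_x g x.
Proof. by move=> If Ig fg; apply: le_Rintegral. Qed.

Lemma RintD f g : integ mu f -> integ mu g ->
  \int[mu]_x (f x + g x) = \int[mu]_x f x + \int[mu]_x g x.
Proof. by move=> If Ig; rewrite RintegralD. Qed.

Lemma RintZ f (c : R) : integ mu f -> \int[mu]_x (c * f x) = c * \int[mu]_x f x.
Proof. by move=> If; rewrite RintegralZl. Qed.

Lemma RintN f : integ mu f -> \int[mu]_x (- f x) = - \int[mu]_x f x.
Proof. by move=> If; rewrite RintegralN. Qed.

Lemma integ_sum (F : nat -> X -> R) (n : nat) : (forall i, integ mu (F i)) ->
  integ mu (fun x => \sum_(i < n) F i x) /\
  \int[mu]_x \sum_(i < n) F i x = \sum_(i < n) \int[mu]_x F i x.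
Proof.
move=> IF; elim: n => [|n [IHi IHn]].
  rewrite (_ : (fun x => _) = cst 0); last by apply/funext => x; rewrite big_ord0.
  split; first by apply: (@integ_bounded _ _ _ mu _ 0) => // x; rewrite normr0.
  by rewrite big_ord0 Rintegral_cst// mul0r.
rewrite (_ : (fun x => _) = (fun x => \sum_(i < n) F i x + F n x)); last first.
  by apply/funext => x; rewrite big_ord_recr.
by split; [exact: integD|rewrite RintD// IHn big_ord_recr].
Qed.

Lemma subset_measure U (a : R) : splittable mu -> measurable U -> 0 <= a ->
  a <= m U -> exists V, [/\ measurable V, V `<=` U & m V = a].
Proof.
move=> sp mU a0 aU.
have [|n|V [mV _ VU muV]] := sp U (fun i => if i == 0%N then a else 0) mU.
- by move=> i; case: ifP.
- rewrite (mE mU) lee_fin; case: n => [|n]; first by rewrite big_ord0 m_ge0.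
  by rewrite big_ord_recl /= big1 ?addr0.
by exists (V 0%N); split=> //; rewrite muV.
Qed.

(** The bound holds everywhere, not just almost everywhere: the choice of an order in each column is
    made point by point and relies on it. *)
Definition bounded_on B (e : R) f : Prop :=
  [/\ measurable_fun setT f, forall x, `|f x| <= e & forall x, ~ B x -> f x = 0].

Lemma bounded_integ B e f : bounded_on B e f -> integ mu f.
Proof. by move=> [mf fe _]; exact: integ_bounded fe. Qed.

Lemma pushes_ae k f g g' : pushes mu k f g -> measurable_fun setT g' ->
  (\forall x \ae mu, g x = g' x) -> pushes mu k f g'.
Proof.
move=> [Ig fg] mg' gg'.
have ee : ae_eq mu setT (EFin \o g) (EFin \o g').
  by apply: filterS gg' => x + _ /= => ->.
split.
  have [mg gi] := integrableP _ _ _ Ig.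
  apply/integrableP; split; first exact/measurable_EFinP.
  rewrite (_ : \int[mu]_x _ = \int[mu]_x `|(EFin \o g) x|)%E//.
  apply: ae_eq_integral => //.
  - by apply: measurableT_comp => //; exact/measurable_EFinP.
  - exact: measurableT_comp.
  - by apply: filterS gg' => x + _ /= => ->.
move=> A mA; rewrite fg// /Rintegral; congr fine.
apply: ae_eq_integral => //.
- by apply: measurable_funTS; exact: (measurable_int _ Ig).
- by apply: measurable_funTS; exact/measurable_EFinP.
- by apply: filterS gg' => x + _ => ->.
Qed.

(** Each point of [D0] joins the point of [C0] that [s] exchanges it with. The density differs from
    the fibre sum only on the null sets where the exchange fails, and all its values are [0], a
    value of [f] off [C] and [D], or a sum over a linked pair; bounds on these are then valid
    everywhere. *)
Lemma link B C D : swappable mu -> measurable B -> measurable C -> measurable D ->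
  C `<=` B -> D `<=` B -> C `&` D = set0 -> mu C = mu D ->
  exists B' k (s : X -> X) C0,
  [/\ tower mu B B' k, m B' = m B - m D,
      [/\ measurable C0, C0 `<=` C, (forall x, C0 x -> D (s x)) &
          measurable_fun setT s] &
      forall f, integ mu f -> (forall x, ~ B x -> f x = 0) ->
      [/\ pushes mu k f (fun x => f x * \1_(B `\` (C `|` D)) x
        + (f x + f (s x)) * \1_C0 x) &
        forall x, ~ B' x -> f x * \1_(B `\` (C `|` D)) x
          + (f x + f (s x)) * \1_C0 x = 0]].
Proof.
move=> sw mB mC mD' CB DB CD eCD.
have [s [C0 [D0 [sa mC0 mD0 CC DD nC nD sl sr]]]] := sw C D mC mD' CD eCD.
(* A family of exchanges with a single nonempty member, at index [0]. *)
pose ss (l : nat) := s; pose CC0 (l : nat) := if l == 0%N then C0 else set0.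
pose DD0 (l : nat) := if l == 0%N then D0 else set0.
have mDD l : measurable (DD0 l) by rewrite /DD0; case: ifP.
have mCC l : measurable (CC0 l) by rewrite /CC0; case: ifP.
have ECC l : CC0 l `<=` CC0 l by [].
have CUl l : CC0 l `<=` C0 by move=> x; rewrite /CC0; case: ifP.
have DBl l : DD0 l `<=` B by move=> x; rewrite /DD0; case: ifP => // _ /DD/DB.
have DUl l x : DD0 l x -> ~ C0 x.
  rewrite /DD0; case: ifP => // _ /DD Dx /CC Cx.
  by have : (C `&` D) x by []; rewrite CD.
have sCl l x : CC0 l x -> DD0 l (ss l x).
  by rewrite /CC0 /DD0; case: ifP => // _; exact: sl.
have tDl i j x : DD0 i x -> DD0 j x -> i = j.
  by rewrite /DD0; case: eqP => [->|//]; case: eqP => [->|//].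
have Efin x : exists N, forall l, (N <= l)%N -> ~ CC0 l x.
  by exists 1%N => -[//|l] _; rewrite /CC0 /= => -[].
have C0B : C0 `<=` B by move=> x /CC/CB.
have saa l : aut mu (ss l) (ss l) by [].
have t := assign_tower mB C0B saa mDD mCC ECC CUl DBl DUl sCl tDl Efin.
pose B' := assign_base B ss DD0 CC0; pose k := assign_map ss DD0 CC0.
have sK : cancel s s by case: sa.
have UE : \bigcup_l assigned ss DD0 CC0 l = D0.
  apply/seteqP; split=> [x [[|l] _ [] //]|x Dx].
  by exists 0%N => //; split=> //; exact: sr.
have B'E : B' = B `\` D0 by rewrite /B' /assign_base UE.
have CD' x : C x -> ~ D x by move=> Cx Dx; have : (C `&` D) x by []; rewrite CD.
exists B', k, s, C0; split.
- exact: t.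
- rewrite B'E mD//; last by move=> x /DD/DB.
  congr (_ - _); apply/eqP; rewrite eq_le m_le//=.
  rewrite -subr_le0 -mD// nD//.
- split=> //; first by move=> x /sl /DD.
  by case: sa.
move=> f If f0.
have F1 x : (B `\` (C `|` D)) x -> ~ C0 x by move=> [_ h] /CC Cx; apply: h; left.
split; last first.
  move=> x; rewrite B'E => nB.
  rewrite !indicE [x \in B `\` _]memNset; last first.
    by move=> [Bx h]; apply: nB; split=> // /DD Dx; apply: h; right.
  rewrite memNset ?mulr0 ?addr0// => C0x; apply: nB; split; first exact: C0B.
  by move=> /DD; exact/CD'/CC.
have mg : measurable_fun setT (fun x => f x * \1_(B `\` (C `|` D)) x
        + (f x + f (s x)) * \1_C0 x).
  have mf := integ_measurable If.
  apply: measurable_funD; apply: measurable_funM => //.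
  - by apply: measurable_indic; apply: measurableD => //; exact: measurableU.
  - by apply: measurable_funD => //; apply: measurableT_comp => //; case: sa.
apply: pushes_ae (pushes_fsum t If) mg _.
exists ((C `\` C0) `|` (D `\` D0)); split.
- by apply: measurableU; exact: measurableD.
- apply/eqP; rewrite eq_le measure_ge0 andbT.
  rewrite -[leRHS]adde0 -[X in (X + _)%E]nC -nD.
  by apply: measureU2; exact: measurableD.
move=> x /=; apply: contra_notP => /not_orP[nC0 nD0].
have [B'x|B'x] := pselect (B' x); last first.
  rewrite (fsum_out t f0 B'x) !indicE memNset; last first.
    by move=> [Bx h]; apply: B'x; rewrite B'E; split=> // /DD Dx; apply: h; right.
  rewrite memNset ?mulr0 ?addr0// => C0x; apply: B'x; rewrite B'E; split; first exact: C0B.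
  by move=> /DD; exact/CD'/CC.
have [Bx D0x] : (B `\` D0) x by rewrite -B'E.
have [C0x|C0x] := pselect (C0 x).
  have bb : assign_base B ss DD0 CC0 x.
    by [].
  rewrite (fsum_assign saa ECC CUl DUl sCl tDl f bb (J := [:: 0%N])) //.
    rewrite big_seq1 !indicE memNset; last by move/F1.
    by rewrite mem_set// mulr0 add0r mulr1.
  move=> l; rewrite inE; split; first by move/eqP ->.
  by rewrite /CC0; case: eqP.
rewrite !indicE [x \in C0]memNset// mulr0 addr0.
have nCx : ~ C x by move=> Cx; apply: nC0.
have Dx : ~ D x by move=> Dx; apply: nD0.
rewrite mem_set; last by split=> // -[].
have bb : assign_base B ss DD0 CC0 x by [].
rewrite (fsum_assign saa ECC CUl DUl sCl tDl f bb (J := [::])) //.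
  by rewrite big_nil addr0 mulr1.
by move=> l; split=> //; rewrite /CC0; case: ifP.
Qed.

(** Both functions must be carried by the same tower: [f] is the function to be written as a
    coboundary, [h] a test function for ergodicity. *)
Definition reach B f h B' f' h' : Prop :=
  exists k, [/\ tower mu B B' k, pushes mu k f f' & pushes mu k h h'].

Lemma reach_refl B f h : measurable B -> integ mu f -> integ mu h -> reach B f h B f h.
Proof.
by move=> mB If Ih; exists id; split; [exact: tower_id|split|split].
Qed.

Lemma reach_trans B f h B1 f1 h1 B2 f2 h2 :
  reach B f h B1 f1 h1 -> reach B1 f1 h1 B2 f2 h2 -> reach B f h B2 f2 h2.
Proof.
move=> [k [t pf ph]] [k' [t' pf' ph']]; exists (k' \o k); split.
- exact: tower_comp t t'.
- by apply: pushes_comp pf pf'; exact: (tower_fun t').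
- by apply: pushes_comp ph ph'; exact: (tower_fun t').
Qed.

Lemma reach_mean B f h B' f' h' : reach B f h B' f' h' ->
  \int[mu]_x f' x = \int[mu]_x f x /\ \int[mu]_x h' x = \int[mu]_x h x.
Proof.
by move=> [k [_ [_ pf] [_ ph]]]; split;
  [rewrite -pf ?preimage_setT|rewrite -ph ?preimage_setT].
Qed.

Lemma link_reach (e e' M M' : R) B C D f h : swappable mu -> splittable mu ->
  measurable B -> measurable C -> measurable D ->
  C `<=` B -> D `<=` B -> C `&` D = set0 -> m C = m D ->
  bounded_on B e f -> bounded_on B M h -> 0 <= e' -> 0 <= M' ->
  (forall x, ~ C x -> ~ D x -> `|f x| <= e' /\ `|h x| <= M') ->
  (forall x y, C x -> D y -> `|f x + f y| <= e' /\ `|h x + h y| <= M') ->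
  exists B' f' h', [/\ reach B f h B' f' h', bounded_on B' e' f',
     bounded_on B' M' h', m B' = m B - m D &
     forall x, [\/ f' x = 0 /\ h' x = 0,
        [/\ B x, ~ C x, ~ D x, f' x = f x & h' x = h x] |
        exists y, [/\ C x, D y, f' x = f x + f y & h' x = h x + h y]]].
Proof.
move=> sw sp mB mC mD' CB DB CD eCD bf bh e0 M0 out_ in_.
have mCD : mu C = mu D by rewrite (mE mC) (mE mD') eCD.
have [B' [k [s [C0 [t mB' [mC0 CC sD ms] H]]]]] := link sw mB mC mD' CB DB CD mCD.
have [mf fe f0] := bf; have [mh hM h0] := bh.
have [pf zf] := H f (bounded_integ bf) f0.
have [ph zh] := H h (bounded_integ bh) h0.
set f' := fun x => _ in pf; set h' := fun x => _ in ph.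
have cases x : [\/ f' x = 0 /\ h' x = 0,
        [/\ B x, ~ C x, ~ D x, f' x = f x & h' x = h x] |
        exists y, [/\ C x, D y, f' x = f x + f y & h' x = h x + h y]].
  have [C0x|C0x] := pselect (C0 x).
    apply: Or33; exists (s x); split; [exact: CC|exact: sD| |].
      rewrite /f' !indicE memNset; last by move=> [_ n]; apply: n; left; exact: CC.
      by rewrite mem_set// mulr0 add0r mulr1.
    rewrite /h' !indicE memNset; last by move=> [_ n]; apply: n; left; exact: CC.
    by rewrite mem_set// mulr0 add0r mulr1.
  have [Wx|Wx] := pselect ((B `\` (C `|` D)) x).
    have [Bx nCD] := Wx.
    apply: Or32; split=> //; [by move=> ?; apply: nCD; left|by move=> ?; apply: nCD; right| |].
      by rewrite /f' !indicE mem_set// memNset// mulr0 addr0 mulr1.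
    by rewrite /h' !indicE mem_set// memNset// mulr0 addr0 mulr1.
  by apply: Or31; rewrite /f' /h' !indicE !memNset// !mulr0 !addr0.
exists B', f', h'; split=> //.
- by exists k; split.
- split; [exact: integ_measurable pf.1| |exact: zf].
  move=> x; case: (cases x) => [[-> _]|[_ nC nD -> _]|[y [Cx Dy -> _]]].
  + by rewrite normr0.
  + by case: (out_ x nC nD).
  + by case: (in_ x y Cx Dy).
- split; [exact: integ_measurable ph.1| |exact: zh].
  move=> x; case: (cases x) => [[_ ->]|[_ nC nD _ ->]|[y [Cx Dy _ ->]]].
  + by rewrite normr0.
  + by case: (out_ x nC nD).
  + by case: (in_ x y Cx Dy).
Qed.

End Linking.

(** * Mixing *)

Section Mixing.
Context {R : realType} {d : measure_display} {X : measurableType d}.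
Variable mu : probability X R.
Hypotheses (sw : swappable mu) (sp : splittable mu).
Implicit Types (B C D U V A Z : set X) (k : X -> X) (f g h : X -> R).

Local Notation m A := (fine (mu A)).

(* [|h| <= 2 M 1_(P `|` Z) - h] pointwise, where [P] is the part of [B] outside [Z] on which [h > 0]. *)
Lemma abs_small_pos B Z h (M eta : R) : measurable B -> measurable Z ->
  bounded_on B M h -> \int[mu]_x h x = 0 ->
  m (B `&` ~` Z `&` [set x | 0 < h x]) <= eta ->
  \int[mu]_x `|h x| <= 2 * M * (eta + m Z).
Proof.
move=> mB mZ bh h0 sm; have Ih := bounded_integ mu bh; have [mh hM hB] := bh.
set P := (X in m X) in sm.
have mP : measurable P.
  apply: measurableI; first by apply: measurableI => //; exact: measurableC.
  by apply: measurable_lt_set => //; exact: measurable_cst.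
have M0 : 0 <= M by apply: le_trans (hM point); exact: normr_ge0.
have mPZ : measurable (P `|` Z) by exact: measurableU.
have IPZ := integ_indicator mu mPZ.
apply: (@le_trans _ _ (\int[mu]_x (2 * M * \1_(P `|` Z) x + - h x))).
  apply: Rint_le; [exact: integ_abs|by apply: integD; [exact: integZ|exact: integN]|].
  move=> x; rewrite indicE; have := hM x; rewrite ler_norml => /andP[h1 h2].
  have [PZx|PZx] := pselect ((P `|` Z) x).
    by rewrite mem_set//= mulr1; case: (ger0P (h x)) => ?; lra.
  rewrite memNset// mulr0 add0r.
  have [Bx|Bx] := pselect (B x); last by rewrite hB// normr0 oppr0.
  case: (ltP 0 (h x)) => hx; last by rewrite ler0_norm.
  exfalso; apply: PZx; have [Zx|Zx] := pselect (Z x); first by right.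
  by left.
rewrite RintD; [|exact: integZ|exact: integN].
rewrite RintN// h0 oppr0 addr0 RintZ// Rintegral_indicator//.
apply: ler_wpM2l; first by rewrite mulr_ge0.
by apply: le_trans (mU_le mu mP mZ) _; rewrite lerD2r.
Qed.

Lemma bounded_onN B M h : bounded_on B M h -> bounded_on B M (fun x => - h x).
Proof.
move=> [mh hM hB]; split; first exact: measurableT_comp.
  by move=> x; rewrite normrN.
by move=> x Bx; rewrite hB// oppr0.
Qed.

Lemma abs_small_neg B Z h (M eta : R) : measurable B -> measurable Z ->
  bounded_on B M h -> \int[mu]_x h x = 0 ->
  m (B `&` ~` Z `&` [set x | h x < 0]) <= eta ->
  \int[mu]_x `|h x| <= 2 * M * (eta + m Z).
Proof.
move=> mB mZ bh h0 sm.
have := @abs_small_pos B Z (fun x => - h x) M eta mB mZ (bounded_onN bh).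
rewrite RintN ?h0 ?oppr0; last exact: (bounded_integ _ bh).
move=> /(_ erefl); under eq_Rintegral do rewrite normrN.
apply; apply: le_trans sm; rewrite (_ : [set x | 0 < _] = [set x | h x < 0])//.
by apply/seteqP; split=> x /=; rewrite oppr_gt0.
Qed.

Lemma markov_abs f (c : R) : integ mu f -> 0 < c ->
  m [set x | c < `|f x|] <= (\int[mu]_x `|f x|) / c.
Proof.
move=> If c0; have mZ : measurable [set x | c < `|f x|].
  apply: measurable_lt_set; first exact: measurable_cst.
  by apply: measurableT_comp => //; exact: integ_measurable If.
rewrite ler_pdivlMr// mulrC -Rintegral_indicator// -RintZ; last exact: integ_indicator.
apply: Rint_le; [by apply: integZ; exact: integ_indicator|exact: integ_abs|].
move=> x; rewrite indicE; have [Zx|Zx] := pselect ([set x | c < `|f x|] x).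
  by rewrite mem_set// mulr1 ltW.
by rewrite memNset// mulr0.
Qed.

Definition pos B f := B `&` [set x | 0 <= f x].
Definition neg B f := B `&` [set x | f x < 0].

Lemma measurable_pos B f : measurable B -> measurable_fun setT f -> measurable (pos B f).
Proof. by move=> mB mf; apply: measurableI => //; apply: measurable_le_set => //; exact: measurable_cst. Qed.

Lemma measurable_neg B f : measurable B -> measurable_fun setT f -> measurable (neg B f).
Proof. by move=> mB mf; apply: measurableI => //; apply: measurable_lt_set => //; exact: measurable_cst. Qed.

Lemma opp_norm (a b e : R) : `|a| <= e -> `|b| <= e -> 0 <= a -> b < 0 -> `|a + b| <= e.
Proof. by rewrite !ler_norml => /andP[? ?] /andP[? ?] ? ?; apply/andP; split; lra. Qed.

(** Both sets are first cut down to measure [eta], so that every link lowers the measure of the base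
    by exactly [eta]; this bounds the number of links in the inductions below. *)
Lemma link_equal (e e' M M' eta : R) B C D f h :
  measurable B -> measurable C -> measurable D ->
  C `<=` B -> D `<=` B -> C `&` D = set0 -> 0 <= eta -> eta <= m C -> eta <= m D ->
  bounded_on B e f -> bounded_on B M h -> 0 <= e' -> 0 <= M' -> e <= e' -> M <= M' ->
  (forall x y, C x -> D y -> `|f x + f y| <= e' /\ `|h x + h y| <= M') ->
  exists B' f' h', [/\ reach mu B f h B' f' h', bounded_on B' e' f',
     bounded_on B' M' h', m B' = m B - eta &
     forall x, [\/ f' x = 0 /\ h' x = 0, f' x = f x /\ h' x = h x |
        exists y, [/\ C x, D y, f' x = f x + f y & h' x = h x + h y]]].
Proof.
move=> mB mC mD' CB DB CD eta0 eC eD bf bh e0 M0 ee MM H.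
have [C' [mC' CC' eC']] := subset_measure sp mC eta0 eC.
have [D' [mDD' DD' eD']] := subset_measure sp mD' eta0 eD.
have CD' : C' `&` D' = set0.
  by apply/seteqP; split=> // x [/CC' Cx /DD' Dx]; rewrite -CD.
have [_ fe _] := bf; have [_ hM _] := bh.
have [|||B' [f' [h' [r bf' bh' mB' cs]]]] := @link_reach _ _ _ mu e e' M M' B C' D' f h sw sp mB mC' mDD'
   (subset_trans CC' CB) (subset_trans DD' DB) CD' _ bf bh e0 M0.
- by rewrite eC' eD'.
- by move=> x _ _; split; [exact: le_trans ee|exact: le_trans MM].
- by move=> x y /CC' Cx /DD' Dy; exact: H.
exists B', f', h'; split=> //; first by rewrite mB' eD'.
move=> x; case: (cs x) => [?|[_ _ _ -> ->]|[y [Cx Dy -> ->]]]; first exact: Or31.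
  exact: Or32.
by apply: Or33; exists y; split=> //; [exact: CC'|exact: DD'].
Qed.

(** The signs of [f] and [h] divide the base into four quadrants. Linking two opposite quadrants
    adds values of opposite signs for both functions, so both bounds persist. When no link of
    measure [eta] is left, each of the two opposite pairs contains a quadrant of measure at most
    [eta]. *)
Lemma mix_quadrants (e M eta : R) (n : nat) B f h : 0 < eta -> measurable B ->
  bounded_on B e f -> bounded_on B M h -> m B <= n%:R * eta ->
  exists B' f' h', [/\ reach mu B f h B' f' h', bounded_on B' e f', bounded_on B' M h',
    m (pos (pos B' f') h') <= eta \/ m (neg (neg B' f') h') <= eta &
    m (pos (neg B' f') h') <= eta \/ m (neg (pos B' f') h') <= eta].
Proof.
move=> eta0; elim: n B f h => [|n IHn] B f h mB bf bh Bn.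
  exists B, f, h; have [mf _ _] := bf; have [mh _ _] := bh.
  have sub A : measurable A -> A `<=` B -> m A <= eta.
    move=> mA AB; apply: le_trans (m_le mu mA mB AB) _.
    by apply: le_trans Bn _; rewrite mul0r ltW.
  split=> //; first by apply: reach_refl => //; [exact: (bounded_integ _ bf)|exact: (bounded_integ _ bh)].
    left; apply: sub; last by move=> x [[]].
    by apply: measurable_pos => //; exact: measurable_pos.
  left; apply: sub; last by move=> x [[]].
  by apply: measurable_pos => //; exact: measurable_neg.
have [mf fe _] := bf; have [mh hM _] := bh.
have e0 : 0 <= e by apply: le_trans (fe point); exact: normr_ge0.
have M0 : 0 <= M by apply: le_trans (hM point); exact: normr_ge0.
have step C D : measurable C -> measurable D -> C `<=` B -> D `<=` B ->
    C `&` D = set0 -> eta < m C -> eta < m D ->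
    (forall x y, C x -> D y -> `|f x + f y| <= e /\ `|h x + h y| <= M) ->
    exists B' f' h', [/\ reach mu B f h B' f' h', bounded_on B' e f', bounded_on B' M h',
      m (pos (pos B' f') h') <= eta \/ m (neg (neg B' f') h') <= eta &
      m (pos (neg B' f') h') <= eta \/ m (neg (pos B' f') h') <= eta].
  move=> mC mD' CB DB CD eC eD H.
  have [B1 [f1 [h1 [r1 bf1 bh1 mB1 _]]]] := link_equal mB mC mD' CB DB CD (ltW eta0)
    (ltW eC) (ltW eD) bf bh e0 M0 (lexx _) (lexx _) H.
  have mB1' : measurable B1 by case: r1 => k [/tower_meas].
  have [|B' [f' [h' [r' bf' bh' c1 c2]]]] := IHn B1 f1 h1 mB1' bf1 bh1.
    by rewrite mB1; move: Bn; rewrite -natr1 mulrDl mul1r; lra.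
  by exists B', f', h'; split=> //; exact: reach_trans r1 r'.
have mpp : measurable (pos (pos B f) h) by apply: measurable_pos => //; exact: measurable_pos.
have mnn : measurable (neg (neg B f) h) by apply: measurable_neg => //; exact: measurable_neg.
have mpn : measurable (neg (pos B f) h) by apply: measurable_neg => //; exact: measurable_pos.
have mnp : measurable (pos (neg B f) h) by apply: measurable_pos => //; exact: measurable_neg.
have [c1|] := pselect (m (pos (pos B f) h) <= eta \/ m (neg (neg B f) h) <= eta); last first.
  move=> /not_orP[/negP + /negP]; rewrite -!ltNge => epp enn.
  apply: (step _ _ mpp mnn) => //.
  - by move=> x [[]].
  - by move=> x [[]].
  - by apply/seteqP; split=> // x [[_ /= h1] [_ /=]]; rewrite ltNge h1.
  - move=> x y [[Bx /= fx] /= hx] [[By /= fy] /= hy].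
    by split; apply: opp_norm.
have [c2|] := pselect (m (pos (neg B f) h) <= eta \/ m (neg (pos B f) h) <= eta); last first.
  move=> /not_orP[/negP + /negP]; rewrite -!ltNge => enp epn.
  apply: (step _ _ mpn mnp) => //.
  - by move=> x [[]].
  - by move=> x [[]].
  - by apply/seteqP; split=> // x [[[_ /= h1] _] [[_ /=] +]]; rewrite ltNge h1.
  - move=> x y [[Bx /= fx] /= hx] [[By /= fy] /= hy].
    by split; [exact: opp_norm|rewrite addrC; exact: opp_norm].
exists B, f, h; split=> //; apply: reach_refl => //; [exact: (bounded_integ _ bf)|exact: (bounded_integ _ bh)].
Qed.

(** Here points are linked by the sign of [h] alone, off the set [Z]. The values of [f] there may
    double at each link, but at most [n] links occur and [2 ^+ n * c <= e]. *)
Lemma mix_off (e M eta c : R) (n : nat) B Z f h : 0 < eta -> measurable B -> measurable Z ->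
  (forall x, ~ Z x -> `|f x| <= c) -> 2 ^+ n * c <= e -> 0 <= c ->
  bounded_on B e f -> bounded_on B M h -> m B <= n%:R * eta ->
  exists B' f' h', [/\ reach mu B f h B' f' h', bounded_on B' e f', bounded_on B' M h' &
    m (pos (B' `&` ~` Z) h') <= eta \/ m (neg (B' `&` ~` Z) h') <= eta].
Proof.
move=> eta0; elim: n c B f h => [|n IHn] c B f h mB mZ fc ce c0 bf bh Bn.
  exists B, f, h; have [mh _ _] := bh.
  split=> //; first by apply: reach_refl => //; [exact: (bounded_integ _ bf)|exact: (bounded_integ _ bh)].
  left; apply: (@le_trans _ _ (m B)); last by apply: le_trans Bn _; rewrite mul0r ltW.
  apply: m_le => //; last by move=> x [[]].
  by apply: measurable_pos => //; apply: measurableI => //; exact: measurableC.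
have [mf fe f0] := bf; have [mh hM h0] := bh.
have e0 : 0 <= e by apply: le_trans (fe point); exact: normr_ge0.
have M0 : 0 <= M by apply: le_trans (hM point); exact: normr_ge0.
have mBZ : measurable (B `&` ~` Z) by apply: measurableI => //; exact: measurableC.
have mP := measurable_pos mBZ mh; have mN := measurable_neg mBZ mh.
have [c1|] := pselect (m (pos (B `&` ~` Z) h) <= eta \/ m (neg (B `&` ~` Z) h) <= eta).
  by exists B, f, h; split=> //; apply: reach_refl => //; [exact: (bounded_integ _ bf)|exact: (bounded_integ _ bh)].
move=> /not_orP[/negP + /negP]; rewrite -!ltNge => eP eN.
have c2e : 2 * c <= e.
  apply: le_trans ce; rewrite exprS -mulrA ler_wpM2l// ler_peMl// exprn_ege1//.
  by rewrite ler1n.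
have [|||x y Cx Dy|B1 [f1 [h1 [r1 bf1 bh1 mB1 cs]]]] := @link_equal e e M M eta B _ _ f h mB mP mN _ _ _
  (ltW eta0) (ltW eP) (ltW eN) bf bh e0 M0 (lexx _) (lexx _).
- by move=> x [[]].
- by move=> x [[]].
- by apply/seteqP; split=> // x [[_ /= h1] [_ /=]]; rewrite ltNge h1.
- by move: Cx Dy => [[Bx Zx] /= hx] [[By Zy] /= hy]; split; [|exact: opp_norm];
    apply: le_trans (ler_normD _ _) _; apply: le_trans c2e; rewrite mulr2n mulrDl mul1r;
    apply: lerD; exact: fc.
have mB1' : measurable B1 by case: r1 => k [/tower_meas].
have [||||B' [f' [h' [r' bf' bh' c1]]]] := IHn (2 * c) B1 f1 h1 mB1' mZ _ _ _ bf1 bh1.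
- move=> x Zx; case: (cs x) => [[-> _]|[-> _]|[y [[[Bx _] _] [[By Zy] _] -> _]]].
  + by rewrite normr0 mulr_ge0.
  + by apply: le_trans (fc x Zx) _; lra.
  + apply: le_trans (ler_normD _ _) _; rewrite mulr2n mulrDl mul1r.
    by apply: lerD; exact: fc.
- by rewrite mulrA -exprSr.
- by rewrite mulr_ge0.
- by rewrite mB1; move: Bn; rewrite -natr1 mulrDl mul1r; lra.
by exists B', f', h'; split=> //; exact: reach_trans r1 r'.
Qed.

(** After [mix_quadrants] the two small quadrants are adjacent. If they share the sign of [h], then
    [h] is almost of one sign and, having mean zero, is small in mean. If they share the sign of
    [f], then [f] is small in mean, hence by Markov's inequality very small off a set [Z] of small
    measure, and [mix_off] makes [h] almost of one sign off [Z]. *)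
Lemma mixing (e M delta : R) B f h : 0 < e -> 0 < delta -> measurable B ->
  bounded_on B e f -> bounded_on B M h -> \int[mu]_x f x = 0 -> \int[mu]_x h x = 0 ->
  exists B' f' h', [/\ reach mu B f h B' f' h', bounded_on B' e f',
    bounded_on B' M h' & \int[mu]_x `|h' x| <= delta].
Proof.
move=> e0 delta0 mB bf bh f0 h0.
have [mh hM _] := bh.
have M0 : 0 <= M by apply: le_trans (hM point); exact: normr_ge0.
have mem1 A : measurable A -> m A <= 1 by exact: m_le1.
(* [K] bounds the number of links in the final application of [mix_off], made in pieces of measure
   [1 / K]; this choice makes [2 M / K] at most [delta / 2]. *)
have [K0 K0P] : exists K : nat, 4 * M / delta < K.+1%:R.
  by exists (Num.truncn (4 * M / delta)); exact: truncnS_gt.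
pose K := K0.+1; have K_gt0 : 0 < K%:R :> R by rewrite ltr0n.
(* The factor [2 ^+ K] compensates Markov's inequality below, which yields
   [m Z <= 4 * 2 ^+ K * eta]; [M + 1] replaces [M], which may be [0]. *)
pose eta := delta / (16 * (M + 1) * 2 ^+ K).
have p2 : 0 < (2 : R) ^+ K by rewrite exprn_gt0.
have p1 : 1 <= (2 : R) ^+ K by rewrite exprn_ege1// ler1n.
have M1 : 0 < M + 1 by lra.
have eta0 : 0 < eta by rewrite divr_gt0// mulr_gt0// mulr_gt0.
have etaE : 16 * (M + 1) * 2 ^+ K * eta = delta.
  by rewrite /eta mulrC divfK// gt_eqF// mulr_gt0// mulr_gt0.
have eta1 : 16 * (M + 1) * eta <= delta.
  rewrite -etaE ler_wpM2r ?(ltW eta0)// ler_peMr//.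
  by rewrite mulr_ge0// ltW.
have eta2 : 16 * M * eta <= delta.
  by apply: le_trans eta1; rewrite ler_wpM2r ?(ltW eta0)//; lra.
have [n nP] : exists n : nat, m B <= n%:R * eta.
  exists (Num.truncn (m B / eta)).+1; rewrite -ler_pdivrMr//.
  by apply: ltW; exact: truncnS_gt.
have [B1 [f1 [h1 [r1 bf1 bh1 c1 c2]]]] := mix_quadrants eta0 mB bf bh nP.
have mB1 : measurable B1 by case: r1 => k [/tower_meas].
have [mean_f mean_h] := reach_mean r1; rewrite f0 in mean_f; rewrite h0 in mean_h.
have [mf1 _ _] := bf1; have [mh1 _ _] := bh1.
have m0 : m (set0 : set X) = 0 by rewrite measure0.
have M2 : 2 * M * (2 * eta + 0) <= delta by apply: le_trans eta2; rewrite addr0; nra.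
have mpp : measurable (pos (pos B1 f1) h1) by apply: measurable_pos => //; exact: measurable_pos.
have mnn : measurable (neg (neg B1 f1) h1) by apply: measurable_neg => //; exact: measurable_neg.
have mpn : measurable (neg (pos B1 f1) h1) by apply: measurable_neg => //; exact: measurable_pos.
have mnp : measurable (pos (neg B1 f1) h1) by apply: measurable_pos => //; exact: measurable_neg.
have two A A1 A2 : measurable A -> measurable A1 -> measurable A2 ->
    A `<=` A1 `|` A2 -> m A1 <= eta -> m A2 <= eta -> m A <= 2 * eta.
  move=> mA mA1 mA2 sA s1 s2; apply: le_trans (m_le mu mA (measurableU _ _ mA1 mA2) sA) _.
  by apply: le_trans (mU_le mu mA1 mA2) _; rewrite mulr2n mulrDl mul1r lerD.
have msgn (g : X -> R) : measurable_fun setT g ->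
    measurable (B1 `&` ~` set0 `&` [set x | 0 < g x]) /\
    measurable (B1 `&` ~` set0 `&` [set x | g x < 0]).
  by move=> mg; split; apply: measurableI; [apply: measurableI => //; exact: measurableC|
    apply: measurable_lt_set => //; exact: measurable_cst|
    apply: measurableI => //; exact: measurableC|
    apply: measurable_lt_set => //; exact: measurable_cst].
(* Either [h1] is essentially one-signed, or [f1] is. *)
have [hsmall|fsmall] : \int[mu]_x `|h1 x| <= delta \/ \int[mu]_x `|f1 x| <= 2 * e * (2 * eta).
  have [mh1p mh1n] := msgn _ mh1; have [mf1p mf1n] := msgn _ mf1.
  case: c1 => [pp|nn]; case: c2 => [np|pn].
  - left; apply: le_trans M2.
    rewrite -m0; apply: (@abs_small_pos B1 set0) => //.
    apply: two mpp mnp _ pp np => // x [[Bx _] /= hx].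
    by case: (ltP (f1 x) 0) => fx; [right|left]; do 2?split=> //=; exact: ltW.
  - right; rewrite -[2 * eta]addr0 -m0; apply: (@abs_small_pos B1 set0) => //.
    apply: two mpp mpn _ pp pn => // x [[Bx _] /= fx].
    by case: (ltP (h1 x) 0) => hx; [right|left]; do 2?split=> //=; exact: ltW.
  - right; rewrite -[2 * eta]addr0 -m0; apply: (@abs_small_neg B1 set0) => //.
    apply: two mnn mnp _ nn np => // x [[Bx _] /= fx].
    by case: (ltP (h1 x) 0) => hx; [left|right]; do 2?split=> //=.
  - left; apply: le_trans M2.
    rewrite -m0; apply: (@abs_small_neg B1 set0) => //.
    apply: two mnn mpn _ nn pn => // x [[Bx _] /= hx].
    by case: (ltP (f1 x) 0) => fx; [left|right]; do 2?split=> //=.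
  by exists B1, f1, h1.
(* Values of size [c] can be doubled [K] times without exceeding [e]. *)
pose c := e / 2 ^+ K.
have c0 : 0 < c by rewrite divr_gt0.
pose Z := [set x | c < `|f1 x|].
have mZ : measurable Z.
  by apply: measurable_lt_set; [exact: measurable_cst|exact: measurableT_comp].
have Zsmall : m Z <= 4 * 2 ^+ K * eta.
  apply: le_trans (markov_abs (bounded_integ mu bf1) c0) _.
  rewrite ler_pdivrMr//; apply: le_trans fsmall _.
  rewrite [X in _ <= X](_ : _ = 4 * e * eta); first by lra.
  by rewrite /c; field; rewrite gt_eqF.
have [||||B2 [f2 [h2 [r2 bf2 bh2 c3]]]] := @mix_off e M (K%:R)^-1 c K B1 Z f1 h1 _ mB1 mZ _ _ (ltW c0) bf1 bh1.
- by rewrite invr_gt0.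
- by move=> x /negP; rewrite -leNgt.
- by rewrite /c mulrC divfK// gt_eqF.
- by rewrite mulfV ?gt_eqF//; exact: mem1.
exists B2, f2, h2; split=> //; first exact: reach_trans r1 r2.
have mB2 : measurable B2 by case: r2 => k [/tower_meas].
have [_ mean_h2] := reach_mean r2; rewrite mean_h in mean_h2.
have [mh2 _ _] := bh2.
have mBZ : measurable (B2 `&` ~` Z) by apply: measurableI => //; exact: measurableC.
apply: (@le_trans _ _ (2 * M * ((K%:R)^-1 + m Z))).
  case: c3 => c3; [apply: (@abs_small_pos B2)|apply: (@abs_small_neg B2)] => //.
  apply: le_trans c3; apply: m_le.
  - by apply: measurableI => //; apply: measurable_lt_set => //; exact: measurable_cst.
  - exact: measurable_pos.
  - by move=> x [Bx /= /ltW].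
have M4 : 4 * M * (K%:R)^-1 <= delta.
  by rewrite ler_pdivrMr// [X in _ <= X]mulrC -ler_pdivrMr//; exact: (ltW K0P).
have M16 : 16 * M * (2 ^+ K * eta) <= delta.
  rewrite -etaE -[X in _ <= X]mulrA; apply: ler_wpM2r; last by lra.
  by rewrite mulr_ge0// ltW.
have MZ : M * m Z <= M * (4 * 2 ^+ K * eta) by exact: ler_wpM2l.
rewrite mulrDr; apply: (@le_trans _ _ (delta / 2 + delta / 2)); last by lra.
by apply: lerD; lra.
Qed.

End Mixing.

(** * Reducing column sums *)

Section Reduction.
Context {R : realType} {d : measure_display} {X : measurableType d}.
Variable mu : probability X R.
Hypotheses (sw : swappable mu) (sp : splittable mu).
Implicit Types (B C D U V A Z : set X) (k : X -> X) (f g h : X -> R).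

Local Notation m A := (fine (mu A)).

(** This is what makes the bases shrink to measure zero. The factor [2] lost in the bound is
    regained by repeated reduction. *)
Lemma halving (e : R) B f : measurable B -> bounded_on B e f ->
  exists B' k f', [/\ tower mu B B' k, pushes mu k f f', bounded_on B' (2 * e) f' &
    m B' = m B / 2].
Proof.
move=> mB bf; have [mf fe f0] := bf.
have e0 : 0 <= e by apply: le_trans (fe point); exact: normr_ge0.
have [||C [mC CB eC]] := @subset_measure _ _ _ mu B (m B / 2) sp mB.
- by rewrite divr_ge0// m_ge0.
- by rewrite ler_pdivrMr// ler_peMr ?m_ge0// ler1n.
have mDC : measurable (B `\` C) by exact: measurableD.
have eD : m C = m (B `\` C) by rewrite mD// eC; lra.
have e2 : 0 <= 2 * e by rewrite mulr_ge0.
have [||x _ _|x y _ _|B' [f' [h' [[k [t pf _]] bf' _ mB' _]]]] := @link_reach _ _ _ mu e (2 * e) e (2 * e) B C (B `\` C) f f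
  sw sp mB mC mDC CB _ _ eD bf bf e2 e2.
- by move=> x [].
- by apply/seteqP; split=> // x [Cx [_ /(_ Cx)]].
- by split; apply: le_trans (fe x) _; lra.
- by split; apply: le_trans (ler_normD _ _) _; rewrite mulr2n mulrDl mul1r; apply: lerD.
by exists B', k, f'; split=> //; rewrite mB' -eD eC; lra.
Qed.

(* The class [(e / 2 ^ j.+1, e / 2 ^ j]] of positive values (unbounded above for [j = 0]);
   a point with value in [[- e, - 3 e / 4)] gets [2 ^ (j - 1)] elements of it,
   truncated subtraction giving one element for [j = 0]. *)
Definition dyadic_class B (e : R) f j :=
  B `&` [set x | e / 2 ^+ j.+1 < f x] `&` [set x | (j == 0%N) || (f x <= e / 2 ^+ j)].

Lemma measurable_dyadic B (e : R) f j : measurable B -> measurable_fun setT f ->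
  measurable (dyadic_class B e f j).
Proof.
move=> mB mf; apply: measurableI.
  by apply: measurableI => //; apply: measurable_lt_set => //; exact: measurable_cst.
case: (j == 0%N) => /=; first by rewrite (_ : [set _ | _] = setT)//; apply/seteqP; split.
by apply: measurable_le_set => //; exact: measurable_cst.
Qed.

Lemma dyadic_inj B (e : R) f i j x : 0 < e -> dyadic_class B e f i x ->
  dyadic_class B e f j x -> i = j.
Proof.
move=> e0; suff H a b : (a < b)%N -> dyadic_class B e f a x -> dyadic_class B e f b x -> False.
  move=> ix jx; case: (ltngtP i j) => // ij; exfalso; [exact: H ij ix jx|exact: H ij jx ix].
move=> ab [[_ /= xa] _] [_ /=]; case: b ab => [//|b] ab /= xb.
have : e / 2 ^+ b.+1 <= e / 2 ^+ a.+1.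
  rewrite ler_pM2l// lef_pV2 ?posrE ?exprn_gt0//.
  by apply: ler_weXn2l => //; rewrite ler1n.
move=> h; move: (lt_le_trans xa (le_trans xb h)); by rewrite ltxx.
Qed.

Lemma dyadic_ex B (e : R) f N x : 0 < e -> B x -> e / 2 ^+ N < f x ->
  exists2 j, (j < N)%N \/ j = 0%N & dyadic_class B e f j x.
Proof.
move=> e0 Bx; elim: N => [|N IHN] fx.
  exists 0%N; first by right.
  split=> //; split=> //=; apply: lt_trans fx.
  by rewrite expr0 divr1 expr1 ltr_pdivrMr// ltr_pMr// ltr1n.
have [fN|fN] := leP (f x) (e / 2 ^+ N).
  by exists N; [by left|split => //=; rewrite fN orbT].
by have [j [jN|->] jx] := IHN fN; [exists j => //; left; exact: ltnW|exists 0%N => //; right].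
Qed.

(** Let [L] be [3 e / 4] and [U] the set where [f < - L]. If each point of [U] takes [2 ^ (j - 1)]
    points of class [j], the sum on the right is the measure that can be served. By mean zero, the
    integral of [f] off [U] is [L * m U] plus the integral of the excess [g] of [- f] over [L]. It
    is at most the sum of [c j * m (P j)], where [c j] bounds [f] on class [j] and is at most
    [L / 2 ^ (j - 1)], plus [e / 2 ^ N] for the classes left out. Since [U] is not null, [g] has
    positive integral and absorbs that last term for large [N]: finitely many classes suffice. *)
Lemma dyadic_capacity (e : R) B f : 0 < e -> measurable B -> bounded_on B e f ->
  (forall x, f x <= 3 / 4 * e) -> \int[mu]_x f x = 0 ->
  0 < m (B `&` [set x | f x < - (3 / 4 * e)]) ->
  exists N, m (B `&` [set x | f x < - (3 / 4 * e)]) <=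
    \sum_(j < N) m (dyadic_class B e f j) / 2 ^+ (j - 1).
Proof.
move=> e0 mB bf fL f0 U0; have [mf fe fB] := bf; have If := bounded_integ mu bf.
set L := 3 / 4 * e in fL U0 *; set U := _ `&` _ in U0 *.
have mU : measurable U.
  by apply: measurableI => //; apply: measurable_lt_set => //; exact: measurable_cst.
pose g x := (- f x - L) * \1_U x.
have g0 x : 0 <= g x.
  rewrite /g indicE; have [Ux|Ux] := pselect (U x); last by rewrite memNset// mulr0.
  by rewrite mem_set// mulr1; case: Ux => _ /= ?; lra.
have Ig : integ mu g.
  apply: integ_indic => //; apply: integB; first exact: integN.
  by apply: (@integ_bounded _ _ _ _ _ `|L|) => //; exact: measurable_cst.
have gam : 0 < \int[mu]_x g x.
  rewrite lt_neqAle Rintegral_ge0// andbT; apply/eqP => /esym gz.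
  have : (\int[mu]_x `|(g x)%:E| = 0)%E.
    rewrite (eq_integral (fun x => (g x)%:E)); last by move=> x _ /=; rewrite ger0_norm.
    rewrite -[LHS]fineK; last by apply: integrable_fin_num.
    by rewrite -/(Rintegral _ _ _) gz.
  move/(ae_eq_integral_abs _ measurableT (measurable_int _ Ig)) => [A [mA A0 sA]].
  suff : m U <= 0 by rewrite leNgt U0.
  rewrite -[X in _ <= X]/(fine 0) -A0; apply: m_le => // x Ux; apply: sA => /= /(_ I).
  rewrite /g indicE mem_set// mulr1; case: Ux => _ /= ? []; lra.
have [N NP] : exists N, e / 2 ^+ N <= \int[mu]_x g x.
  have := @cvg_geometric R e 2^-1; rewrite ger0_norm// => /(_ _)/wrap[].
    by rewrite invf_lt1// ltr1n.
  move=> /cvgrPdist_lt/(_ _ gam) [N _ /(_ N)]/=; rewrite leqnn => /(_ isT).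
  rewrite sub0r normrN /geometric /= ger0_norm; last by rewrite mulr_ge0 ?ltW// exprn_ge0.
  by rewrite exprVn => /ltW ?; exists N.
(* [dyadic_ex] may return class [0] even when [N = 0], so at least one class is kept. *)
have [M [NM M0]] : exists M, (N <= M)%N /\ (0 < M)%N by exists N.+1; split.
exists M.
pose c j : R := if j == 0%N then L else e / 2 ^+ j.
pose P j := dyadic_class B e f j.
have mP j : measurable (P j) by exact: measurable_dyadic.
have L0 : 0 < L by rewrite mulr_gt0.
have c0 j : 0 <= c j.
  by rewrite /c; case: ifP => _; [exact: ltW|rewrite divr_ge0 ?ltW// exprn_gt0].
have cle j : c j * m (P j) <= L * (m (P j) / 2 ^+ (j - 1)).
  rewrite /c; case: j => [|j] /=; first by rewrite expr0 divr1.
  rewrite subn1 /= exprS invfM.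
  have -> : e * (2^-1 / 2 ^+ j) * m (P j.+1) = (e / 2) * (m (P j.+1) / 2 ^+ j).
    by ring.
  apply: ler_wpM2r; first by rewrite divr_ge0 ?m_ge0// exprn_ge0.
  by rewrite /L; lra.
have ineq x : f x * \1_(~` U) x <= \sum_(j < M) c j * \1_(P j) x + e / 2 ^+ N.
  have s0 : 0 <= \sum_(j < M) c j * \1_(P j) x :> R.
    by apply: sumr_ge0 => j _; rewrite mulr_ge0// indicE.
  have eN : 0 <= e / 2 ^+ N by rewrite divr_ge0 ?ltW// exprn_gt0.
  rewrite indicE; have [Ux|Ux] := pselect (U x).
    by rewrite memNset ?mulr0; [exact: addr_ge0|exact].
  rewrite mem_set// mulr1.
  have [fx|fx] := leP (f x) (e / 2 ^+ N); first by rewrite -[f x]add0r lerD.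
  have Bx : B x.
    apply: contrapT => Bx; move: fx; rewrite fB// ltNge eN//.
  have [j jN Pj] := dyadic_ex e0 Bx fx.
  have jM : (j < M)%N by case: jN => [jN|->//]; exact: leq_trans NM.
  apply: ler_wpDr => //; rewrite (bigD1 (Ordinal jM))//=.
  apply: ler_wpDr; first by apply: sumr_ge0 => i _; rewrite mulr_ge0// indicE.
  rewrite indicE mem_set// mulr1 /c; case: eqP => [_|j0]; first exact: fL.
  by case: Pj => _ /=; case: eqP.
have IP j : integ mu (fun x => c j * \1_(P j) x) by apply: integZ; exact: integ_indicator.
have [Isum sumE] := integ_sum M IP.
have Icst (a : R) : integ mu (fun=> a).
  by apply: (@integ_bounded _ _ _ _ _ `|a|) => //; exact: measurable_cst.
have cstE (a : R) : \int[mu]_x (fun=> a) x = a.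
  rewrite Rintegral_cst// -[RHS]mulr1; congr (_ * _).
  by rewrite -[RHS]/(fine 1%E); congr fine; exact: probability_setT.
have fU : \int[mu]_x (f x * \1_(~` U) x) = \int[mu]_x g x + L * m U.
  have -> : \int[mu]_x g x + L * m U = \int[mu]_x (f x * \1_(~` U) x - f x).
    rewrite -Rintegral_indicator// -RintZ; last exact: integ_indicator.
    rewrite -RintD; [|exact: Ig|by apply: integZ; exact: integ_indicator].
    apply: eq_Rintegral => x _; rewrite /g !indicE in_setC.
    by case: (x \in U) => /=; ring.
  rewrite RintegralB//; first by rewrite f0 subr0.
  by apply: integ_indic => //; exact: measurableC.
have I1 : integ mu (fun x => f x * \1_(~` U) x).
  by apply: integ_indic => //; exact: measurableC.
have main := Rint_le I1 (integD Isum (Icst (e / 2 ^+ N))) ineq.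
rewrite (RintD Isum (Icst _)) sumE cstE fU in main.
rewrite (eq_bigr (fun j : 'I_M => c j * m (P j))) in main; last first.
  by move=> j _; rewrite RintZ ?Rintegral_indicator//; exact: integ_indicator.
rewrite -(ler_pM2l L0).
apply: (@le_trans _ _ (\sum_(j < M) c j * m (P j))); first by lra.
by rewrite mulr_sumr; apply: ler_sum => j _; exact: cle.
Qed.

Lemma trivIset_inj (V : nat -> set X) i j x : trivIset setT V -> V i x -> V j x -> i = j.
Proof. by move=> tV Vi Vj; apply: (tV i j) => //; exists x. Qed.

Lemma split_finite U (a : nat -> R) N : measurable U -> (forall i, 0 <= a i) ->
  \sum_(i < N) a i <= m U -> exists V : nat -> set X,
  [/\ forall i, measurable (V i), trivIset setT V, forall i, V i `<=` U,
      forall i, (i < N)%N -> m (V i) = a i & forall i, (N <= i)%N -> m (V i) = 0].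
Proof.
move=> mU a0 aU; pose a' i := if (i < N)%N then a i else 0.
have a'0 i : 0 <= a' i by rewrite /a'; case: ifP.
have a'N : \sum_(i < N) a' i = \sum_(i < N) a i.
  by apply: eq_bigr => i _; rewrite /a' ltn_ord.
have [n|V [mV tV VU muV]] := sp mU a'0; last first.
  exists V; split=> // i; first by move=> iN; rewrite muV /a' iN.
  by move=> Ni; rewrite muV /a' ltnNge Ni.
rewrite (mE mu mU) lee_fin; apply: le_trans aU; rewrite -a'N.
have [nN|Nn] := leqP n N.
  rewrite (big_ord_widen N a')// [leRHS](bigID (fun i : 'I_N => (i < n)%N))/=.
  by rewrite ler_wpDr// sumr_ge0.
rewrite [leRHS](big_ord_widen n a') ?(ltnW Nn)//.
rewrite (bigID (fun i : 'I_n => (i < N)%N))/= [X in _ + X]big1 ?addr0//.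
by move=> i; rewrite /a' => /negbTE ->.
Qed.

Lemma sum_iota_const (c : R) n : \sum_(i <- iota 0 n) c = c * n%:R.
Proof. by rewrite big_const_seq count_predT size_iota iter_addr_0 mulr_natr. Qed.

(** A point of [U] has a value in [[- e, - 3 e / 4)]. Joining [2 ^ (j - 1)] points of class [j > 0]
    adds between [e / 4] and [e / 2]; joining one point of class [0] adds between [e / 2] and
    [3 e / 4]. Either way the sum has size at most [3 e / 4], and all other values already have. *)
Lemma reduce_onesided (e : R) B f : 0 < e -> measurable B -> bounded_on B e f ->
  (forall x, f x <= 3 / 4 * e) -> \int[mu]_x f x = 0 ->
  exists B' k f', [/\ tower mu B B' k, pushes mu k f f' & bounded_on B' (3 / 4 * e) f'].
Proof.
move=> e0 mB bf fL f0; have [mf fe fB] := bf; have If := bounded_integ mu bf.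
set L := 3 / 4 * e in fL *; pose U := B `&` [set x | f x < - L].
have L0 : 0 < L by rewrite mulr_gt0.
have eL : e / 4 + L = e by rewrite /L; field.
have mU : measurable U.
  by apply: measurableI => //; apply: measurable_lt_set => //; exact: measurable_cst.
have UB : U `<=` B by move=> x [].
have [U0|U0] := leP (m U) 0.
  have U0' : mu U = 0%E by rewrite mE//; congr EFin; apply/le_anti; rewrite U0 m_ge0.
  exists B, id, (fun x => f x * \1_(B `\` U) x).
  have mBU : measurable (B `\` U) by exact: measurableD.
  have mf' : measurable_fun setT (fun x => f x * \1_(B `\` U) x).
    by apply: measurable_funM => //; exact: measurable_indic.
  split; [exact: tower_id| |].
    have pf : pushes mu id f f by split.
    apply: pushes_ae pf mf' _.
    exists U; split=> // x /= fx; apply: contrapT => Ux; apply: fx.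
    have [Bx|Bx] := pselect (B x); last by rewrite (fB _ Bx) mul0r.
    by rewrite indicE mem_set ?mulr1//.
  split=> //.
    move=> x; rewrite indicE; have [[Bx Ux]|BUx] := pselect ((B `\` U) x); last first.
      by rewrite memNset// mulr0 normr0 ltW.
    rewrite mem_set// mulr1 ler_norml fL andbT leNgt; apply/negP => h; exact: Ux.
  by move=> x Bx; rewrite (fB _ Bx) mul0r.
have [N UN] := dyadic_capacity e0 mB bf fL f0 U0.
pose P j := dyadic_class B e f j.
have mP j : measurable (P j) by exact: measurable_dyadic.
pose q j := (2 ^ (j - 1))%N.
have q0 j : (0 < q j)%N by rewrite expn_gt0.
have qE j : (q j)%:R = 2 ^+ (j - 1) :> R by rewrite natrX.
pose t j := m (P j) / (q j)%:R.
have t0 j : 0 <= t j by rewrite divr_ge0 ?m_ge0.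
pose T := \sum_(j < N) t j.
have UT : m U <= T.
  by apply: le_trans UN _; apply: ler_sum => j _; rewrite /t qE.
have T0 : 0 < T by exact: lt_le_trans UT.
have T1 : 0 <= m U / T by rewrite divr_ge0 ?m_ge0// ltW.
(* The share of [U] served by class [j]: proportional to the capacity [t j] and with total exactly
   [m U]. *)
pose al j := t j * (m U / T).
have al0 j : 0 <= al j by rewrite mulr_ge0.
have alt j : al j <= t j by rewrite ler_piMr// ler_pdivrMr// mul1r.
have alN : \sum_(j < N) al j = m U by rewrite -mulr_suml -/T mulrC divfK// gt_eqF.
have [|V [mV tV VU muV V0]] := split_finite mU al0 (N := N); first by rewrite alN.
(* Inside class [j], [q j] disjoint copies of the share are cut out; they fit because
   [q j * al j <= m (P j)]. *)
have /choice[W WP] : forall j, exists W : nat -> set X,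
    [/\ forall i, measurable (W i), trivIset setT W, forall i, W i `<=` P j &
        forall i, (i < q j)%N -> m (W i) = al j].
  move=> j; have [|W [mW tW WP muW _]] := split_finite (mP j) (a := fun=> al j) (fun=> al0 j) (N := q j).
    by rewrite sumr_const card_ord -mulr_natr -ler_pdivlMr ?ltr0n//; exact: alt.
  by exists W.
have mW j i : measurable (W j i) by have [] := WP j.
have UP x j : U x -> P j x -> False.
  move=> [_ /= fx] [[_ /= xj] _].
  have : f x < 0 by apply: lt_trans fx _; rewrite oppr_lt0.
  by rewrite ltNge (le_trans _ (ltW xj))// divr_ge0 ?ltW// exprn_gt0.
have /choice[S SP] : forall ji : nat * nat, exists S : (X -> X) * set X * set X,
    (ji.1 < N)%N && (ji.2 < q ji.1)%N -> swap mu (V ji.1) (W ji.1 ji.2) S.1.1 S.1.2 S.2.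
  move=> [j i] /=; case: andP => [[jN iq]|_]; last by exists (id, set0, set0).
  have [||s [C0 [D0 sc]]] := sw (mV j) (mW j i).
  - apply/seteqP; split=> // x [Vx Wx]; apply: (@UP x j); first exact: VU Vx.
    by have [_ _ WP' _] := WP j; exact: WP' Wx.
  - by rewrite (mE mu (mV j)) (mE mu (mW j i)); congr EFin; rewrite muV//; have [_ _ _ ->] := WP j.
  by exists (s, C0, D0).
pose s j i := (S (j, i)).1.1; pose C0 j i := (S (j, i)).1.2; pose D0 j i := (S (j, i)).2.
have sP j i : (j < N)%N -> (i < q j)%N -> swap mu (V j) (W j i) (s j i) (C0 j i) (D0 j i).
  by move=> jN iq; apply: (SP (j, i)); rewrite /= jN.
(* Only points for which all [q j] exchanges are defined collect anything, so that a group is either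
   complete or empty. *)
pose G j := V j `&` \bigcap_(i in `I_(q j)) C0 j i.
have mG j : (j < N)%N -> measurable (G j).
  move=> jN; apply: measurableI => //; apply: bigcap_measurable => [|i iq]; first by exists 0%N; exact: q0.
  exact: (swap_measl (sP _ _ jN iq)).
(* The [i]-th exchange for class [j] gets the index [j * K + i]; [K] is at least every [q j] with
   [j < N], so quotient and remainder recover the pair. Indices failing [ok] stand for empty
   exchanges. *)
have K0 : (0 < 2 ^ N)%N by rewrite expn_gt0.
set K := (2 ^ N)%N in K0.
have qK j : (j < N)%N -> (q j <= K)%N.
  by move=> jN; rewrite leq_exp2l// (leq_trans (leq_subr _ _))// ltnW.
pose ok l := ((l %/ K < N) && (l %% K < q (l %/ K)))%N.
pose ss l := if ok l then s (l %/ K)%N (l %% K)%N else id.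
pose CC l := if ok l then C0 (l %/ K)%N (l %% K)%N else set0.
pose DD l := if ok l then D0 (l %/ K)%N (l %% K)%N else set0.
pose E l := if ok l then G (l %/ K)%N else set0.
have okP l : ok l -> swap mu (V (l %/ K)%N) (W (l %/ K)%N (l %% K)%N) (ss l) (CC l) (DD l).
  by move=> okl; rewrite /ss /CC /DD okl; case/andP: okl => *; exact: sP.
have saa l : aut mu (ss l) (ss l).
  case okl : (ok l); first by exact: (swap_aut (okP _ okl)).
  by rewrite /ss okl; exact: aut_id.
have mDD l : measurable (DD l).
  by case okl : (ok l); [exact: (swap_measr (okP _ okl))|rewrite /DD okl].
have mEE l : measurable (E l).
  by rewrite /E; case okl : (ok l) => //; apply: mG; case/andP: okl.
have EC l : E l `<=` CC l.
  move=> x; rewrite /E /CC; case okl : (ok l) => // -[_ Cx]; apply: Cx => /=.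
  by case/andP: okl.
have CU l : CC l `<=` U.
  case okl : (ok l); last by rewrite /CC okl.
  by move=> x /(swap_subl (okP _ okl)); exact: VU.
have DP l x : DD l x -> ok l /\ W (l %/ K)%N (l %% K)%N x.
  case okl : (ok l); last by rewrite /DD okl.
  by move=> /(swap_subr (okP _ okl)).
have WPP j i : W j i `<=` P j by have [] := WP j.
have DB l : DD l `<=` B by move=> x /DP[_ /WPP[[]]].
have DU l x : DD l x -> ~ U x by move=> /DP[_ /WPP Px] Ux; exact: UP Ux Px.
have sC l x : CC l x -> DD l (ss l x).
  by case okl : (ok l); [exact: (swap_funl (okP _ okl))|rewrite /CC okl].
have tD i j x : DD i x -> DD j x -> i = j.
  move=> /DP[oki Wi] /DP[okj Wj].
  have ij : (i %/ K = j %/ K)%N by exact: (dyadic_inj e0 (WPP _ _ _ Wi) (WPP _ _ _ Wj)).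
  rewrite (divn_eq i K) (divn_eq j K) ij; congr (_ + _)%N.
  have [_ tW _ _] := WP (i %/ K)%N.
  by apply: (trivIset_inj tW Wi); rewrite ij.
have Efin x : exists n, forall l, (n <= l)%N -> ~ E l x.
  exists (N * K)%N => l Nl; rewrite /E /ok.
  by rewrite ltnNge leq_divRL ?expn_gt0// Nl.
have tw := assign_tower mB UB saa mDD mEE EC CU DB DU sC tD Efin.
set B' := assign_base _ _ _ _ in tw; set k := assign_map _ _ _ in tw.
have UB' : U `<=` B' by move=> x Ux; split; [exact: UB|move=> [l _ [/DU]]].
pose GG := \bigcup_(j in `I_N) G j.
have mGG : measurable GG by apply: bigcup_measurable => j; exact: mG.
(* Off this set the density is put to [0]: the points of [U] without a complete group would keep too
   negative a value, but they form a null set. *)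
pose Wok := (B' `\` U) `|` GG.
have mWok : measurable Wok.
  by apply: measurableU => //; apply: measurableD => //; exact: (tower_meas tw).
have mf' : measurable_fun setT (fun x => fsum k f x * \1_Wok x).
  by apply: measurable_funM; [exact: measurable_fsum tw mf|exact: measurable_indic].
have junk : mu.-negligible (U `\` GG).
  have nV : mu.-negligible (U `\` \bigcup_(j in `I_N) V j).
    have mbV : measurable (\bigcup_(j in `I_N) V j) by exact: bigcup_measurable.
    exists (U `\` \bigcup_(j in `I_N) V j); split=> //; first exact: measurableD.
    have VE : mu (\bigcup_(j in `I_N) V j) = mu U.
      rewrite bigcup_mkord.
      have -> := @measure_bigsetU_ord _ _ _ mu N xpredT (fun j => V j) (fun j => mV j) _.
        rewrite (eq_bigr (fun j : 'I_N => (al j)%:E)); last first.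
          by move=> j _ /=; rewrite (mE mu (mV j)) muV.
        by rewrite sumEFin alN -mE.
      move=> a b _ _ ab; apply: val_inj; exact: tV ab.
    rewrite (mE mu (measurableD mU mbV)) mD ?VE ?subrr//.
    by move=> x [j _ /VU].
  have nC : mu.-negligible (\bigcup_j \bigcup_i
      (if (j < N)%N && (i < q j)%N then V j `\` C0 j i else set0)).
    apply: negligible_bigcup => j; apply: negligible_bigcup => i.
    case: ifPn => [/andP[jN iq]|_]; last exact: negligible_set0.
    have sc := sP _ _ jN iq.
    exists (V j `\` C0 j i); split=> //; last exact: (swap_nulll sc).
    by apply: measurableD => //; exact: (swap_measl sc).
  apply: negligibleS (negligibleU nV nC) => x [Ux Gx].
  have [Vx|Vx] := pselect ((\bigcup_(j in `I_N) V j) x); [right|by left].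
  apply: contrapT => h; apply: Gx; case: Vx => j /= jN Vx; exists j => //; split=> // i /= iq.
  by apply: contrapT => Cx; apply: h; exists j => //; exists i => //; rewrite jN iq.
exists B', k, (fun x => fsum k f x * \1_Wok x); split=> //.
  apply: pushes_ae (pushes_fsum tw If) mf' _.
  apply: negligibleS junk => x /=; apply: contra_notP => UG.
  have [B'x|B'x] := pselect (B' x); last by rewrite (fsum_out tw fB B'x) mul0r.
  rewrite indicE mem_set ?mulr1//; have [Ux|Ux] := pselect (U x); [right|by left].
  by apply: contrapT => h; apply: UG.
have WB' : Wok `<=` B'.
  by move=> x [[]//|[j _ [/VU/UB']]].
split=> //; last by move=> x B'x; rewrite (fsum_out tw fB B'x) mul0r.
move=> x; rewrite indicE.
have [Wx|Wx] := pselect (Wok x); last by rewrite memNset// mulr0 normr0 ltW.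
rewrite mem_set// mulr1.
have B'x := WB' _ Wx.
have [Ux|Ux] := pselect (U x); last first.
  rewrite (fsum_assign saa EC CU DU sC tD f B'x (J := [::]))//; last first.
    by move=> l; split=> // /EC/CU.
  rewrite big_nil addr0 ler_norml fL andbT leNgt; apply/negP => h.
  by apply: Ux; split=> //; case: B'x.
case: Wx => [[]//|[j /= jN Gx]].
have qj := qK _ jN.
have divj i : (i < q j)%N -> ((j * K + i) %/ K = j /\ (j * K + i) %% K = i)%N.
  move=> iq; have iK : (i < K)%N by exact: leq_trans qj.
  by rewrite divnMDl// divn_small// addn0 modnMDl modn_small.
have EJ l : l \in [seq (j * K + i)%N | i <- iota 0 (q j)] <-> E l x.
  split.
    move=> /mapP[i]; rewrite mem_iota add0n /= => iq ->.
    by have [d1 d2] := divj _ iq; rewrite /E /ok d1 d2 jN iq.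
  rewrite /E; case okl : (ok l) => // -[Vx _].
  have [Vx' _] := Gx; have jl := trivIset_inj tV Vx Vx'.
  case/andP: okl => _; rewrite jl => lq.
  by apply/mapP; exists (l %% K)%N; [rewrite mem_iota|rewrite {1}(divn_eq l K) jl].
have uJ : uniq [seq (j * K + i)%N | i <- iota 0 (q j)].
  by rewrite map_inj_in_uniq ?iota_uniq// => a b _ _ /addnI.
rewrite (fsum_assign saa EC CU DU sC tD f B'x uJ EJ) big_map.
have vals i : (i < q j)%N -> P j (ss (j * K + i)%N x).
  move=> iq; have [d1 d2] := divj _ iq.
  have Ex : E (j * K + i)%N x by apply/EJ/mapP; exists i; rewrite ?mem_iota.
  by have [_] := DP _ _ (sC _ _ (EC _ _ Ex)); rewrite d1 => /WPP.
have [_ /= fx] := Ux.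
have fe' : - e <= f x by have := fe x; rewrite ler_norml => /andP[].
have lo : e / 4 <= \sum_(i <- iota 0 (q j)) f (ss (j * K + i)%N x).
  apply: (@le_trans _ _ (\sum_(i <- iota 0 (q j)) (e / 2 ^+ j.+1))).
    rewrite sum_iota_const qE.
    case: (j) => [|j'] /=; first by rewrite expr1 expr0; lra.
    rewrite subn1 /= [in leRHS]exprS [in leRHS]exprS.
    rewrite [leRHS](_ : _ = e / 4) //.
    by field; rewrite expf_neq0.
  rewrite !big_seq; apply: ler_sum => i; rewrite mem_iota add0n => /andP[_ iq].
  by have [[_ /=] ] := vals _ iq; move=> /ltW.
have hi : \sum_(i <- iota 0 (q j)) f (ss (j * K + i)%N x) <= L.
  apply: (@le_trans _ _ (\sum_(i <- iota 0 (q j)) (if j == 0%N then L else e / 2 ^+ j))).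
    rewrite !big_seq; apply: ler_sum => i; rewrite mem_iota add0n => /andP[_ iq].
    have [_ /=] := vals _ iq; case: eqP => //= _ _; exact: fL.
  rewrite sum_iota_const qE.
  case: (j) => [|j'] /=; first by rewrite expr0 mulr1.
  rewrite subn1 /= exprS [leLHS](_ : _ = e / 2); first by rewrite /L; lra.
  by field; rewrite expf_neq0.
rewrite ler_norml; apply/andP; split; lra.
Qed.

End Reduction.

Section Stage.
Context {R : realType} {d : measure_display} {X : measurableType d}.
Variable mu : probability X R.
Hypotheses (sw : swappable mu) (sp : splittable mu).
Implicit Types (B C D U V A Z : set X) (k : X -> X) (f g h : X -> R).

Local Notation m A := (fine (mu A)).

Lemma pushesN k f g : measurable_fun setT k -> integ mu f ->
  pushes mu k f g -> pushes mu k (fun x => - f x) (fun x => - g x).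
Proof.
move=> mk If [Ig fg]; split; first exact: integN.
move=> A mA; rewrite !RintegralN ?fg// -[_ @^-1` _]setTI; exact: mk.
Qed.

Lemma bounded_on_le B (e e' : R) f : e <= e' -> bounded_on B e f -> bounded_on B e' f.
Proof. by move=> ee [mf fe f0]; split=> // x; exact: le_trans ee. Qed.

Lemma pushes_mean k f g : pushes mu k f g -> \int[mu]_x g x = \int[mu]_x f x.
Proof. by move=> [_ fg]; rewrite -fg ?preimage_setT. Qed.

(** Values above [L] are linked with values below [- L], which gives sums of size at most [e / 4],
    until the scarcer kind is used up. Only one kind of extreme value is then left:
    [reduce_onesided] treats the negative kind, and a change of sign the positive one. *)
Lemma reduce (e : R) B f : 0 < e -> measurable B -> bounded_on B e f ->
  \int[mu]_x f x = 0 ->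
  exists B' k f', [/\ tower mu B B' k, pushes mu k f f' & bounded_on B' (3 / 4 * e) f'].
Proof.
move=> e0 mB bf f0; have [mf fe fB] := bf.
set L := 3 / 4 * e; have L0 : 0 < L by rewrite mulr_gt0.
have eL : e = 4 / 3 * L by rewrite /L; field.
pose P := B `&` [set x | L < f x]; pose N := B `&` [set x | f x < - L].
have mP : measurable P by apply: measurableI => //; apply: measurable_lt_set => //; exact: measurable_cst.
have mN : measurable N by apply: measurableI => //; apply: measurable_lt_set => //; exact: measurable_cst.
have bnd x : - e <= f x <= e by rewrite -ler_norml.
have PN x : P x -> N x -> False by move=> [_ /= p] [_ /= n]; lra.
have sum_le a b : - e <= a <= e -> - e <= b <= e -> L < a -> b < - L -> `|a + b| <= e.
  by move=> /andP[? ?] /andP[? ?] ? ?; rewrite ler_norml; apply/andP; split; lra.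
have [PN_le|NP_lt] := leP (m P) (m N).
  have [D [mD' DN eD]] := subset_measure sp mN (m_ge0 mu P) PN_le.
  have [||||x y Px Dy|B1 [f1 [h1 [[k1 [t1 p1 _]] bf1 _ _ cs]]]] := @link_reach _ _ _ mu e e e e B P D f f
    sw sp mB mP mD' _ _ _ (esym eD) bf bf (ltW e0) (ltW e0).
  - by move=> x [].
  - by move=> x /DN[].
  - by apply/seteqP; split=> // x [Px /DN]; exact: PN.
  - by move=> x _ _; split; exact: fe.
  - by have [_ /= ?] := Px; have [_ /= ?] := DN _ Dy; split; exact: sum_le.
  have f1L x : f1 x <= 3 / 4 * e.
    case: (cs x) => [[-> _]|[Bx nP _ -> _]|[y [[_ /= Px] /DN[_ /= Ny] -> _]]].
    - exact: ltW.
    - by rewrite leNgt; apply/negP => h; exact: nP.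
    - by have /andP[_ ?] := bnd x; rewrite -/L; lra.
  have f10 : \int[mu]_x f1 x = 0 by rewrite (pushes_mean p1).
  have [B2 [k2 [f2 [t2 p2 bf2]]]] := reduce_onesided sw sp e0 (tower_meas t1) bf1 f1L f10.
  exists B2, (k2 \o k1), f2; split=> //; first exact: tower_comp t1 t2.
  by apply: pushes_comp p1 p2; exact: (tower_fun t2).
have [D [mD' DP eD]] := subset_measure sp mP (m_ge0 mu N) (ltW NP_lt).
have [||||x y Nx Dy|B1 [f1 [h1 [[k1 [t1 p1 _]] bf1 _ _ cs]]]] := @link_reach _ _ _ mu e e e e B N D f f
  sw sp mB mN mD' _ _ _ (esym eD) bf bf (ltW e0) (ltW e0).
- by move=> x [].
- by move=> x /DP[].
- by apply/seteqP; split=> // x [Nx /DP Px]; exact: PN Px Nx.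
- by move=> x _ _; split; exact: fe.
- by have [_ /= ?] := Nx; have [_ /= ?] := DP _ Dy; split; rewrite addrC; exact: sum_le.
have f1L x : - f1 x <= 3 / 4 * e.
  case: (cs x) => [[-> _]|[Bx nP _ -> _]|[y [[_ /= Nx] /DP[_ /= Py] -> _]]].
  - by rewrite oppr0 ltW.
  - by rewrite leNgt -/L; apply/negP => h; apply: nP; split=> //=; lra.
  - by have /andP[? _] := bnd x; rewrite -/L; lra.
have If1 := bounded_integ mu bf1.
have f10 : \int[mu]_x - f1 x = 0 by rewrite RintN// (pushes_mean p1) f0 oppr0.
have [B2 [k2 [f2 [t2 p2 bf2]]]] := reduce_onesided sw sp e0 (tower_meas t1) (bounded_onN bf1) f1L f10.
exists B2, (k2 \o k1), (fun x => - f2 x); split; [exact: tower_comp t1 t2| |exact: bounded_onN].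
apply: pushes_comp p1 _; first exact: (tower_fun t2).
have := pushesN (tower_fun t2) (integN If1) p2.
by rewrite (_ : (fun x => - - f1 x) = f1)//; apply/funext => x; rewrite opprK.
Qed.

Lemma reduce_iter (e : R) n B f : 0 < e -> measurable B -> bounded_on B e f ->
  \int[mu]_x f x = 0 ->
  exists B' k f', [/\ tower mu B B' k, pushes mu k f f' &
    bounded_on B' ((3 / 4) ^+ n * e) f'].
Proof.
move=> e0 mB bf f0; elim: n => [|n [B1 [k1 [f1 [t1 p1 b1]]]]].
  exists B, id, f; split; [exact: tower_id|split=> //; exact: bounded_integ bf|].
  by rewrite expr0 mul1r.
have e1 : 0 < (3 / 4) ^+ n * e by rewrite mulr_gt0// exprn_gt0.
have f10 : \int[mu]_x f1 x = 0 by rewrite (pushes_mean p1).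
have [B2 [k2 [f2 [t2 p2 b2]]]] := reduce e1 (tower_meas t1) b1 f10.
exists B2, (k2 \o k1), f2; split; [exact: tower_comp t1 t2| |by rewrite exprS -mulrA].
by apply: pushes_comp p1 p2; exact: (tower_fun t2).
Qed.

(** [h] is truncated at height [n], then a constant is subtracted on [B] to restore mean zero.
    Truncation costs [delta / 2], and so does the correction, because the mean of the truncation is
    minus that of the discarded part. *)
Lemma bounded_approx B h (delta : R) : measurable B -> integ mu h ->
  (forall x, ~ B x -> h x = 0) -> \int[mu]_x h x = 0 -> 0 < delta ->
  exists M g, [/\ bounded_on B M g, \int[mu]_x g x = 0 &
    \int[mu]_x `|h x - g x| <= delta].
Proof.
move=> mB Ih hB h0 delta0; have mh := integ_measurable Ih.
pose A n := [set x | `|h x| <= n%:R].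
have mA n : measurable (A n).
  by apply: measurable_le_set; [exact: measurableT_comp|exact: measurable_cst].
have mCA n : measurable (~` A n) by exact: measurableC.
have IC n : integ mu (fun x => `|h x| * \1_(~` A n) x) by apply: integ_indic => //; exact: integ_abs.
have [n small] : exists n, \int[mu]_x (`|h x| * \1_(~` A n) x) <= delta / 2.
  have [|||_ _ dc] := @dominated_convergence _ _ _ mu setT measurableT
    (fun n x => (`|h x| * \1_(~` A n) x)%:E) (cst 0%E) (fun x => `|h x|%:E)
    (fun n => measurable_int _ (IC n)) (measurable_cst _).
  - apply: aeW => x _; apply: cvg_near_cst; near=> i.
    have Ai : A i x by rewrite /A /=; near: i; exact: nbhs_infty_ger.
    by rewrite indicE memNset ?mulr0//; apply.
  - exact: integ_abs Ih.
  - apply: aeW => x n _ /=; rewrite lee_fin normrM normr_id ler_piMr//.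
    by rewrite indicE; case: (_ \in _); rewrite ?normr1 ?normr0.
  rewrite integral0 in dc.
  have d2 : 0 < delta / 2 by rewrite divr_gt0.
  have [_ /cvgrPdist_lt/(_ _ d2)[N _ /(_ N)/=]] := (fine_cvgP _ _).1 dc.
  rewrite leqnn => /(_ isT); rewrite sub0r normrN ger0_norm; last first.
    by apply: Rintegral_ge0 => x _; rewrite mulr_ge0// indicE.
  by move=> /ltW ?; exists N.
pose c := \int[mu]_x (h x * \1_(A n) x).
have IA : integ mu (fun x => h x * \1_(A n) x) by exact: integ_indic.
have IhC : integ mu (fun x => h x * \1_(~` A n) x) by exact: integ_indic.
have hE x : h x = h x * \1_(A n) x + h x * \1_(~` A n) x.
  by rewrite !indicE in_setC; case: (_ \in _) => /=; lra.
have cle : `|c| <= delta / 2.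
  have -> : c = - \int[mu]_x (h x * \1_(~` A n) x).
    apply/eqP; rewrite -addr_eq0 -RintD//; apply/eqP; rewrite -h0.
    by apply: eq_Rintegral => x _; rewrite -hE.
  rewrite normrN; apply: le_trans (le_normr_Rintegral _ _) _ => //.
  apply: le_trans small; apply: Rint_le => //; first exact: integ_abs.
  move=> x; rewrite normrM ler_wpM2l// indicE; case: (_ \in _); rewrite ?normr1 ?normr0//.
(* If [m B = 0] the quotient is [0] by convention, and [c] vanishes as well. *)
pose a := c / m B.
have aB : a * m B = c.
  have [mB0|mB0] := eqVneq (m B) 0; last by rewrite /a divfK.
  rewrite mB0 mulr0; apply/esym/eqP; rewrite -normr_eq0 eq_le normr_ge0 andbT.
  apply: le_trans (le_normr_Rintegral _ _) _ => //.
  apply: (@le_trans _ _ (\int[mu]_x (n%:R * \1_B x))).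
    apply: Rint_le; [exact: integ_abs|by apply: integZ; exact: integ_indicator|].
    move=> x; have [Bx|Bx] := pselect (B x); last by rewrite hB// mul0r normr0 mulr_ge0// indicE.
    rewrite [\1_B x]indicE mem_set// mulr1 indicE; have [Ax|Ax] := pselect (A n x).
      by rewrite mem_set// mulr1.
    by rewrite memNset// mulr0 normr0.
  rewrite RintZ; last exact: integ_indicator.
  by rewrite Rintegral_indicator// mB0 mulr0.
exists (n%:R + `|a|), (fun x => h x * \1_(A n) x - a * \1_B x).
have IB : integ mu (fun x => a * \1_B x) by apply: integZ; exact: integ_indicator.
split; first split.
- by apply: measurable_funB; [exact: integ_measurable IA|exact: integ_measurable IB].
- move=> x; apply: le_trans (ler_normB _ _) _; apply: lerD.
    rewrite indicE; have [Ax|Ax] := pselect (A n x); first by rewrite mem_set// mulr1.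
    by rewrite memNset// mulr0 normr0.
  by rewrite normrM ler_piMr// indicE; case: (_ \in _); rewrite ?normr1 ?normr0.
- by move=> x Bx; rewrite hB// mul0r indicE memNset// mulr0 subr0.
- rewrite RintegralB// RintZ; last exact: integ_indicator.
  by rewrite Rintegral_indicator// aB subrr.
apply: (@le_trans _ _ (\int[mu]_x (`|h x| * \1_(~` A n) x + `|a| * \1_B x))).
  apply: Rint_le.
  - by apply: integ_abs; apply: integB => //; exact: integB.
  - by apply: integD => //; apply: integZ; exact: integ_indicator.
  move=> x.
  have -> : h x - (h x * \1_(A n) x - a * \1_B x) = h x * \1_(~` A n) x + a * \1_B x.
    by rewrite {1}(hE x); ring.
  apply: le_trans (ler_normD _ _) _; rewrite !normrM.
  by apply: lerD; rewrite ler_wpM2l// indicE; case: (_ \in _); rewrite ?normr1 ?normr0.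
rewrite RintD//; last by apply: integZ; exact: integ_indicator.
rewrite RintZ; last exact: integ_indicator.
rewrite Rintegral_indicator// -[m B]ger0_norm ?m_ge0// -normrM aB.
lra.
Unshelve. all: by end_near. Qed.

(** Mixing requires a bounded test function and merely preserves the bound on [f], so it is applied
    to a bounded approximation [g], with the bound [2 * e] left by halving. The reductions come
    last: passing to sums over further columns never increases the integral of [|h|], and for the
    same reason the approximation error stays below [delta / 2]. *)
Lemma stage (e e' delta : R) B f h : 0 < e -> 0 < e' -> 0 < delta ->
  measurable B -> bounded_on B e f -> \int[mu]_x f x = 0 ->
  integ mu h -> (forall x, ~ B x -> h x = 0) -> \int[mu]_x h x = 0 ->
  exists B' k f', [/\ tower mu B B' k, pushes mu k f f', bounded_on B' e' f',
    m B' <= m B / 2 &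
    forall h', pushes mu k h h' -> \int[mu]_x `|h' x| <= delta].
Proof.
move=> e0 e'0 delta0 mB bf f0 Ih hB h0.
have [B1 [k1 [f1 [t1 p1 b1 mB1]]]] := halving sw sp mB bf.
have e20 : 0 < 2 * e by rewrite mulr_gt0.
have d2 : 0 < delta / 2 by rewrite divr_gt0.
have f10 : \int[mu]_x f1 x = 0 by rewrite (pushes_mean p1).
pose h1 := fsum k1 h.
have q1 : pushes mu k1 h h1 := pushes_fsum t1 Ih.
have h1B x : ~ B1 x -> h1 x = 0 by exact: fsum_out t1 hB.
have h10 : \int[mu]_x h1 x = 0 by rewrite (pushes_mean q1).
have [M [g [bg g0 hg]]] := bounded_approx (tower_meas t1) q1.1 h1B h10 d2.
have [B2 [f2 [g2 [[k2 [t2 p2 q2]] b2 _ g2d]]]] :=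
  mixing sw sp e20 d2 (tower_meas t1) b1 bg f10 g0.
have f20 : \int[mu]_x f2 x = 0 by rewrite (pushes_mean p2).
have [n nP] : exists n : nat, (3 / 4) ^+ n * (2 * e) <= e'.
  have : geometric (2 * e) (3 / 4) x @[x --> \oo] --> (0 : R).
    by apply: cvg_geometric; rewrite ger0_norm//; lra.
  move=> /cvgrPdist_lt/(_ _ e'0) [n _ /(_ n)]/=; rewrite leqnn => /(_ isT).
  rewrite sub0r normrN ger0_norm; first by rewrite mulrC => /ltW ?; exists n.
  by rewrite /geometric /= mulr_ge0 ?(ltW e20)// exprn_ge0//; lra.
have [B3 [k3 [f3 [t3 p3 b3]]]] := reduce_iter n e20 (tower_meas t2) b2 f20.
have mk2 := tower_fun t2; have mk3 := tower_fun t3.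
exists B3, (k3 \o (k2 \o k1)), f3; split.
- exact: tower_comp (tower_comp t1 t2) t3.
- by apply: pushes_comp p3 => //; exact: pushes_comp p1 p2.
- exact: bounded_on_le nP b3.
- rewrite -mB1; apply: m_le; [exact: (tower_meas t3)|exact: (tower_meas t1)|].
  by apply: subset_trans (tower_sub t2); exact: (tower_sub t3).
move=> h' ph'.
have Ig := bounded_integ mu bg.
have Ir : integ mu (fun x => h1 x - g x) by apply: integB => //; exact: q1.1.
have q2' : pushes mu k2 h1 (fun x => g2 x + fsum k2 (fun x => h1 x - g x) x).
  have := pushesD mk2 Ig Ir q2 (pushes_fsum t2 Ir).
  by rewrite (_ : (fun x => g x + _) = h1)//; apply/funext => x; rewrite addrC subrK.
have I2 := q2'.1.
have q3 := pushes_fsum t3 I2.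
have q : pushes mu (k3 \o (k2 \o k1)) h _ := pushes_comp mk3 (pushes_comp mk2 q1 q2') q3.
have ae_eq_h := pushes_unique ph' q.
rewrite [leLHS](_ : _ = \int[mu]_x `|fsum k3 (fun x => g2 x + fsum k2 (fun x => h1 x - g x) x) x|); last first.
  rewrite /Rintegral; congr fine; apply: ae_eq_integral => //.
  - by apply/measurable_EFinP; apply: measurableT_comp => //; exact: integ_measurable ph'.1.
  - by apply/measurable_EFinP; apply: measurableT_comp => //; exact: integ_measurable q.1.
  - by apply: filterS ae_eq_h => x + _ => ->.
apply: le_trans (pushes_norm mk3 I2 q3) _.
apply: (@le_trans _ _ (\int[mu]_x (`|g2 x| + `|fsum k2 (fun x => h1 x - g x) x|))).
  have Ir2 := fsum_integ t2 Ir; have Ig2 := q2.1.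
  apply: Rint_le => [||x]; [exact: integ_abs|by apply: integD; exact: integ_abs|exact: ler_normD].
have Ir2 := fsum_integ t2 Ir; have Ig2 := q2.1.
rewrite RintD; [|exact: integ_abs|exact: integ_abs].
have := pushes_norm mk2 Ir (pushes_fsum t2 Ir).
lra.
Qed.

End Stage.

(** * Ordering the points of a column *)

(* The next term is always one whose sign is opposite to that of the current partial sum. *)
Lemma greedy_order (R : realType) (T : eqType) (v : T -> R) (b : R) (r : seq T) (c : R) :
  `|c| <= b -> `|c + \sum_(j <- r) v j| <= b -> (forall j, j \in r -> `|v j| <= b) ->
  exists2 r', perm_eq r r' & forall n, `|c + \sum_(j <- take n r') v j| <= b.
Proof.
elim/ltn_ind: {r}(size r) {-2}r (erefl (size r)) c => n IHn r rn c cb tb vb.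
have [r0|rN0] := eqVneq r [::].
  by exists [::]; rewrite ?r0// => i; rewrite big_nil addr0.
have [j jr jb] : exists2 j, j \in r & `|c + v j| <= b.
  (* If no remaining term fits and [c >= 0], every one of them exceeds [b - c], so their total
     overshoots [b], against the hypothesis on the final sum; the case [c < 0] is symmetric. *)
  apply: contrapT => H; move: cb tb; rewrite !ler_norml => /andP[c1 c2] /andP[t1 t2].
  have vb' j : j \in r -> - b <= v j <= b by move=> /vb; rewrite ler_norml.
  have out j : j \in r -> c + v j < - b \/ b < c + v j.
    move=> jr; have [|h1] := ltP (c + v j) (- b); first by left.
    have [|h2] := ltP b (c + v j); first by right.
    by exfalso; apply: H; exists j => //; rewrite ler_norml h1.
  have [c0|c0] := leP 0 c.
    have pos j : j \in r -> b - c < v j.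
      by move=> jr; have /andP[? ?] := vb' j jr; case: (out j jr); lra.
    case: r rN0 rn vb vb' out pos t1 t2 H => [//|j r] _ _ _ _ _ pos t1 t2 _.
    rewrite big_cons in t2; have := pos j (mem_head _ _).
    have : 0 <= \sum_(i <- r) v i.
      rewrite big_seq; apply: sumr_ge0 => i ir; have := pos i.
      by rewrite inE ir orbT => /(_ isT); lra.
    lra.
  have neg j : j \in r -> v j < - b - c.
    by move=> jr; have /andP[? ?] := vb' j jr; case: (out j jr); lra.
  case: r rN0 rn vb vb' out neg t1 t2 H => [//|j r] _ _ _ _ _ neg t1 t2 _.
  rewrite big_cons in t1; have := neg j (mem_head _ _).
  have : \sum_(i <- r) v i <= 0.
    rewrite big_seq; apply: sumr_le0 => i ir; have := neg i.
    by rewrite inE ir orbT => /(_ isT); lra.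
  lra.
have pr := perm_to_rem jr.
have [|||r' pr' r'b] := IHn (size (rem j r)) _ (rem j r) erefl (c + v j) jb.
- by rewrite -rn (perm_size pr) /=.
- by rewrite -addrA -(big_cons _ _ j _ xpredT v) -(perm_big _ pr).
- by move=> i /mem_rem; exact: vb.
exists (j :: r'); first by apply: perm_trans pr _; rewrite perm_cons.
by case=> [|i] /=; [rewrite big_nil addr0|rewrite big_cons addrA].
Qed.

Section Ordering.
Context {R : realType} {d : measure_display} {X : measurableType d}.
Variable mu : probability X R.
Implicit Types (f g : X -> R).

Variables (B B' : set X) (k : X -> X) (t : tower mu B B' k).
Variables (l : X -> nat) (r r' : nat -> X -> X) (kl : labelling mu k l r r').
Variables (s s' beta : X -> R).
Hypotheses (Is : integ mu s) (ps : pushes mu k s s') (mbeta : measurable_fun setT beta)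
  (sb : forall x, `|s x| <= beta (k x)) (s'b : forall x, `|s' x| <= beta x).

(** The order is a list of labels of the class of [b]. It starts with the label of [b] itself, so
    that the transfer function vanishes at the base point. *)
Definition good_order (b : X) (p : seq nat) : Prop :=
  [/\ uniq p, forall j, j \in p <-> l (r j b) = j, ohead p = Some (l b) &
      forall n, `|\sum_(j <- take n p) s (r j b)| <= beta b].

Let good_code (b : X) (n : nat) : Prop :=
  if @unpickle (seq nat) n is Some p then good_order b p else False.

(** A measurable selection: the least code of a good order, shifted by one, [0] meaning that there
    is none. *)
Definition order_code (b : X) : nat :=
  if pselect (exists n, `[< good_code b n >]) is left e then (ex_minn e).+1 else 0%N.

Definition order_of (n : nat) : seq nat :=
  if n is m.+1 then odflt [::] (@unpickle (seq nat) m) else [::].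

Lemma measurable_good p : measurable [set b | good_order b p].
Proof.
have [ml ar _] := kl; have ms := integ_measurable Is.
have mD j : measurable [set b | l (r j b) = j].
  by have := aut_measurable (ar j) (ml j).
have [up|nup] := boolP (uniq p); last first.
  by rewrite (_ : [set _ | _] = set0)//; apply/seteqP; split=> // b [up]; rewrite up in nup.
rewrite (_ : [set _ | _] =
  \bigcap_j [set b | j \in p <-> l (r j b) = j] `&`
  [set b | ohead p = Some (l b)] `&`
  \bigcap_n [set b | `|\sum_(j <- take n p) s (r j b)| <= beta b]); last first.
  apply/seteqP; split=> b /=.
    by move=> [_ h1 h2 h3]; split; [split=> // j _; exact: h1|move=> n _; exact: h3].
  by move=> [[h1 h2] h3]; split=> //; [move=> j; exact: h1|move=> n; exact: h3].
apply: measurableI; first apply: measurableI.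
- apply: bigcapT_measurable => j; have [jp|jp] := boolP (j \in p).
    by rewrite (_ : [set _ | _] = [set b | l (r j b) = j])//;
      apply/seteqP; split=> b /= h; [exact/h|split].
  rewrite (_ : [set _ | _] = ~` [set b | l (r j b) = j]); first exact: measurableC.
  by apply/seteqP; split=> b /= h; [move=> e; have := h.2 e|split=> // e; have := h e].
- case: (p) => [|j p'] /=.
    by rewrite (_ : [set _ | _] = set0)//; apply/seteqP; split=> b.
  by rewrite (_ : [set _ | _] = l @^-1` [set j])//;
    apply/seteqP; split=> b /= => [[->]|->].
- apply: bigcapT_measurable => n; apply: measurable_le_set => //.
  apply: measurableT_comp => //; apply: measurable_sum => j.
  by apply: measurableT_comp => //; have [] := ar j.
Qed.

Lemma measurable_code n : measurable (order_code @^-1` [set n]).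
Proof.
have mg i : measurable [set b | good_code b i].
  rewrite /good_code; case: unpickle => [p|]; first exact: measurable_good.
  by rewrite (_ : [set _ | _] = set0)//; apply/seteqP; split=> b.
case: n => [|n].
  rewrite (_ : _ @^-1` _ = ~` \bigcup_i [set b | good_code b i]).
    by apply: measurableC; exact: bigcupT_measurable.
  apply/seteqP; split=> b /=; rewrite /order_code; case: pselect => // h.
    by move=> _ [i _ gi]; apply: h; exists i; exact/asboolP.
  by move=> nb; exfalso; case: (h) => i /asboolP gi; apply: nb; exists i.
rewrite (_ : _ @^-1` _ = [set b | good_code b n] `&`
    \bigcap_(i in `I_n) ~` [set b | good_code b i]).
  apply: measurableI => //; case: n => [|n].
    by rewrite II0 bigcap_set0.
  apply: bigcap_measurable => [|i _]; first by exists 0%N.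
  exact: measurableC.
apply/seteqP; split=> b /=; rewrite /order_code; case: pselect => // h.
- case: ex_minnP => m /asboolP gm mini [<-]; split=> // i /= im gi.
  by have := mini i; rewrite leqNgt im => /(_ (asboolT gi)).
- move=> [gn mini]; case: ex_minnP => m /asboolP gm minm; congr S.
  apply/eqP; rewrite eqn_leq minm ?asboolT// leqNgt; apply/negP => mn.
  exact: (mini m).
- by move=> [gn _]; exfalso; apply: h; exists n; exact/asboolP.
Qed.

Lemma order_codeP b n : order_code b = n.+1 -> good_order b (order_of n.+1).
Proof.
rewrite /order_code; case: pselect => // h [].
case: ex_minnP => m /asboolP gm _ <-; move: gm; rewrite /good_code /order_of.
by case: unpickle.
Qed.

Let ord x := order_of (order_code (k x)).

Lemma ord_cases x : ord x = [::] \/ good_order (k x) (ord x).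
Proof.
rewrite /ord; case e : (order_code (k x)) => [|n]; first by left.
by right; exact: order_codeP.
Qed.

Lemma ord_uniq x : uniq (ord x).
Proof. by case: (ord_cases x) => [->//|[]]. Qed.

(** [next] is cyclic, so the last point of a column returns to its base point. On an empty list
    [next] is the identity, and columns without a good order are fixed pointwise. *)
Definition order_map x := r (next (ord x) (l x)) (k x).
Definition order_inv x := r (prev (ord x) (l x)) (k x).

Lemma label_self x : l (r (l x) (k x)) = l x.
Proof. by have [_ _ ->] := kl. Qed.

Lemma mem_ord x : ord x != [::] -> l x \in ord x.
Proof.
by case: (ord_cases x) => [->//|[_ h _ _] _]; apply/h; exact: label_self.
Qed.

Lemma shift_label x j : (forall i, i \in ord x -> j \in ord x) -> (ord x = [::] -> j = l x) ->
  k (r j (k x)) = k x /\ l (r j (k x)) = j.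
Proof.
move=> h1 h2; have [e|ne] := eqVneq (ord x) [::].
  by rewrite h2//; have [_ _ ->] := kl.
have jo : j \in ord x by apply: h1; exact: mem_ord.
case: (ord_cases x) => [e|[_ h _ _]]; first by rewrite e in ne.
by apply: (labelP kl j (k x)).1; exact/h.
Qed.

Lemma order_mapP x : k (order_map x) = k x /\ l (order_map x) = next (ord x) (l x).
Proof.
apply: shift_label => [i io|->//].
by rewrite mem_next mem_ord//; case: (ord x) io.
Qed.

Lemma order_invP x : k (order_inv x) = k x /\ l (order_inv x) = prev (ord x) (l x).
Proof.
apply: shift_label => [i io|->//].
by rewrite mem_prev mem_ord//; case: (ord x) io.
Qed.

(** On the points with a given code and label [j], the map is [r' j] followed by the [r] of the next
    label, so [aut_piecewise] applies. *)
Lemma order_aut : aut mu order_map order_inv.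
Proof.
have [ml ar rl] := kl.
have mk : measurable_fun setT k := tower_fun t.
pose lab x := pickle (order_code (k x), l x).
have mlab n : measurable (lab @^-1` [set n]).
  have [[[i j] e]|ne] := pselect (exists ij : nat * nat, pickle ij = n).
    rewrite (_ : _ @^-1` _ = k @^-1` (order_code @^-1` [set i]) `&` l @^-1` [set j]).
      apply: measurableI => //; rewrite -[_ @^-1` _]setTI.
      by apply: mk => //; exact: measurable_code.
    apply/seteqP; split=> x /=; rewrite /lab -e.
      by move=> /(congr1 (@unpickle (nat * nat)%type)); rewrite !pickleK => -[-> ->].
    by move=> [-> ->].
  rewrite (_ : _ @^-1` _ = set0)//; apply/seteqP; split=> // x /= xn.
  by apply: ne; eexists; exact: xn.
pose a (nx : seq nat -> nat -> nat) n :=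
  if @unpickle (nat * nat)%type n is Some ij
  then r (nx (order_of ij.1) ij.2) \o r' ij.2 else id.
pose a' (nx : seq nat -> nat -> nat) n :=
  if @unpickle (nat * nat)%type n is Some ij
  then r ij.2 \o r' (nx (order_of ij.1) ij.2) else id.
have aa nx n : aut mu (a nx n) (a' nx n).
  rewrite /a /a'; case: unpickle => [[i j]|]; last exact: aut_id.
  by apply: aut_comp => //; exact: aut_sym.
have kE x : r' (l x) x = k x.
  by have [_ _ rK _ _] := ar (l x); rewrite -{2}(rl x) rK.
have aE (nx : seq nat -> nat -> nat) x : r (nx (ord x) (l x)) (k x) = a nx (lab x) x.
  by rewrite /a /lab pickleK /= kE.
apply: (aut_piecewise mlab (aa (@next nat))).
- by move=> x; exact: aE.
- rewrite (_ : order_inv = fun x => a (@prev nat) (lab x) x).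
    by apply: measurable_piecewise => // n; have [] := aa (@prev nat) n.
  by apply/funext => x; exact: aE.
- move=> x; have [k1 l1] := order_mapP x.
  by rewrite /order_inv /ord k1 l1 prev_next ?ord_uniq// rl.
- move=> x; have [k1 l1] := order_invP x.
  by rewrite /order_map /ord k1 l1 next_prev ?ord_uniq// rl.
Qed.

Definition partial f x : R :=
  - \sum_(j <- take (index (l x) (ord x)) (ord x)) f (r j (k x)).

Lemma measurable_partial f : measurable_fun setT f -> measurable_fun setT (partial f).
Proof.
move=> mf; have [ml ar rl] := kl; have mk : measurable_fun setT k := tower_fun t.
pose g (ij : nat * nat) x : R :=
  - \sum_(j <- take (index ij.2 (order_of ij.1)) (order_of ij.1)) f (r j (k x)).
apply: (@measurable_piecewise _ _ (nat * nat)%type _ _ (fun x => (order_code (k x), l x)) g).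
  move=> [i j].
  rewrite (_ : _ @^-1` _ = k @^-1` (order_code @^-1` [set i]) `&` l @^-1` [set j]).
    apply: measurableI => //; rewrite -[_ @^-1` _]setTI.
    by apply: mk => //; exact: measurable_code.
  by apply/seteqP; split=> x /=; [move=> [-> ->]|move=> [-> ->]].
move=> [i j]; rewrite /g /=; apply: measurableT_comp => //.
apply: measurable_sum => j'; apply: measurableT_comp => //.
by apply: measurableT_comp => //; have [] := ar j'.
Qed.

Lemma partial_bound x : `|partial s x| <= beta (k x).
Proof.
rewrite /partial normrN; case: (ord_cases x) => [->|[_ _ _ h]]; last exact: h.
by rewrite big_nil normr0; apply: le_trans (sb x).
Qed.

Lemma partial_base f x : k x = x -> partial f x = 0.
Proof.
move=> kx; rewrite /partial; case: (ord_cases x) => [->|[_ _ + _]].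
  by rewrite big_nil oppr0.
rewrite kx; case: (ord x) => [//|j p] [->] /=.
by rewrite eqxx take0 big_nil oppr0.
Qed.

(** Below the last point of a column the difference of partial sums is the single term [f x], and
    the fibre sum at the image is empty, the image not being a base point. At the last point the
    image is the base point, where the partial sum vanishes and the fibre sum is the total over the
    column. *)
Lemma partial_step f x : ord x != [::] ->
  f x = partial f x - partial f (order_map x) + fsum k f (order_map x).
Proof.
move=> one; have lo := mem_ord one; have [k1 l1] := order_mapP x.
have kk : k (k x) = k x := tower_idem _ t.
case: (ord_cases x) => [e|[up h hd _]]; first by rewrite e in one.
have [_ _ rl] := kl.
have oE : ord (order_map x) = ord x by rewrite /ord k1.
move: l1 oE; rewrite {2}/partial => l1 ->; rewrite l1 k1 /partial.
case eo : (ord x) one lo up h hd l1 => [//|c p] _ lo up h [cb] l1.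
have icp := lo; rewrite -index_mem in icp.
set i := index (l x) (c :: p) in icp *.
have nE : next (c :: p) (l x) = nth c p i by rewrite next_nth lo.
have xE : f x = f (r (nth c (c :: p) i) (k x)) by rewrite /i nth_index// rl.
have : (i <= size p)%N by rewrite -ltnS.
rewrite leq_eqVlt => /orP[/eqP ip|ip].
  have nc : next (c :: p) (l x) = c by rewrite nE nth_default// ip.
  have ob : order_map x = k x by rewrite /order_map eo nc cb -[X in r _ X = _]kk rl.
  rewrite nc index_head take0 big_nil oppr0 subr0 ob.
  rewrite (@fsum_seq _ _ _ _ _ _ [seq r j (k x) | j <- c :: p]).
  - rewrite big_map xE ip.
    have -> : \sum_(j <- c :: p) f (r j (k x)) =
        \sum_(j <- take (size p) (c :: p)) f (r j (k x)) + f (r (nth c (c :: p) (size p)) (k x)).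
      rewrite -[in LHS](@take_size _ (c :: p)) -[size (c :: p)]/(size p).+1.
      by rewrite (take_nth c)// -cats1 big_cat big_seq1.
    lra.
  - rewrite map_inj_in_uniq// => i1 i2 /h h1 /h h2 e12.
    by rewrite -h1 -h2 e12.
  move=> y; split.
    move=> ky; apply/mapP; exists (l y); last by rewrite -ky rl.
    by apply/h; rewrite -ky; exact: label_self.
  by move=> /mapP[j /h jl ->]; have [] := (labelP kl j (k x)).1 jl.
have nE' : next (c :: p) (l x) = nth c (c :: p) i.+1 by rewrite nE.
have inE' : index (nth c (c :: p) i.+1) (c :: p) = i.+1 by rewrite index_uniq.
have one : order_map x <> k x.
  move=> e; have := l1; rewrite e nE'.
  move=> e2; have : index (l (k x)) (c :: p) = i.+1 by rewrite e2 inE'.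
  by rewrite -cb index_head.
rewrite nE' inE' /fsum (_ : k @^-1` _ = set0) ?fsbig_set0; last first.
  apply/seteqP; split=> // y /= ky; apply: one.
  by rewrite -k1 -ky (tower_idem y t).
have it : (i < size (c :: p))%N by rewrite /= ltnS ltnW.
rewrite (take_nth c it) -cats1 big_cat big_seq1 /= xE /=; lra.
Qed.

(* Where the fibre sum disagrees with [s'] no admissible order need exist; this happens on a null set only. *)
Lemma ord_ae : \forall x \ae mu, ord x != [::].
Proof.
have [ml ar rl] := kl.
have [N [mN N0 sN]] := pushes_unique (pushes_fsum t Is) ps.
(* [k] does not preserve the measure, but the preimage of the null set [N] under [k] is covered by
   its countably many preimages under the automorphisms [r' j]. *)
exists (\bigcup_j (r' j @^-1` N)); split.
- apply: bigcupT_measurable => j; exact: aut_measurable (aut_sym (ar j)) mN.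
- apply/eqP; rewrite eq_le measure_ge0 andbT.
  apply: le_trans (measure_sigma_subadditive _ _ _ (@subset_refl _ _)) _ => [j||].
  + exact: aut_measurable (aut_sym (ar j)) mN.
  + by apply: bigcupT_measurable => j; exact: aut_measurable (aut_sym (ar j)) mN.
  rewrite eseries0// => j _ _.
  by have [_ _ _ _ H] := aut_sym (ar j); have := H _ mN; rewrite N0.
move=> x /= xo; exists (l x) => //=.
have -> : r' (l x) x = k x.
  by have [_ _ rK _ _] := ar (l x); rewrite -{2}(rl x) rK.
apply: sN => /= es; apply: xo; apply/negP => /eqP xo.
pose b := k x; have kb : k b = b := tower_idem _ t.
have fJ := finite_labels t kl b.
pose J := finmap.enum_fset (fset_set [set j | l (r j b) = j]).
have JP j : j \in J <-> l (r j b) = j.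
  by rewrite /J in_fset_set// inE.
have uJ : uniq J by exact: finmap.fset_uniq.
have lbJ : l b \in J by apply/JP; rewrite -{2}kb rl.
have rb : r (l b) b = b by rewrite -{2}kb rl.
have vb j : j \in J -> `|s (r j b)| <= beta b.
  by move=> /JP jl; have [kj _] := (labelP kl j b).1 jl; rewrite -{2}kj.
have sumJ : fsum k s b = \sum_(j <- J) s (r j b).
  rewrite (@fsum_seq _ _ _ _ _ _ [seq r j b | j <- J]) ?big_map//.
    rewrite map_inj_in_uniq// => i1 i2 /JP h1 /JP h2 e12.
    by rewrite -h1 -h2 e12.
  move=> y; split.
    move=> ky; apply/mapP; exists (l y); last by rewrite -ky rl.
    by apply/JP; rewrite -ky; exact: label_self.
  by move=> /mapP[j /JP jl ->]; have [] := (labelP kl j b).1 jl.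
have pJ := perm_to_rem lbJ.
have [||i /mem_rem|q pq qb] := @greedy_order _ _ (fun j => s (r j b)) (beta b) (rem (l b) J) (s (r (l b) b)).
- exact: vb.
- rewrite -(big_cons _ _ (l b) _ xpredT (fun j => s (r j b))) -(perm_big _ pJ) -sumJ es.
  exact: s'b.
- exact: vb.
have good : good_order b (l b :: q).
  have pp : perm_eq J (l b :: q) by apply: perm_trans pJ _; rewrite perm_cons.
  split=> //; first by rewrite -(perm_uniq pp).
    by move=> j; rewrite -(perm_mem pp); exact: JP.
  case=> [|n] /=; last by rewrite big_cons.
  by rewrite big_nil normr0; apply: le_trans (vb _ lbJ).
have : order_code b <> 0%N.
  rewrite /order_code; case: pselect => // h _; apply: h.
  by exists (pickle (l b :: q)); apply/asboolP; rewrite /good_code pickleK.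
case e : (order_code b) => [//|n] _.
have [_ _ + _] := order_codeP e; have : order_of n.+1 = [::] by rewrite -e.
by move=> ->.
Qed.

Lemma ordering_lab : exists (sg sg' : X -> X) (u : X -> R),
  [/\ aut mu sg sg', forall x, k (sg x) = k x, measurable_fun setT u &
      forall x, `|u x| <= beta (k x)] /\
  [/\ forall x, k x = x -> u x = 0, \forall x \ae mu, s x = u x - u (sg x) + s' (sg x) &
      forall f, integ mu f -> exists v : X -> R, [/\ measurable_fun setT v,
        forall x, k x = x -> v x = 0 &
        \forall x \ae mu, f x = v x - v (sg x) + fsum k f (sg x)]].
Proof.
have ao := order_aut.
have [_ _ _ _ muo] := ao.
exists order_map, order_inv, (partial s); split; split.
- exact: ao.
- by move=> x; have [] := order_mapP x.
- exact: measurable_partial (integ_measurable Is).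
- exact: partial_bound.
- exact: partial_base.
- have [N [mN N0 sN]] := pushes_unique (pushes_fsum t Is) ps.
  have nN : \forall x \ae mu, fsum k s (order_map x) = s' (order_map x).
    exists (order_map @^-1` N); split.
    + exact: aut_measurable ao mN.
    + by rewrite muo.
    + by move=> x /= h; exact: sN.
  by apply: filterS2 ord_ae nN => x /(partial_step s) {1}-> ->.
- move=> f If; exists (partial f); split.
  + exact: measurable_partial (integ_measurable If).
  + exact: partial_base.
  + by apply: filterS ord_ae => x; exact: partial_step.
Qed.

End Ordering.

(** The bound [beta] depends on the base point in order to include columns on which [f] is
    unbounded. The last clause uses the same [sg] for any other integrable function and asks no
    bound of its transfer function: for test functions only the column sums matter. *)
Lemma ordering (R : realType) (d : measure_display) (X : measurableType d)
    (mu : probability X R) (B B' : set X) (k : X -> X) (s s' beta : X -> R) :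
  tower mu B B' k -> integ mu s -> pushes mu k s s' -> measurable_fun setT beta ->
  (forall x, `|s x| <= beta (k x)) -> (forall x, `|s' x| <= beta x) ->
  exists (sg sg' : X -> X) (u : X -> R),
  [/\ aut mu sg sg', forall x, k (sg x) = k x, measurable_fun setT u &
      forall x, `|u x| <= beta (k x)] /\
  [/\ forall x, k x = x -> u x = 0, \forall x \ae mu, s x = u x - u (sg x) + s' (sg x) &
      forall f, integ mu f -> exists v : X -> R, [/\ measurable_fun setT v,
        forall x, k x = x -> v x = 0 &
        \forall x \ae mu, f x = v x - v (sg x) + fsum k f (sg x)]].
Proof.
move=> t Is ps mb sb s'b; have [l [r [r' kl]]] := tower_lab t.
exact: (ordering_lab t kl Is ps mb sb s'b).
Qed.

(** * Limits of automorphisms *)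

Section Limits.
Context {R : realType} {d : measure_display} {X : measurableType d}.
Variable mu : probability X R.
Implicit Types (A B Y Z : set X).

Local Notation m A := (fine (mu A)).

Definition preserving (U : X -> X) := measurable_fun setT U /\
  forall A, measurable A -> mu (U @^-1` A) = mu A.

Lemma preserving_set U A : preserving U -> measurable A -> measurable (U @^-1` A).
Proof. by move=> [mU _] mA; rewrite -[_ @^-1` _]setTI; exact: mU. Qed.

Lemma preserving_iter U n : preserving U -> preserving (iter n U).
Proof.
move=> [mU muU]; elim: n => [|n [mI muI]]; first by split => //; exact: measurable_id.
split; first by rewrite iterfS; exact: measurableT_comp.
move=> A mA; rewrite (_ : iter n.+1 U @^-1` A = iter n U @^-1` (U @^-1` A))//.
by rewrite muI ?muU//; apply: preserving_set.
Qed.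

(** For each [n] the measures of [A] and of its preimage under [U] differ by at most [m (E n)], as
    [T n] preserves the measure. *)
Lemma preserving_close U (T T' : nat -> X -> X) (E : nat -> set X) :
  measurable_fun setT U -> (forall n, aut mu (T n) (T' n)) ->
  (forall n, measurable (E n)) -> (forall n x, ~ E n x -> U x = T n x) ->
  (forall e : R, 0 < e -> exists n, m (E n) <= e) -> preserving U.
Proof.
move=> mU aT mE' UT E0; split=> // A mA.
have mUA : measurable (U @^-1` A) by rewrite -[_ @^-1` _]setTI; exact: mU.
have mTA n : measurable (T n @^-1` A) by exact: aut_measurable (aT n) mA.
rewrite (mE mu mUA) (mE mu mA); congr EFin.
have TA n : m (T n @^-1` A) = m A by have [_ _ _ _ ->] := aT n.
have close n : `|m (U @^-1` A) - m A| <= m (E n).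
  rewrite -(TA n) ler_norml; apply/andP; split.
    rewrite lerBrDl lerBlDr.
    apply: le_trans (mU_le mu mUA (mE' n)); apply: m_le => //; first exact: measurableU.
    by move=> x /= Ax; have [Ex|Ex] := pselect (E n x); [right|left; rewrite /= (UT n x Ex)].
  rewrite lerBlDr addrC.
  apply: le_trans (mU_le mu (mTA n) (mE' n)); apply: m_le => //; first exact: measurableU.
  by move=> x /= Ax; have [Ex|Ex] := pselect (E n x); [right|left; rewrite /= -(UT n x Ex)].
apply/eqP; rewrite -subr_eq0 -normr_le0 leNgt; apply/negP => p.
have [n En] : exists n, m (E n) <= `|m (U @^-1` A) - m A| / 2.
  by apply: E0; rewrite divr_gt0.
by have := le_trans (close n) En; lra.
Qed.

(** The points whose iterates under [U] and under [V] all remain in [Y] form a set [Z] of full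
    measure, invariant under both maps, which are mutually inverse on it. Off [Z] the maps are
    replaced by the identity, which gives an inverse at every point. *)
Lemma ae_invertible_aut U V Y : preserving U -> preserving V -> measurable Y ->
  mu (~` Y) = 0%E -> (forall x, Y x -> V (U x) = x /\ U (V x) = x) ->
  exists S S', aut mu S S' /\ \forall x \ae mu, S x = U x.
Proof.
move=> pU pV mY Y0 UV.
pose Z := (\bigcap_n (iter n U @^-1` Y)) `&` (\bigcap_n (iter n V @^-1` Y)).
have mZU : measurable (\bigcap_n (iter n U @^-1` Y)).
  by apply: bigcapT_measurable => n; apply: preserving_set => //; exact: preserving_iter.
have mZV : measurable (\bigcap_n (iter n V @^-1` Y)).
  by apply: bigcapT_measurable => n; apply: preserving_set => //; exact: preserving_iter.
have mZ : measurable Z by exact: measurableI.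
have null W : preserving W -> mu.-negligible (~` \bigcap_n (iter n W @^-1` Y)).
  move=> pW; rewrite setC_bigcap; apply: negligible_bigcup => n.
  have pn := preserving_iter n pW.
  exists (~` (iter n W @^-1` Y)); split=> //.
    by apply: measurableC; exact: preserving_set.
  by rewrite preimage_setC; have [_ H] := pn; have := H _ (measurableC mY); rewrite Y0.
have Z0 : mu.-negligible (~` Z) by rewrite /Z setCI; apply: negligibleU; exact: null.
have YZ x : Z x -> Y x by move=> [/(_ 0%N I)].
have ZU x : Z x -> Z (U x).
  move=> Zx; have [ZUx ZVx] := Zx; split=> n _ /=.
    by rewrite -iterSr; exact: (ZUx n.+1 I).
  case: n => [|n]; first exact: (ZUx 1%N I).
  rewrite iterSr; have [-> _] := UV x (YZ x Zx); exact: (ZVx n I).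
have ZV x : Z x -> Z (V x).
  move=> Zx; have [ZUx ZVx] := Zx; split=> n _ /=.
    case: n => [|n]; first exact: (ZVx 1%N I).
    rewrite iterSr; have [_ ->] := UV x (YZ x Zx); exact: (ZUx n I).
  by rewrite -iterSr; exact: (ZVx n.+1 I).
pose g (W : X -> X) (b : bool) := if b then W else id.
pose S x := g U (x \in Z) x; pose S' x := g V (x \in Z) x.
have mS (W : X -> X) : measurable_fun setT W -> measurable_fun setT (fun x => g W (x \in Z) x).
  move=> mW; apply: (@measurable_piecewise _ _ bool _ _ (fun x => x \in Z) (g W)).
    move=> [].
      by rewrite (_ : _ @^-1` _ = Z)//; apply/seteqP; split=> x /= h; [exact: set_mem|exact: mem_set].
    rewrite (_ : _ @^-1` _ = ~` Z); first exact: measurableC.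
    apply/seteqP; split=> x /= h; last exact: memNset.
    by move=> Zx; rewrite (mem_set Zx) in h.
  by case=> //=; exact: measurable_id.
have SZ x : Z x -> S x = U x by move=> Zx; rewrite /S mem_set.
have SZ' x : Z x -> S' x = V x by move=> Zx; rewrite /S' mem_set.
have SN x : ~ Z x -> S x = x by move=> Zx; rewrite /S memNset.
have SN' x : ~ Z x -> S' x = x by move=> Zx; rewrite /S' memNset.
have SU : \forall x \ae mu, S x = U x.
  by apply: negligibleS Z0 => x /= h Zx; apply: h; exact: SZ.
exists S, S'; split=> //; split.
- by apply: mS; case: pU.
- by apply: mS; case: pV.
- move=> x; have [Zx|Zx] := pselect (Z x); last by rewrite SN// SN'.
  by rewrite SZ// SZ'; [have [-> _] := UV x (YZ x Zx)|exact: ZU].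
- move=> x; have [Zx|Zx] := pselect (Z x); last by rewrite SN'// SN.
  by rewrite SZ'// SZ; [have [_ ->] := UV x (YZ x Zx)|exact: ZV].
move=> A mA; have [mU muU] := pU; rewrite -(muU _ mA).
have [N [mN N0 sN]] := SU.
have mSA : measurable (S @^-1` A) by rewrite -[_ @^-1` _]setTI; exact: mS.
have mUA : measurable (U @^-1` A) by exact: preserving_set.
have sub (P Q : set X) : measurable P -> measurable Q -> P `<=` Q `|` N -> (mu P <= mu Q)%E.
  move=> mP mQ PQ; rewrite -[leRHS]adde0 -N0.
  apply: (@le_trans _ _ (mu (Q `|` N))); last exact: measureU2.
  by apply: le_measure; rewrite ?inE//; exact: measurableU.
apply/eqP; rewrite eq_le; apply/andP; split; apply: sub => // x /=.
- move=> Ax; have [e|e] := pselect (S x = U x); [by left; rewrite /= -e|right; exact: sN].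
- move=> Ax; have [e|e] := pselect (S x = U x); [by left; rewrite /= e|right; exact: sN].
Qed.

Definition first_index (P : nat -> set X) (x : X) : nat :=
  if pselect (exists n, `[< P n x >]) is left e then (ex_minn e).+1 else 0%N.

Lemma first_indexS P x n : first_index P x = n.+1 -> P n x.
Proof.
by rewrite /first_index; case: pselect => // h []; case: ex_minnP => i /asboolP ? _ <-.
Qed.

Lemma first_index0 P x n : P n x -> first_index P x <> 0%N.
Proof.
rewrite /first_index; case: pselect => // h Pn _; apply: h; exists n; exact/asboolP.
Qed.

Lemma measurable_first_index P n : (forall i, measurable (P i)) ->
  measurable (first_index P @^-1` [set n]).
Proof.
move=> mP; case: n => [|n].
  rewrite (_ : _ @^-1` _ = ~` \bigcup_i P i).
    by apply: measurableC; exact: bigcupT_measurable.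
  apply/seteqP; split=> x /=.
    by move=> e [i _ /first_index0]; apply.
  rewrite /first_index; case: pselect => // h nb; exfalso.
  by case: (h) => i /asboolP Pi; apply: nb; exists i.
rewrite (_ : _ @^-1` _ = P n `&` \bigcap_(i in `I_n) ~` P i).
  apply: measurableI => //; case: n => [|n]; first by rewrite II0 bigcap_set0.
  apply: bigcap_measurable => [|i _]; first by exists 0%N.
  exact: measurableC.
apply/seteqP; split=> x /=; rewrite /first_index; case: pselect => // h.
- case: ex_minnP => j /asboolP Pj mini [<-]; split=> // i /= ij Pi.
  by have := mini i; rewrite leqNgt ij => /(_ (asboolT Pi)).
- move=> [Pn mini]; case: ex_minnP => j /asboolP Pj minj; congr S.
  apply/eqP; rewrite eqn_leq minj ?asboolT// leqNgt; apply/negP => jn.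
  exact: (mini j).
- by move=> [Pn _]; exfalso; apply: h; exists n; exact/asboolP.
Qed.

(** Once [T n x] lies outside [B n] it never changes again, since the sets [B n] decrease. So the
    limit is [T n x] for the first such [n], and the inverse at [y] is [T' n y] for the first [n]
    with [y] outside [B n]; both exist off null sets because [m (B n)] becomes arbitrarily small. *)
Lemma limit_aut (T T' : nat -> X -> X) (B : nat -> set X) :
  (forall n, aut mu (T n) (T' n)) -> (forall n, measurable (B n)) ->
  (forall n, B n.+1 `<=` B n) -> (forall n x, ~ B n (T n x) -> T n.+1 x = T n x) ->
  (forall e : R, 0 < e -> exists n, m (B n) <= e) ->
  exists S S', aut mu S S' /\
    \forall x \ae mu, exists n, forall i, (n <= i)%N -> T i x = S x.
Proof.
move=> aT mB BS TS B0.
have Bdec i j : (i <= j)%N -> B j `<=` B i.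
  move=> /subnK <-; elim: (j - i)%N => [//|n IHn].
  by rewrite addSn; exact: subset_trans (BS _) IHn.
have stable n x : ~ B n (T n x) -> forall i, (n <= i)%N -> T i x = T n x.
  move=> nB i /subnK <-; elim: (i - n)%N => [//|j IHj].
  by rewrite addSn TS ?IHj// => /(Bdec _ _ (leq_addl j n)).
pose P n := T n @^-1` (~` B n); pose Q n := ~` B n.
have mQ n : measurable (Q n) by exact: measurableC.
have mP n : measurable (P n) by exact: aut_measurable (aT n) (mQ n).
pose u n := if n is j.+1 then T j else id; pose v n := if n is j.+1 then T' j else id.
pose U x := u (first_index P x) x; pose V x := v (first_index Q x) x.
have mu_u n : measurable_fun setT (u n).
  by case: n => [|n] /=; [exact: measurable_id|have [] := aT n].
have mu_v n : measurable_fun setT (v n).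
  by case: n => [|n] /=; [exact: measurable_id|have [] := aT n].
have mU : measurable_fun setT U.
  by apply: measurable_piecewise => // i; exact: measurable_first_index.
have mV : measurable_fun setT V.
  by apply: measurable_piecewise => // i; exact: measurable_first_index.
have UT n x : P n x -> U x = T n x.
  move=> Pn; rewrite /U; case e : (first_index P x) => [|j].
    by have := first_index0 Pn.
  have Pj := first_indexS e; rewrite /u.
  by have [jn|/ltnW nj] := leqP j n; [rewrite (stable j)|rewrite (stable n)].
have VT n y : Q n y -> V y = T' n y.
  move=> Qn; rewrite /V; case e : (first_index Q y) => [|j].
    by have := first_index0 Qn.
  have Qj := first_indexS e; rewrite /v.
  have [_ _ Tj T'j _] := aT j; have [_ _ Tn T'n _] := aT n.
  have [jn|/ltnW nj] := leqP j n.
    apply: (can_inj Tn); rewrite T'n (stable j) ?T'j//.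
  apply: (can_inj Tj); rewrite T'j (stable n) ?T'n//.
have pU : preserving U.
  apply: (@preserving_close _ T T' (fun n => ~` P n)) => //.
  - by move=> n; exact: measurableC.
  - by move=> n x /contrapT; exact: UT.
  - move=> e /B0[n Bn]; exists n; rewrite /P preimage_setC setCK.
    by have [_ _ _ _ ->] := aT n.
have pV : preserving V.
  have aT' n : aut mu (T' n) (T n) := aut_sym (aT n).
  exact: (preserving_close mV aT' mB VT B0).
pose Y := (\bigcup_n P n) `&` (\bigcup_n Q n).
have mY : measurable Y by apply: measurableI; exact: bigcupT_measurable.
have null (W : nat -> set X) : (forall n, measurable (W n)) ->
    (forall n, m (~` W n) = m (B n)) -> mu.-negligible (~` \bigcup_n W n).
  move=> mW WB; have mCW : measurable (~` \bigcup_n W n).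
    by apply: measurableC; exact: bigcupT_measurable.
  exists (~` \bigcup_n W n); split=> //; rewrite (mE mu mCW); congr EFin.
  apply/eqP; rewrite eq_le m_ge0 andbT leNgt; apply/negP => p.
  have [n Bn] : exists n, m (B n) <= m (~` \bigcup_n W n) / 2.
    by apply: B0; rewrite divr_gt0.
  have : m (~` \bigcup_n W n) <= m (~` W n).
    apply: m_le => //; first exact: measurableC.
    by apply: subsetC => x Wx; exists n.
  by rewrite WB; lra.
have Y0 : mu (~` Y) = 0%E.
  apply: measure_negligible; first exact: measurableC.
  rewrite /Y setCI; apply: negligibleU; apply: null => // n.
    by rewrite /P preimage_setC setCK; have [_ _ _ _ ->] := aT n.
  by rewrite /Q setCK.
have UV x : Y x -> V (U x) = x /\ U (V x) = x.
  move=> [[n _ Pn] [j _ Qj]]; split.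
    by rewrite (UT n)// (VT n)//; have [_ _ -> _ _] := aT n.
  have [_ _ _ T'j _] := aT j.
  by rewrite (VT j)// (UT j)//; rewrite /P /= T'j.
have [S [S' [aS SU]]] := ae_invertible_aut pU pV mY Y0 UV.
exists S, S'; split=> //.
have Yae : \forall x \ae mu, Y x by exists (~` Y); split=> //; exact: measurableC.
apply: filterS2 SU Yae => x -> [[n _ Pn] _]; exists n => i ni.
by rewrite (UT n)// (stable n).
Qed.

End Limits.

(** * Refinement of columns *)

Section Construction.
Context {R : realType} {d : measure_display} {X : measurableType d}.
Variable mu : probability X R.
Implicit Types (A B : set X) (f g h : X -> R).

Local Notation m A := (fine (mu A)).

(** [H] vanishes on [B] because later stages modify [T x] only inside [B]: the term [H (T x)] is
    then already final. *)
Definition cobounds (T : X -> X) B f (H h : X -> R) : Prop :=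
  [/\ measurable_fun setT H, forall x, B x -> H x = 0, forall x, ~ B x -> h x = 0,
      integ mu h & \forall x \ae mu, f x = H x - H (T x) + h (T x)].

Record data := Data { fwd : X -> X ; bwd : X -> X ; proj : X -> X ; base : set X ;
  transfer : X -> R ; rest : X -> R }.

(* [fwd D] permutes periodically the columns over [base D], [proj D x] being the base point
   of the column of [x]; [rest D] is the sum of [f] over a column, put at its base point. *)
Record admissible f (e : R) (D : data) : Prop := Admissible {
  adm_aut : aut mu (fwd D) (bwd D) ;
  adm_base : measurable (base D) ;
  adm_proj : measurable_fun setT (proj D) ;
  adm_inv : forall x, proj D (fwd D x) = proj D x ;
  adm_fix : forall x, base D x -> proj D x = x ;
  adm_cob : cobounds (fwd D) (base D) f (transfer D) (rest D) ;
  adm_bound : bounded_on (base D) e (rest D) ;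
  adm_mean : \int[mu]_x rest D x = 0 ;
  adm_all : forall h, integ mu h -> \int[mu]_x h x = 0 ->
    exists H h', cobounds (fwd D) (base D) h H h' /\ \int[mu]_x h' x = 0 }.

Lemma aut_ae T S (P : X -> Prop) : aut mu T S -> (\forall x \ae mu, P x) ->
  \forall x \ae mu, P (T x).
Proof.
move=> aT [N [mN N0 sN]]; exists (T @^-1` N); split.
- exact: aut_measurable aT mN.
- by have [_ _ _ _ ->] := aT.
- by move=> x /= h; apply: sN.
Qed.

Section refine.
Variables (T T' p : X -> X) (B B' : set X) (k sg sg' : X -> X).
Hypotheses (aT : aut mu T T') (mp : measurable_fun setT p)
  (pT : forall x, p (T x) = p x) (pB : forall x, B x -> p x = x)
  (t : tower mu B B' k) (asg : aut mu sg sg') (ksg : forall x, k (sg x) = k x).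

Lemma refine_out x : ~ B x -> sg x = x.
Proof.
move=> Bx; have kx := tower_out t Bx; have e := ksg x; rewrite kx in e.
have [Bs|Bs] := pselect (B (sg x)); last by rewrite -[LHS](tower_out t Bs).
by exfalso; apply: Bx; rewrite -e; apply: (tower_sub t); exact: (tower_in t).
Qed.

Lemma refine_in x : B x -> B (sg x).
Proof.
move=> Bx; apply: contrapT => Bs; apply: (Bs).
rewrite -[sg x](tower_out t Bs) ksg; apply: (tower_sub t); exact: (tower_in t).
Qed.

(** Composing with [sg] stacks columns: it redirects only the returns to [B]. The value of [v] at
    the base point is added along the whole old column, so nothing changes inside it; at a return,
    [p x = T x], and the equation for [h] at [T x] supplies the new terms. *)
Lemma refine_cobounds f H h (v : X -> R) h' : cobounds T B f H h -> measurable_fun setT v ->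
  (forall x, k x = x -> v x = 0) -> integ mu h' -> (forall x, ~ B' x -> h' x = 0) ->
  (\forall x \ae mu, h x = v x - v (sg x) + h' (sg x)) ->
  cobounds (sg \o T) B' f (fun x => H x + v (p x)) h'.
Proof.
move=> [mH HB hB Ih fE] mv v0 Ih' h'B hE; split=> //.
- by apply: measurable_funD => //; exact: measurableT_comp.
- move=> x B'x; rewrite HB ?pB ?v0 ?addr0//; first exact: (tower_fix t).
  + exact: (tower_sub t).
  + exact: (tower_sub t).
apply: filterS2 fE (aut_ae aT hE) => x -> hTx /=.
have [By|By] := pselect (B (T x)); last first.
  rewrite refine_out// hB// h'B; last by move=> /(tower_sub t).
  by rewrite pT; ring.
have Bs := refine_in By.
rewrite (HB _ Bs) (HB _ By) (pB Bs) -pT (pB By) hTx; ring.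
Qed.

End refine.

(** The transfer function changes by the bounded function [u] at the base point, hence by at most
    the old bound [e]. The condition [e' <= e] lets this single bound cover the new column sums too,
    as the greedy order requires. The test function, arbitrary at each step, is first replaced by
    its sums over the present columns. *)
Lemma step f (e e' delta : R) (D : data) (h : X -> R) :
  swappable mu -> splittable mu ->
  0 < e -> 0 < e' -> e' <= e -> 0 < delta ->
  admissible f e D -> integ mu h -> \int[mu]_x h x = 0 ->
  exists D', [/\ admissible f e' D',
    [/\ base D' `<=` base D, m (base D') <= m (base D) / 2,
        forall x, ~ base D (fwd D x) -> fwd D' x = fwd D x &
        forall x, base D (fwd D x) -> base D (fwd D' x)],
    forall x, `|transfer D' x - transfer D x| <= e &
    exists H h', cobounds (fwd D') (base D') h H h' /\ \int[mu]_x `|h' x| <= delta].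
Proof.
move=> sw sp e0 e'0 ee delta0 [aT mB mp pT pB cob bs s0 all_] Ih h0.
have [H [h1 [ch h10]]] := all_ h Ih h0.
have [_ _ h1B Ih1 _] := ch.
have [B' [k [s' [t ps bs' mB' small]]]] := stage sw sp e0 e'0 delta0 mB bs s0 Ih1 h1B h10.
have [ms se sB] := bs; have [ms' s'e s'B] := bs'.
have Is := bounded_integ mu bs.
have [|x|sg [sg' [u [[asg ksg mu_ ub] [u0 us all_u]]]]] :=
  @ordering _ _ _ mu (base D) B' k (rest D) s' (cst e) t Is ps _ se.
- exact: measurable_cst.
- exact: le_trans (s'e x) ee.
have ref := refine_cobounds aT mp pT pB t ksg.
pose D' := Data (sg \o fwd D) (bwd D \o sg') (k \o proj D) B'
  (fun x => transfer D x + u (proj D x)) s'.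
have fsumB g x : (forall x, ~ base D x -> g x = 0) -> ~ B' x -> fsum k g x = 0.
  by move=> gB; exact: fsum_out t gB.
exists D'; split.
- split.
  + exact: aut_comp.
  + exact: (tower_meas t).
  + by apply: measurableT_comp => //; exact: (tower_fun t).
  + move=> x /=; have [By|By] := pselect (base D (fwd D x)).
      by rewrite (pB _ (refine_in t ksg By)) ksg -pT (pB _ By).
    by rewrite (refine_out t ksg By) pT.
  + move=> x B'x /=; rewrite (pB x); first exact: (tower_fix t).
    exact: (tower_sub t).
  + by apply: ref cob mu_ u0 _ _ us => //; exact: ps.1.
  + exact: bs'.
  + by rewrite /= (pushes_mean ps).
  + move=> g Ig g0; have [H2 [h2 [c2 h20]]] := all_ g Ig g0.
    have [_ _ h2B Ih2 _] := c2.
    have [v [mv v0 hv]] := all_u h2 Ih2.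
    exists (fun x => H2 x + v (proj D x)), (fsum k h2); split.
      apply: ref c2 mv v0 _ _ hv; first exact: fsum_integ t Ih2.
      by move=> x; exact: fsumB.
    by rewrite (pushes_mean (pushes_fsum t Ih2)).
- split=> //.
  + exact: (tower_sub t).
  + by move=> x Bx /=; rewrite (refine_out t ksg Bx).
  + by move=> x Bx /=; exact: (refine_in t ksg Bx).
- by move=> x /=; rewrite addrC addKr.
have [v [mv v0 hv]] := all_u h1 Ih1.
exists (fun x => H x + v (proj D x)), (fsum k h1); split.
  apply: ref ch mv v0 _ _ hv; first exact: fsum_integ t Ih1.
  by move=> x; exact: fsumB.
by apply: small; exact: pushes_fsum t Ih1.
Qed.

End Construction.

(** * Coboundaries and ergodicity *)

Section Coboundaries.
Context {R : realType} {d : measure_display} {X : measurableType d}.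
Variable mu : probability X R.

Lemma ae_Rintegral (A : set X) (f g : X -> R) : measurable A -> measurable_fun setT f ->
  measurable_fun setT g -> (\forall x \ae mu, f x = g x) ->
  \int[mu]_(x in A) f x = \int[mu]_(x in A) g x.
Proof.
move=> mA mf mg fg; congr fine; apply: ae_eq_integral => //.
- by apply/measurable_EFinP; exact: measurable_funTS.
- by apply/measurable_EFinP; exact: measurable_funTS.
- by apply: filterS fg => x -> _.
Qed.

Let clip (n : nat) (y : R) : R := Num.max (- n%:R) (Num.min n%:R y).

Let clip_le n y : `|clip n y| <= n%:R.
Proof.
have n0 : 0 <= n%:R :> R by [].
by rewrite /clip ler_norml le_max lexx /= ge_max ge_min lexx /= andbT; lra.
Qed.

Let clip_lip n y z : `|clip n y - clip n z| <= `|y - z|.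
Proof.
have n0 : 0 <= n%:R :> R by [].
have case_clip w : [\/ n%:R <= w /\ clip n w = n%:R, w <= - n%:R /\ clip n w = - n%:R |
    [/\ - n%:R <= w, w <= n%:R & clip n w = w]].
  rewrite /clip; have [?|?] := leP n%:R w; first by apply: Or31; split=> //; rewrite max_r//; lra.
  have [?|?] := leP w (- n%:R); first by apply: Or32.
  by apply: Or33; rewrite !ltW.
have := ler_norm (y - z); have := ler_norm (z - y); rewrite distrC => ? ?.
rewrite ler_norml; apply/andP; move: (case_clip y) (case_clip z).
by move=> [[? ->]|[? ->]|[? ? ->]] [[? ->]|[? ->]|[? ? ->]]; split; lra.
Qed.

(* The integral over [A] vanishes for the truncations of [H], which are integrable;
   truncating does not increase differences, so dominated convergence applies. *)
Lemma coboundary_mean S S' (A : set X) (F H : X -> R) : aut mu S S' -> measurable A ->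
  S @^-1` A = A -> measurable_fun setT H -> integ mu F ->
  (\forall x \ae mu, F x = H x - H (S x)) -> \int[mu]_(x in A) F x = 0.
Proof.
move=> aS mA SA mH IF FE.
have mS : measurable_fun setT S by have [] := aS.
have mF := integ_measurable IF.
pose Hn n x := clip n (H x).
have mHn n : measurable_fun setT (Hn n).
  by apply: measurable_maxr => //; apply: measurable_minr.
have IHn n : integ mu (Hn n).
  by apply: (@integ_bounded _ _ _ mu _ n%:R) => // x; exact: clip_le.
have IHS n : integ mu (Hn n \o S) by exact: aut_integ aS (IHn n).
have z n : \int[mu]_(x in A) (Hn n x - Hn n (S x)) = 0.
  rewrite RintegralB//; [|exact: integ_sub|exact: (integ_sub mA (IHS n))].
  by rewrite -{2}SA (aut_Rintegral aS mA (IHn n)) subrr.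
rewrite (@ae_Rintegral A F (fun x => H x - H (S x)))//; last first.
  by apply: measurable_funB => //; exact: measurableT_comp.
have [|||||_ _ lim_] := @dominated_convergence _ _ _ mu A mA
  (fun n x => (Hn n x - Hn n (S x))%:E) (fun x => (H x - H (S x))%:E)
  (fun x => `|F x|%:E).
- move=> n; apply/measurable_EFinP; apply: measurable_funTS; apply: measurable_funB => //.
  exact: measurableT_comp.
- apply/measurable_EFinP; apply: measurable_funTS; apply: measurable_funB => //.
  exact: measurableT_comp.
- apply: aeW => x _; apply: cvg_near_cst; near=> n.
  have e y : `|y| <= n%:R -> clip n y = y.
    by rewrite ler_norml /clip => /andP[? ?]; rewrite min_r// max_r.
  rewrite /Hn !e//; near: n; exact: nbhs_infty_ger.
- exact: (integ_sub mA (integ_abs IF)).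
- apply: filterS FE => x Fx n _ /=; rewrite lee_fin Fx; exact: clip_lip.
have e0 : (fun n => \int[mu]_(x in A) (Hn n x - Hn n (S x))%:E)%E = fun=> 0%E.
  apply/funext => n; rewrite -[LHS]fineK; first by congr EFin; exact: z.
  apply: integrable_fin_num => //.
  by apply: (integ_sub mA (integB (IHn n) (IHS n))).
rewrite e0 in lim_; rewrite /Rintegral -(cvg_lim _ lim_)//.
by rewrite lim_cst.
Unshelve. all: by end_near. Qed.

End Coboundaries.

Section Assembly.
Context {R : realType} {d : measure_display} {X : measurableType d}.
Variable mu : probability X R.
Hypotheses (sw : swappable mu) (sp : splittable mu).
Variables (f : X -> R) (e0 : R) (D0 : @data R d X).
Hypotheses (e0_gt0 : 0 < e0) (adm0 : admissible mu f e0 D0).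

Local Notation m A := (fine (mu A)).
Local Notation e n := (e0 * 2^-1 ^+ n).

Let e_gt0 n : 0 < e n. Proof. by rewrite mulr_gt0// exprn_gt0. Qed.

Let eS n : e n.+1 = e n / 2. Proof. by rewrite exprSr mulrA. Qed.

Let e_small (c : R) : 0 < c -> exists n, e n <= c.
Proof.
move=> c0; have := @cvg_geometric R e0 2^-1; rewrite ger0_norm// => /(_ _)/wrap[].
  by rewrite invf_lt1// ltr1n.
move=> /cvgrPdist_lt/(_ _ c0) [N _ /(_ N)]/=; rewrite leqnn => /(_ isT).
by rewrite sub0r normrN /geometric /= gtr0_norm// => /ltW ?; exists N.
Qed.

Lemma iterate_step (h : nat -> X -> R) (delta : nat -> R) :
  (forall n, integ mu (h n)) -> (forall n, \int[mu]_x h n x = 0) ->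
  (forall n, 0 < delta n) ->
  exists D : nat -> @data R d X, D 0%N = D0 /\ forall n, admissible mu f (e n) (D n) /\
   [/\ [/\ base (D n.+1) `<=` base (D n), m (base (D n.+1)) <= m (base (D n)) / 2,
        forall x, ~ base (D n) (fwd (D n) x) -> fwd (D n.+1) x = fwd (D n) x &
        forall x, base (D n) (fwd (D n) x) -> base (D n) (fwd (D n.+1) x)],
    forall x, `|transfer (D n.+1) x - transfer (D n) x| <= e n &
    exists H h', cobounds mu (fwd (D n.+1)) (base (D n.+1)) (h n) H h' /\
      \int[mu]_x `|h' x| <= delta n].
Proof.
move=> Ih h0 d0.
have /choice[F FP] : forall nD : nat * @data R d X, exists D',
    admissible mu f (e nD.1) nD.2 -> admissible mu f (e nD.1.+1) D' /\
   [/\ [/\ base D' `<=` base nD.2, m (base D') <= m (base nD.2) / 2,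
        forall x, ~ base nD.2 (fwd nD.2 x) -> fwd D' x = fwd nD.2 x &
        forall x, base nD.2 (fwd nD.2 x) -> base nD.2 (fwd D' x)],
    forall x, `|transfer D' x - transfer nD.2 x| <= e nD.1 &
    exists H h', cobounds mu (fwd D') (base D') (h nD.1) H h' /\
      \int[mu]_x `|h' x| <= delta nD.1].
  move=> [n D] /=; have [aD|naD] := pselect (admissible mu f (e n) D); last by exists D.
  have ee : e n.+1 <= e n by rewrite eS; have := e_gt0 n; lra.
  have [D' [? ? ? ?]] := step sw sp (e_gt0 n) (e_gt0 n.+1) ee (d0 n) aD (Ih n) (h0 n).
  by exists D'.
pose D := fix D n := if n is i.+1 then F (i, D i) else D0.
have aD n : admissible mu f (e n) (D n).
  by elim: n => [|n IHn]; [rewrite expr0 mulr1|have [] := FP (n, D n) IHn].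
exists D; split=> // n; split; first exact: aD.
by have [_] := FP (n, D n) (aD n).
Qed.

Section limit.
Variables (h : nat -> X -> R) (delta : nat -> R) (D : nat -> @data R d X).
Hypotheses (Ih : forall n, integ mu (h n)) (D0E : D 0%N = D0)
  (aD : forall n, admissible mu f (e n) (D n))
  (BS : forall n, base (D n.+1) `<=` base (D n))
  (mB : forall n, m (base (D n.+1)) <= m (base (D n)) / 2)
  (Tout : forall n x, ~ base (D n) (fwd (D n) x) -> fwd (D n.+1) x = fwd (D n) x)
  (Tin : forall n x, base (D n) (fwd (D n) x) -> base (D n) (fwd (D n.+1) x))
  (Ge : forall n x, `|transfer (D n.+1) x - transfer (D n) x| <= e n)
  (small : forall n, exists H h', cobounds mu (fwd (D n.+1)) (base (D n.+1)) (h n) H h' /\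
      \int[mu]_x `|h' x| <= delta n).

Let G n := transfer (D n).
Let T n := fwd (D n).
Let B n := base (D n).

Lemma base_decr i j : (i <= j)%N -> B j `<=` B i.
Proof.
move=> /subnK <-; elim: (j - i)%N => [//|n IHn].
by rewrite addSn; apply: subset_trans IHn; exact: BS.
Qed.

Lemma base_small (c : R) : 0 < c -> exists n, m (B n) <= c.
Proof.
move=> c0; have [n nc] := e_small (mulr_gt0 c0 e0_gt0); exists n.
have mBn : m (B n) <= 2^-1 ^+ n.
  elim: n {nc} => [|n IHn]; first by rewrite expr0 m_le1//; exact: (adm_base (aD 0)).
  by apply: le_trans (mB n) _; rewrite exprSr ler_pM2r.
apply: le_trans mBn _; rewrite -(ler_pM2l e0_gt0); apply: le_trans nc _.
by rewrite mulrC.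
Qed.

(** An image outside [B i] at stage [i] is final; otherwise it can only move inside [B i]. Functions
    vanishing on [B i] do not see the difference. *)
Lemma fwd_later i j x : (i <= j)%N -> T j x = T i x \/ B i (T j x) /\ B i (T i x).
Proof.
move=> /subnK <-; elim: (j - i)%N => [|n IHn]; first by left.
rewrite addSn; have dec := @base_decr i (n + i) (leq_addl _ _).
have [Bn|Bn] := pselect (B (n + i) (T (n + i) x)); last first.
  by have -> : T (n + i).+1 x = T (n + i)%N x by exact: Tout.
right; split; first by apply: dec; exact: Tin.
by case: IHn => [<-|[]//]; exact: dec.
Qed.

Lemma limit_exists : exists S S' (g : X -> R), [/\ aut mu S S', measurable_fun setT g,
  forall x, `|g x - transfer D0 x| <= 2 * e0, \forall x \ae mu, f x = g x - g (S x) &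
  forall A n, measurable A -> S @^-1` A = A -> `|\int[mu]_(x in A) h n x| <= delta n].
Proof.
have mBn n : measurable (B n) by exact: (adm_base (aD n)).
have [S [S' [aS STx]]] := limit_aut (fun n => adm_aut (aD n)) mBn BS Tout base_small.
have mS : measurable_fun setT S by have [] := aS.
have Hlim n (H : X -> R) : (forall x, B n x -> H x = 0) ->
    \forall x \ae mu, H (T n x) = H (S x).
  move=> HB; apply: filterS STx => x [j jS].
  have <- : T (maxn j n) x = S x by apply: jS; exact: leq_maxl.
  have [->//|[b1 b2]] := @fwd_later n (maxn j n) x (leq_maxr _ _).
  by rewrite !HB.
(* The tail of the geometric series, written so that the induction on [i] closes. *)
have Gm n i x : `|G (n + i)%N x - G n x| <= 2 * e n - 2 * e (n + i)%N.
  elim: i => [|i IHi]; first by rewrite addn0 !subrr normr0.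
  rewrite addnS; have := Ge (n + i) x; rewrite eS -/(G _) -/(G _) => Gi.
  have -> : G (n + i).+1 x - G n x = G (n + i).+1 x - G (n + i)%N x + (G (n + i)%N x - G n x).
    by rewrite addrA subrK.
  by apply: le_trans (ler_normD _ _) _; lra.
(* These lower bounds for the limit increase with [n]; their supremum defines [g] at every point. *)
pose E x := [set G n x - 2 * e n | n in setT].
have ubE x n : ubound (E x) (G n x + 2 * e n).
  move=> _ [i _ <-]; have := e_gt0 i; have := e_gt0 n.
  have [ni|ni] := leqP n i.
    by have := Gm n (i - n)%N x; rewrite subnKC// ler_norml => /andP[? ?]; lra.
  by have := Gm i (n - i)%N x; rewrite subnKC ?(ltnW ni)// ler_norml => /andP[? ?]; lra.
pose g x := sup (E x).
have gG n x : `|g x - G n x| <= 2 * e n.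
  have supE : has_sup (E x) by split; [exists (G 0%N x - 2 * e 0%N); exists 0%N|exists (G 0%N x + 2 * e 0%N)].
  have h1 : G n x - 2 * e n <= g x by apply: (sup_upper_bound supE); exists n.
  have h2 : g x <= G n x + 2 * e n by apply: ge_sup => //; exact: supE.1.
  by rewrite ler_norml; apply/andP; split; lra.
have mG n : measurable_fun setT (G n) by have [] := adm_cob (aD n).
have mg : measurable_fun setT g.
  apply: (measurable_fun_cvg mG) => x _; apply/cvgrPdist_le => c c0.
  have [N Nc] := e_small (divr_gt0 c0 (ltr0n R 2)).
  exists N => // n /= Nn; apply: le_trans (gG n x) _.
  have : e n <= e N.
    by rewrite ler_pM2l// ler_wiXn2l// invf_le1// ler1n.
  lra.
exists S, S', g; split=> //.
- by move=> x; have := gG 0%N x; rewrite /G D0E expr0 mulr1.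
- have all_ : \forall x \ae mu, forall n, f x = G n x - G n (T n x) + rest (D n) (T n x)
      /\ G n (T n x) = G n (S x).
    apply/ae_foralln => n; have [_ G0 _ _ fE] := adm_cob (aD n).
    by apply: filterS2 fE (Hlim n (G n) G0) => x.
  apply: filterS all_ => x fx; apply/eqP; rewrite -subr_eq0 -normr_le0.
  apply/ler_addgt0Pr => c c0; rewrite add0r.
  (* Replacing [g] by [G n] costs [2 e n] at [x] and at [S x], and the remaining column sum costs
     [e n]: five times [e n] in all. *)
  have [n nc] := e_small (divr_gt0 c0 (ltr0n R 5)).
  have [fn gn] := fx n; rewrite fn gn.
  have := gG n x; have := gG n (S x); have [_ se _] := adm_bound (aD n).
  have := se (T n x); rewrite !ler_norml => /andP[? ?] /andP[? ?] /andP[? ?].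
  apply/andP; split; lra.
move=> A n mA SA; have [H [h' [[mH HB _ Ih' hE] hd]]] := small n.
have aT := adm_aut (aD n.+1).
have IT := aut_integ aT Ih'.
have IhT := integB (Ih n) IT.
(* [h n] minus [h'] along [T n.+1] is a coboundary for the limit [S] as well, because [H] vanishes
   on the base; its integral over an invariant set is therefore zero. *)
have z : \int[mu]_(x in A) (h n x - h' (T n.+1 x)) = 0.
  apply: (coboundary_mean aS mA SA mH IhT).
  by apply: filterS2 hE (Hlim n.+1 H HB) => x -> /= <-; rewrite addrK.
have -> : \int[mu]_(x in A) h n x = \int[mu]_(x in A) h' (T n.+1 x).
  apply/eqP; rewrite -subr_eq0 -RintegralB ?z//; [exact: integ_sub|].
  exact: (integ_sub mA IT).
apply: le_trans hd; have mT : measurable_fun setT (T n.+1) by have [] := aT.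
apply: (@le_trans _ _ (\int[mu]_(x in A) `|h' (T n.+1 x)|)).
  by apply: le_normr_Rintegral => //; exact: (integ_sub mA IT).
have <- : \int[mu]_x `|h' (T n.+1 x)| = \int[mu]_x `|h' x|.
  have := aut_Rintegral aT measurableT (integ_abs Ih').
  by rewrite preimage_setT.
rewrite (Rintegral_split mA (integ_abs IT)) lerDl Rintegral_ge0//.
Qed.

End limit.

Definition separating (A : nat -> set X) := (forall i, measurable (A i)) /\
  forall C, measurable C -> (forall i, mu (C `&` A i) = (mu C * mu (A i))%E) ->
  mu C = 0%E \/ mu C = 1%E.

(** The test functions are [1_(A i) - m (A i)], each taken infinitely often with accuracies
    [1 / (j + 1)]: [idx] enumerates the pairs. An invariant set [C] is then independent of every
    [A i], and separation makes it trivial. *)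
Lemma ergodic_cobounding (A : nat -> set X) : separating A ->
  exists S S' (g : X -> R), [/\ aut mu S S', ergodic mu S, measurable_fun setT g,
    forall x, `|g x - transfer D0 x| <= 2 * e0 & \forall x \ae mu, f x = g x - g (S x)].
Proof.
move=> [mA sepA].
pose idx n := if @unpickle (nat * nat)%type n is Some ij then ij else (0, 0)%N.
pose h n x : R := \1_(A (idx n).1) x - m (A (idx n).1).
pose delta n : R := (idx n).2.+1%:R^-1.
have Ic c : integ mu (fun=> c) by apply: (@integ_bounded _ _ _ mu _ `|c|).
have Ih n : integ mu (h n) by apply: integB; [exact: integ_indicator|exact: Ic].
have intA C i : measurable C -> \int[mu]_(x in C) (\1_(A i) x - m (A i)) =
    m (C `&` A i) - m C * m (A i).
  move=> mC; rewrite RintegralB//; last 2 first.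
  - by apply: (integ_sub mC); exact: integ_indicator.
  - by apply: (integ_sub mC); exact: Ic.
  congr (_ - _); last by rewrite Rintegral_cst// mulrC.
  by rewrite /Rintegral integral_indic// setIC.
have h0 n : \int[mu]_x h n x = 0.
  by rewrite intA// setTI probability_setT /= mul1r subrr.
have d0 n : 0 < delta n by rewrite invr_gt0.
have [D [D0E DP]] := iterate_step Ih h0 d0.
have [|||||||S [S' [g [aS mg gG fE hA]]]] := @limit_exists h delta D Ih D0E.
- by move=> n; have [] := DP n.
- by move=> n; have [_ [[]]] := DP n.
- by move=> n; have [_ [[]]] := DP n.
- by move=> n; have [_ [[]]] := DP n.
- by move=> n; have [_ [[]]] := DP n.
- by move=> n; have [_ []] := DP n.
- by move=> n; have [_ []] := DP n.
exists S, S', g; split=> // C mC SC; apply: sepA => // i.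
rewrite (mE mu mC) (mE mu (mA i)) (mE mu (measurableI _ _ mC (mA i))) -EFinM.
congr EFin; apply/eqP; rewrite -subr_eq0 -normr_le0; apply/ler_addgt0Pr => c c0; rewrite add0r.
have [k kc] : exists k, k.+1%:R^-1 <= c.
  exists (Num.truncn c^-1); rewrite invf_ple ?posrE//; apply/ltW/truncnS_gt.
have := hA C (pickle (i, k)) mC SC.
by rewrite /h /delta /idx pickleK /= intA// => /le_trans; apply.
Qed.

End Assembly.

(** * Standard probability spaces *)

Section Laws.
Context {R : realType} {d : measure_display} {X : measurableType d}.

Lemma ray_law (m1 m2 : {measure set X -> \bar R}) (g h : X -> R) :
  measurable_fun setT g -> measurable_fun setT h -> (m1 setT < +oo)%E ->
  (forall t, m1 [set x | t < g x] = m2 [set x | t < h x]) ->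
  forall B, measurable B -> m1 (g @^-1` B) = m2 (h @^-1` B).
Proof.
move=> mg mh m1oo gh B mB.
have rayE k t : k @^-1` (`]t, +oo[ : set R) = [set x : X | t < k x].
  by apply/seteqP; split=> x /=; rewrite in_itv/= andbT.
unshelve refine (@measure_unique _ R _ (@RGenOInfty.G R)
  (fun k : nat => `]- k%:R, +oo[%classic) _ _ _ _ (pushforward m1 g) (pushforward m2 h) _ _ B mB) => //.
- exact: RGenOInfty.measurableE.
- move=> _ _ [s ->] [t ->]; exists (Num.max s t).
  by apply/seteqP; split=> x /=; rewrite !in_itv/= !andbT gt_max; [case=> -> ->|case/andP].
- by move=> k; exists (- k%:R).
- apply/seteqP; split=> // x _; exists (Num.truncn `|x|).+1 => //=.
  rewrite in_itv/= andbT ltrNl; apply: le_lt_trans (truncnS_gt _).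
  by rewrite -normrN ler_norm.
- by move=> _ [t ->]; rewrite /= /pushforward !rayE.
- move=> k; rewrite /= /pushforward; apply: le_lt_trans m1oo; apply: le_measure; rewrite ?inE//.
  by rewrite -[X in measurable X]setTI; exact: mg.
Qed.

Lemma measure_eq_mod (mu : probability X R) (A B N : set X) : measurable A -> measurable B ->
  mu.-negligible N -> (forall x, ~ N x -> A x <-> B x) -> mu A = mu B.
Proof.
move=> mA mB [M [mM M0 NM]] AB.
have half C D : measurable C -> measurable D -> (forall x, ~ N x -> C x -> D x) -> (mu C <= mu D)%E.
  move=> mC mD CD; apply: (@le_trans _ _ (mu (D `|` M))).
    apply: le_measure; rewrite ?inE//; first exact: measurableU.
    move=> x Cx; have [Nx|Nx] := pselect (N x); first by right; exact: NM.
    by left; exact: CD.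
  have -> : mu D = (mu D + mu M)%E by rewrite M0 adde0.
  exact: measureU2.
by apply/eqP; rewrite eq_le; apply/andP; split; apply: half => // x /AB[].
Qed.

End Laws.

Section Codings.
Context {R : realType} {d : measure_display} {X : measurableType d}.
Variable mu : probability X R.
Local Notation m A := (fine (mu A)).

(* Up to null sets, [c] identifies [X] with a Borel set carrying the measure of [0, 1]; the
   measurable sets are the Borel sets, or their completions. *)
Record coding (c : X -> R) (psi : R -> X) (X0 : set X) (Y0 : set R) : Prop := Coding {
  cod_fun : measurable_fun setT c ;
  cod_X0 : measurable X0 ;
  cod_null : mu (~` X0) = 0%E ;
  cod_Y0 : measurable Y0 ;
  cod_range : forall x, 0 <= c x <= 1 ;
  cod_in : forall x, X0 x -> Y0 (c x) ;
  cod_out : forall y, Y0 y -> X0 (psi y) ;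
  cod_K : forall x, X0 x -> psi (c x) = x ;
  cod_K' : forall y, Y0 y -> c (psi y) = y ;
  cod_law : forall s t, s <= t -> (mu [set x | (s < c x <= t)%R] <= (t - s)%:E)%E ;
  cod_sets : (forall A, measurable A -> exists2 B, measurable B &
      forall y, Y0 y -> A (psi y) <-> B y) \/
    (forall A, measurable A -> exists B N, [/\ measurable B, measurable N,
      mu (c @^-1` N) = 0%E & forall y, Y0 y -> ~ N y -> A (psi y) <-> B y]) /\
    (forall M Z, measurable M -> mu M = 0%E -> M `<=` X0 -> Z `<=` M -> measurable Z) }.

Variables (c : X -> R) (psi : R -> X) (X0 : set X) (Y0 : set R).
Hypothesis cod : coding c psi X0 Y0.

Let mc : measurable_fun setT c := cod_fun cod.

Let mcB (B : set R) : measurable B -> measurable (c @^-1` B).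
Proof. by move=> mB; rewrite -[X in measurable X]setTI; exact: mc. Qed.

Let mcf (f : R -> R) (B : set R) : measurable_fun setT f -> measurable B ->
  measurable [set x | B (f (c x))].
Proof.
move=> mf mB; rewrite -[X in measurable X]setTI.
by have := measurableT_comp mf mc; apply.
Qed.

Let mlt t : measurable [set x | t < c x].
Proof. by apply: measurable_lt_set => //; exact: measurable_cst. Qed.

Let mle t : measurable [set x | c x <= t].
Proof. by apply: measurable_le_set => //; exact: measurable_cst. Qed.

Lemma cod_approx A : measurable A -> exists B N, [/\ measurable B, measurable N,
  mu (c @^-1` N) = 0%E & forall y, Y0 y -> ~ N y -> A (psi y) <-> B y].
Proof.
case: (cod_sets cod) => [h /h[B mB AB]|[h _] /h//].
by exists B, set0; split=> //; [rewrite preimage_set0 measure0|move=> y Yy _; exact: AB].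
Qed.

(** In the completed case [A] corresponds to a Borel set only off a null set [N]; the part of the
    preimage lying over [N] is contained in a null set, by the assumption on [tau], and is
    measurable by completeness. *)
Lemma cod_lift (P : set X) (tau : R -> R) (A : set X) : measurable P -> P `<=` X0 ->
  measurable_fun setT tau ->
  (forall N, measurable N -> mu (c @^-1` N) = 0%E -> mu (P `&` [set x | N (tau (c x))]) = 0%E) ->
  (forall x, P x -> Y0 (tau (c x))) -> measurable A ->
  measurable (P `&` [set x | A (psi (tau (c x)))]).
Proof.
move=> mP PX mtau ns PY mA.
case: (cod_sets cod) => [/(_ A mA)[B mB AB]|[/(_ A mA)[B [N [mB mN N0 AB]]] compl]].
  rewrite (_ : _ `&` _ = P `&` [set x | B (tau (c x))]).
    by apply: measurableI => //; exact: (mcf mtau mB).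
  by apply/seteqP; split=> x [Px /= h]; split=> //=; have [? ?] := AB _ (PY x Px); auto.
pose M := P `&` [set x | N (tau (c x))].
have mM : measurable M by apply: measurableI => //; exact: (mcf mtau mN).
set Q := P `&` [set x | A (psi (tau (c x)))].
have -> : Q = (P `&` [set x | B (tau (c x))] `\` M) `|` (Q `&` M).
  apply/seteqP; split=> x.
    move=> [Px Ax]; have [Mx|Mx] := pselect (M x); [right|left]; do 2?split=> //.
    by have [|h _] := AB _ (PY x Px); [move=> Nx; apply: Mx|exact: h].
  move=> [[[Px Bx] Mx]|[]//]; split=> //.
  by have [|_ h] := AB _ (PY x Px); [move=> Nx; apply: Mx|exact: h].
apply: measurableU.
  by apply: measurableD => //; apply: measurableI => //; exact: (mcf mtau mB).
by apply: (compl M) => //; [exact: ns|move=> x [/PX]].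
Qed.

Section cumulative.
Variables (U : set X).
Hypothesis mU : measurable U.

(** The distribution function of [c] under the restriction of [mu] to [U]. It is [1]-Lipschitz by
    [cod_law]; this is the form in which the absence of atoms is used. *)
Definition cum (t : R) : R := m (U `&` [set x | c x <= t]).

Let mUle t : measurable (U `&` [set x | c x <= t]). Proof. exact: measurableI. Qed.
Let mUlt t : measurable (U `&` [set x | t < c x]). Proof. exact: measurableI. Qed.

Lemma cum_ge0 t : 0 <= cum t. Proof. exact: m_ge0. Qed.

Lemma cum_le t : cum t <= m U.
Proof. by apply: m_le => // x []. Qed.

Lemma cum_nondecreasing s t : s <= t -> cum s <= cum t.
Proof. by move=> st; apply: m_le => // x [Ux /= xs]; split=> //=; exact: le_trans st. Qed.

Lemma cum_lipschitz s t : s <= t -> cum t <= cum s + (t - s).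
Proof.
move=> st; have mst : measurable [set x | s < c x <= t].
  rewrite (_ : mkset _ = [set x | s < c x] `&` [set x | c x <= t]); first exact: measurableI.
  by apply/seteqP; split=> x /=; [move/andP|move=> [-> ->]].
rewrite -lee_fin EFinD -(mE mu (mUle t)) -(mE mu (mUle s)).
apply: (@le_trans _ _ (mu ((U `&` [set x | c x <= s]) `|` [set x | s < c x <= t]))).
  apply: le_measure; rewrite ?inE//; first exact: measurableU.
  move=> x [Ux /= xt]; have [xs|xs] := leP (c x) s; [by left|right] => /=.
  by rewrite xt.
by apply: le_trans (measureU2 _ _ _) _ => //; rewrite leeD2l// (cod_law cod).
Qed.

Lemma cum_le0 t : t <= 0 -> cum t = 0.
Proof.
have cn (s : R) : s < 0 -> cum s = 0.
  move=> s0; rewrite /cum (_ : _ `&` _ = set0) ?measure0//.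
  apply/seteqP; split=> // x [_ /= xs]; have /andP[? ?] := cod_range cod x; lra.
rewrite le_eqVlt => /orP[/eqP->|/cn//]; apply/eqP; rewrite eq_le cum_ge0 andbT.
apply/ler_addgt0Pr => e e0; have ne : - (e : R) <= 0 by rewrite oppr_le0 ltW.
by have := cum_lipschitz ne; rewrite (cn (- (e : R))) ?oppr_lt0 // sub0r opprK.
Qed.

Lemma cum_ge1 t : 1 <= t -> cum t = m U.
Proof.
move=> t1; rewrite /cum (_ : _ `&` _ = U)//; apply/seteqP; split=> [x []//|x Ux].
by split=> //=; have /andP[? ?] := cod_range cod x; lra.
Qed.

Lemma measure_above t : m (U `&` [set x | t < c x]) = m U - cum t.
Proof.
rewrite -mD//.
congr (m _); apply/seteqP; split=> x /=.
  by move=> [Ux tx]; split=> // -[_]; rewrite leNgt tx.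
by move=> [Ux h]; split=> //; rewrite ltNge; apply/negP => ?; apply: h.
Qed.

(* [u = 0] is allowed in order that the set be never empty. *)
Definition quant (a : R) : R := sup [set u | u = 0 \/ 0 <= u <= 1 /\ cum u < a].

Let has_supQ a : has_sup [set u | u = 0 \/ 0 <= u <= 1 /\ cum u < a].
Proof. by split; [exists 0; left|exists 1 => u /= [->//|[/andP[]]]]. Qed.

Lemma quant_ge0 a : 0 <= quant a.
Proof. by apply: (sup_upper_bound (has_supQ a)); left. Qed.

Lemma quant_nondecreasing a b : a <= b -> quant a <= quant b.
Proof.
move=> ab; apply: ge_sup; first exact: (has_supQ a).1.
move=> u /= ua; apply: (sup_upper_bound (has_supQ b)) => /=.
by case: ua => [->|[? ua]]; [left|right; split=> //; exact: lt_le_trans ab].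
Qed.

(** The correspondence between quantiles and distribution function. From right to left, continuity
    keeps [cum] below [a] slightly to the right of [u]. *)
Lemma quant_gt a u : 0 <= u -> a <= m U -> u < quant a <-> cum u < a.
Proof.
move=> u0 aU; split.
  move=> /(sup_gt (has_supQ a).1)[v /= [->|[_ va]] uv]; first by lra.
  by apply: le_lt_trans va; exact/cum_nondecreasing/ltW.
move=> ua; have u1 : u < 1.
  by rewrite ltNge; apply/negP => /cum_ge1 e; move: ua; rewrite e; lra.
pose e := Num.min (1 - u) ((a - cum u) / 2).
have e0 : 0 < e by rewrite lt_min; apply/andP; split; lra.
have e1 : e <= 1 - u by rewrite ge_min lexx.
have e2 : e <= (a - cum u) / 2 by rewrite ge_min lexx orbT.
have ue : u <= u + e by lra.
have lip := cum_lipschitz ue.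
apply: (@lt_le_trans _ _ (u + e)); first by lra.
apply: (sup_upper_bound (has_supQ a)) => /=; right; split; last by lra.
by apply/andP; split; lra.
Qed.

Lemma cum_quant a : 0 < a -> a <= m U -> cum (quant a) = a.
Proof.
move=> a0 aU; apply/eqP; rewrite eq_le; apply/andP; split; last first.
  rewrite leNgt; apply/negP => /(quant_gt (quant_ge0 a) aU).2.
  by rewrite ltxx.
apply/ler_addgt0Pr => e e0; have qe : quant a - (e : R) <= quant a by rewrite lerBlDr lerDl ltW.
have lip := cum_lipschitz qe.
have : cum (quant a - e) <= a; last by lra.
have [?|?] := leP (quant a - e) 0; first by rewrite cum_le0//; lra.
apply/ltW/(@quant_gt a (quant a - e)) => //; lra.
Qed.

Lemma measurable_cum : measurable_fun setT cum.
Proof. by apply: nondecreasing_measurable => // s t; exact: cum_nondecreasing. Qed.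

Lemma measurable_quant : measurable_fun setT quant.
Proof. by apply: nondecreasing_measurable => // s t; exact: quant_nondecreasing. Qed.

Let mcum a : measurable (U `&` [set x | a < cum (c x)]).
Proof.
apply: measurableI => //; apply: measurable_lt_set; first exact: measurable_cst.
by apply: measurableT_comp => //; exact: measurable_cum.
Qed.

(** The probability integral transform: on [U], the function [cum \o c] is uniformly distributed
    over the interval from [0] to [m U]. *)
Lemma measure_cum_gt a : 0 <= a -> a <= m U ->
  m (U `&` [set x | a < cum (c x)]) = m U - a.
Proof.
move=> a0 aU; apply/eqP; rewrite eq_le; apply/andP; split.
  have [az|an0] := eqVneq a 0; first by rewrite az subr0; apply: m_le => // x [].
  have {}a0 : 0 < a by rewrite lt_neqAle eq_sym an0.
  rewrite -[in leRHS](cum_quant a0 aU) -measure_above; apply: m_le => // x [Ux /= ax].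
  split=> //=; rewrite ltNge; apply/negP => /cum_nondecreasing.
  by rewrite cum_quant//; lra.
have [->|naU] := eqVneq a (m U); first by rewrite subrr m_ge0.
have {}aU : a < m U by rewrite lt_neqAle naU.
apply/ler_addgt0Pr => e e0; pose b := Num.min (m U) (a + e).
have bU : b <= m U by rewrite ge_min lexx.
have ab : a < b by rewrite lt_min aU/=; lra.
have be : b <= a + e by rewrite ge_min lexx orbT.
have b0 : 0 < b by lra.
have : m U - b <= m (U `&` [set x | a < cum (c x)]); last by lra.
rewrite -[in leLHS](cum_quant b0 bU) -measure_above; apply: m_le => // x [Ux /= ax].
by split=> //=; apply: (lt_le_trans ab); rewrite -(cum_quant b0 bU); exact/cum_nondecreasing/ltW.
Qed.

End cumulative.

(** As [cum \o c] is uniformly distributed on [U], the pieces are its preimages of consecutive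
    intervals of lengths [a i]. *)
Lemma coding_splittable : splittable mu.
Proof.
move=> U a mU a0 aU.
pose S n := \sum_(i < n) a i.
have S0 n : 0 <= S n by apply: sumr_ge0 => i _.
have SU n : S n <= m U by rewrite -lee_fin -mE; [exact: aU|exact: mU].
have SS n : S n.+1 = S n + a n by rewrite /S big_ord_recr.
have Smono i j : (i <= j)%N -> S i <= S j.
  by move=> /subnK <-; elim: (j - i)%N => [//|k IH]; rewrite addSn SS (le_trans IH)// lerDl.
pose G t := U `&` [set x | t < cum U (c x)].
have mG t : measurable (G t).
  apply: measurableI => //; apply: measurable_lt_set; first exact: measurable_cst.
  by apply: measurableT_comp => //; exact: measurable_cum.
exists (fun i => G (S i) `\` G (S i.+1)); split.
- by move=> i; exact: measurableD.
- have sep i j x : (i < j)%N -> (G (S i) `\` G (S i.+1)) x -> (G (S j) `\` G (S j.+1)) x -> False.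
    move=> ij [[Ux /= _] h] [[_ /= jx] _]; apply: h; split=> //=.
    exact: le_lt_trans (Smono _ _ ij) jx.
  apply/trivIsetP => i j _ _ ij; apply/seteqP; split=> // x [xi xj].
  by move: ij; rewrite neq_ltn => /orP[] h; [exact: (sep i j x h)|exact: (sep j i x h)].
- by move=> i x [[]].
move=> i; rewrite mE; last exact: measurableD.
rewrite mD//; last by move=> x [Ux /= sx]; split=> //=; apply: le_lt_trans sx; rewrite SS lerDl.
by rewrite !measure_cum_gt// SS; congr EFin; lra.
Qed.

End Codings.

Section Transport.
Context {R : realType} {d : measure_display} {X : measurableType d}.
Variable mu : probability X R.
Variables (c : X -> R) (psi : R -> X) (X0 : set X) (Y0 : set R).
Hypothesis cod : coding mu c psi X0 Y0.
Local Notation m A := (fine (mu A)).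
Local Notation cum := (cum mu c).
Local Notation quant := (quant mu c).

Let mc : measurable_fun setT c := cod_fun cod.

Let mcf (f : R -> R) (B : set R) : measurable_fun setT f -> measurable B ->
  measurable [set x | B (f (c x))].
Proof.
move=> mf mB; rewrite -[X in measurable X]setTI.
by have := measurableT_comp mf mc; apply.
Qed.

(** The increasing rearrangement: quantile function of [D] after distribution function of [C]. *)
Definition rearrange (C D : set X) (t : R) : R := quant D (cum C t).

Lemma measurable_rearrange C D : measurable C -> measurable D ->
  measurable_fun setT (rearrange C D).
Proof.
move=> mC mD; apply: measurableT_comp; first exact: measurable_quant.
exact: (measurable_cum cod mC).
Qed.

Lemma rearrange_law C D B : measurable C -> measurable D -> mu C = mu D -> measurable B ->
  mu (C `&` [set x | B (rearrange C D (c x))]) = mu (D `&` c @^-1` B).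
Proof.
move=> mC mD CD mB.
have mrr := measurable_rearrange mC mD.
have CDm : m C = m D by rewrite CD.
have mgt (f : X -> R) t : measurable_fun setT f -> measurable [set x : X | t < f x].
  by move=> mf; apply: measurable_lt_set => //; exact: measurable_cst.
have mrc : measurable_fun setT (rearrange C D \o c) by exact: measurableT_comp.
have mcc : measurable_fun setT (cum C \o c).
  by apply: measurableT_comp => //; exact: (measurable_cum cod mC).
have := @ray_law R d X (mrestr mu mC) (mrestr mu mD) (rearrange C D \o c) c mrc mc.
move=> /(_ _ _ B mB)/=; rewrite /mrestr ![_ `&` C]setIC ![_ `&` D]setIC; apply.
  by rewrite setIT -ge0_fin_numE// fin_mu.
move=> t; rewrite ![_ `&` C]setIC ![_ `&` D]setIC.
have [t0|t0] := ltP t 0.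
  rewrite (_ : C `&` _ = C); last first.
    apply/seteqP; split=> [x []//|x Cx]; split=> //=; apply: lt_le_trans t0 _.
    exact: quant_ge0.
  rewrite (_ : D `&` _ = D)//; apply/seteqP; split=> [x []//|x Dx]; split=> //=.
  by have /andP[? _] := cod_range cod x; exact: lt_le_trans t0 _.
have m1 : measurable (C `&` [set x | t < rearrange C D (c x)]).
  by apply: measurableI => //; exact: mgt.
have m2 : measurable (D `&` [set x | t < c x]) by apply: measurableI => //; exact: mgt.
transitivity (m (C `&` [set x | t < rearrange C D (c x)]))%:E; first exact: (mE mu m1).
rewrite (mE mu m2); congr EFin; rewrite (measure_above cod mD) -CDm.
have le1 : cum D t <= m C by rewrite CDm; exact: (cum_le cod mD).
rewrite -(measure_cum_gt cod mC _ le1); last exact: cum_ge0.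
congr (m _); apply/seteqP; split=> x [Cx /= h]; split=> //=; move: h;
  rewrite /rearrange (quant_gt cod mD t0)// -CDm; exact: (cum_le cod mC).
Qed.

(** The last condition excludes the points at which [cum C] is constant on an interval ending at
    [c x]; elsewhere [quant] recovers [c x] from its level, which makes the rearrangement exactly
    invertible. *)
Definition strict_part (C : set X) := C `&` X0 `&`
  [set x | 0 < cum C (c x)] `&` [set x | rearrange C C (c x) = c x].

Lemma measurable_strict_part C : measurable C -> measurable (strict_part C).
Proof.
move=> mC; have mrr := measurable_rearrange mC mC.
have mcc : measurable_fun setT (cum C \o c).
  by apply: measurableT_comp => //; exact: (measurable_cum cod mC).
have mrc : measurable_fun setT (rearrange C C \o c) by exact: measurableT_comp.
apply: measurableI.
  apply: measurableI; first by apply: measurableI => //; exact: cod_X0 cod.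
  by apply: measurable_lt_set => //; exact: measurable_cst.
rewrite (_ : mkset _ = [set x | rearrange C C (c x) <= c x] `&`
  [set x | c x <= rearrange C C (c x)]).
  by apply: measurableI; [exact: (measurable_le_set mrc mc)|exact: (measurable_le_set mc mrc)].
apply/seteqP; split=> x /=; first by move=> ->.
by move=> [? ?]; apply/eqP; rewrite eq_le; apply/andP.
Qed.

Let negl0 A : measurable A -> mu A = 0%E -> mu.-negligible A.
Proof. by move=> mA A0; exists A; split. Qed.

Lemma rearrange_le C x : measurable C -> rearrange C C (c x) <= c x.
Proof.
move=> mC; rewrite leNgt; apply/negP => h.
have /andP[c0 _] := cod_range cod x.
by move: h; rewrite /rearrange (quant_gt cod mC c0) ?ltxx//; exact: (cum_le cod mC).
Qed.

(** [rearrange C C] is at most the identity and preserves the law of [c] on [C]. So for every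
    rational [q] the set where [q] separates the two values is null, and these sets cover the places
    where they differ. *)
Lemma strict_part_negligible C : measurable C -> mu.-negligible (C `\` strict_part C).
Proof.
move=> mC; have mrr := measurable_rearrange mC mC.
have mcc : measurable_fun setT (cum C \o c).
  by apply: measurableT_comp => //; exact: (measurable_cum cod mC).
have mrc : measurable_fun setT (rearrange C C \o c) by exact: measurableT_comp.
pose q n : R := ratr (if @unpickle rat n is Some r then r else 0).
pose Q n := C `&` [set x | q n < c x] `\` [set x | q n < rearrange C C (c x)].
have mQ1 n : measurable (C `&` [set x | q n < c x]).
  by apply: measurableI => //; apply: measurable_lt_set => //; exact: measurable_cst.
have mQ2 n : measurable (C `&` [set x | q n < rearrange C C (c x)]).
  by apply: measurableI => //; apply: measurable_lt_set => //; exact: measurable_cst.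
have Q0 n : mu.-negligible (Q n).
  have -> : Q n = (C `&` [set x | q n < c x]) `\` (C `&` [set x | q n < rearrange C C (c x)]).
    apply/seteqP; split=> x [[Cx qx] h]; split=> // h'; apply: h; last by [].
    by case: h'.
  apply: negl0; first exact: measurableD.
  rewrite (mE mu); last exact: measurableD.
  rewrite mD//; last first.
    by move=> x [Cx /= qx]; split=> //=; apply: lt_le_trans qx (rearrange_le x mC).
  have ray (f : X -> R) : [set x | q n < f x] = [set x | `]q n, +oo[%classic (f x)].
    by apply/seteqP; split=> x /=; rewrite in_itv/= andbT.
  have e : mu (C `&` [set x | q n < rearrange C C (c x)]) = mu (C `&` [set x | q n < c x]).
    by rewrite (ray (rearrange C C \o c)) (ray c); exact: rearrange_law.
  by rewrite e subrr.
pose P := C `\` [set x | 0 < cum C (c x)].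
have P0 : mu.-negligible P.
  have mcum0 : measurable (C `&` [set x | 0 < cum C (c x)]).
    by apply: measurableI => //; apply: measurable_lt_set => //; exact: measurable_cst.
  have -> : P = C `\` (C `&` [set x | 0 < cum C (c x)]).
    by apply/seteqP; split=> x [Cx h]; split=> //; [move=> []|move=> h'; apply: h].
  apply: negl0; first exact: measurableD.
  rewrite (mE mu); last exact: measurableD.
  rewrite mD//.
  by rewrite (measure_cum_gt cod mC) ?m_ge0// subr0 subrr.
have X0c : mu.-negligible (~` X0).
  by apply: negl0 (cod_null cod); apply: measurableC; exact: cod_X0 cod.
apply: negligibleS (negligibleU X0c (negligibleU P0 (negligible_bigcup Q0))).
move=> x [Cx nS].
have [Xx|Xx] := pselect (X0 x); last by left.
have [px|px] := pselect (0 < cum C (c x)); last by right; left; split.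
right; right.
have : rearrange C C (c x) < c x.
  rewrite lt_neqAle rearrange_le// andbT; apply/eqP => e; apply: nS.
  by split; [split; [split|]|].
move=> /rat_in_itvoo[r]; rewrite in_itv/= => /andP[r1 r2].
exists (pickle r) => //; rewrite /Q /q pickleK; split; first by split.
by move=> /= h; have := lt_trans h r1; rewrite ltxx.
Qed.

Section swapping.
Variables C D : set X.
Hypotheses (mC : measurable C) (mD_ : measurable D) (CD : mu C = mu D).

(** On [landing] the rearranged coordinate belongs to [Y0], so that [psi] has a meaning there;
    [departure] requires moreover that the point reached lie in [D]. Both conditions fail only on
    null subsets of [C]. *)
Definition landing := strict_part C `&` [set x | Y0 (rearrange C D (c x))].
Definition carry x := psi (rearrange C D (c x)).
Definition departure := landing `&` carry @^-1` D.

Lemma measurable_landing : measurable landing.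
Proof.
apply: measurableI; first exact: measurable_strict_part.
by apply: mcf; [exact: measurable_rearrange|exact: cod_Y0 cod].
Qed.

Lemma landing_negligible : mu.-negligible (C `\` landing).
Proof.
have h : mu.-negligible (C `&` [set x | (~` Y0) (rearrange C D (c x))]).
  have mY : measurable (~` Y0) by apply: measurableC; exact: cod_Y0 cod.
  apply: negl0.
    by apply: measurableI => //; apply: mcf => //; exact: measurable_rearrange.
  rewrite rearrange_law//; apply/eqP; rewrite eq_le measure_ge0 andbT.
  rewrite -[X in (_ <= X)%E](cod_null cod); apply: le_measure; rewrite ?inE.
  - by apply: measurableI => //; rewrite -[X in measurable X]setTI; exact: mc.
  - by apply: measurableC; exact: cod_X0 cod.
  - by move=> x [_ /= Yx] /(cod_in cod).
apply: negligibleS (negligibleU (strict_part_negligible mC) h).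
move=> x [Cx nl]; have [sx|sx] := pselect (strict_part C x); last by left.
by right; split=> // Yx; apply: nl.
Qed.

Lemma measurable_carry A : measurable A -> measurable (landing `&` carry @^-1` A).
Proof.
move=> mA; apply: (cod_lift cod measurable_landing) => //.
- by move=> x [[[[]]]].
- exact: measurable_rearrange.
- move=> N mN N0; apply/eqP; rewrite eq_le measure_ge0 andbT.
  have <- : mu (C `&` [set x | N (rearrange C D (c x))]) = 0%E.
    rewrite rearrange_law//; apply/eqP; rewrite eq_le measure_ge0 andbT -N0.
    have mcN : measurable (c @^-1` N) by rewrite -[X in measurable X]setTI; exact: mc.
    by apply: le_measure; rewrite ?inE//; exact: measurableI.
  have mr : measurable [set x | N (rearrange C D (c x))].
    by apply: mcf => //; exact: measurable_rearrange.
  apply: le_measure; rewrite ?inE; [|exact: measurableI|].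
    by apply: measurableI => //; exact: measurable_landing.
  by move=> x [[[[[]]]]].
- by move=> x [].
Qed.

Lemma measure_carry A : measurable A -> mu (landing `&` carry @^-1` A) = mu (D `&` A).
Proof.
move=> mA; have [B [N [mB mN N0 AB]]] := cod_approx cod mA.
have mrr := measurable_rearrange mC mD_.
have mcB : measurable (c @^-1` B) by rewrite -[X in measurable X]setTI; exact: mc.
have mcN : measurable (c @^-1` N) by rewrite -[X in measurable X]setTI; exact: mc.
have mtB : measurable [set x | B (rearrange C D (c x))] by exact: mcf.
have mtN : measurable [set x | N (rearrange C D (c x))] by exact: mcf.
have X0c : mu.-negligible (~` X0).
  by apply: negl0 (cod_null cod); apply: measurableC; exact: cod_X0 cod.
have nN : mu.-negligible (C `&` [set x | N (rearrange C D (c x))]).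
  apply: negl0; first exact: measurableI.
  rewrite rearrange_law//; apply/eqP; rewrite eq_le measure_ge0 andbT -N0.
  by apply: le_measure; rewrite ?inE//; exact: measurableI.
transitivity (mu (C `&` [set x | B (rearrange C D (c x))])).
  apply: measure_eq_mod (negligibleU landing_negligible nN) _.
  - exact: measurable_carry.
  - exact: measurableI.
  move=> x nx; split.
    move=> [lx Ax]; have Cx : C x by case: lx => [[[[]]]].
    split=> //=; apply/AB => //; first by case: lx.
    by move=> Nx; apply: nx; right.
  move=> [Cx /= Bx]; have lx : landing x.
    by apply: contrapT => nl; apply: nx; left.
  split=> //=; apply/AB => //; first by case: lx.
  by move=> Nx; apply: nx; right.
rewrite rearrange_law//; apply: measure_eq_mod (negligibleU X0c (negl0 mcN N0)) _.
- exact: measurableI.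
- exact: measurableI.
move=> x nx; have Xx : X0 x by apply: contrapT => Xx; apply: nx; left.
have [|h1 h2] := AB (c x) (cod_in cod Xx).
  by move=> Nx; apply: nx; right.
by rewrite (cod_K cod Xx) in h1 h2; split=> -[Dx h]; split=> //; [exact: h2|exact: h1].
Qed.

Lemma departure_negligible : mu (C `\` departure) = 0%E.
Proof.
have md : measurable departure by exact: measurable_carry.
rewrite (mE mu); last exact: measurableD.
rewrite mD//; last by move=> x [[[[[]]]]].
by rewrite /departure measure_carry// setIid CD subrr.
Qed.

End swapping.

(** [cum D] undoes [quant D], so the level of the point is kept by [carry], and by the definition of
    [strict_part] the quantile function of [C] brings it back to [c x]. *)
Lemma carryK C D x : measurable C -> measurable D -> mu C = mu D -> departure C D x ->
  departure D C (carry C D x) /\ carry D C (carry C D x) = x.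
Proof.
move=> mC mD CD [[[[[Cx Xx] /= px] ex] Yx] /= Dx].
have CDm : m C = m D by rewrite CD.
have cE : c (carry C D x) = rearrange C D (c x) by rewrite /carry (cod_K' cod).
have qE : cum D (rearrange C D (c x)) = cum C (c x).
  by rewrite /rearrange (cum_quant cod mD)// -CDm; exact: (cum_le cod mC).
have bE : rearrange D C (rearrange C D (c x)) = c x by rewrite /rearrange qE -[RHS]ex.
have KE : carry D C (carry C D x) = x by rewrite {1}/carry cE bE (cod_K cod).
split=> //; split; last by rewrite /= KE.
split; last by rewrite /= cE bE; exact: (cod_in cod).
split; last by rewrite /= cE [in LHS]/rearrange qE.
split; last by rewrite /= cE qE.
by split=> //; exact: (cod_out cod).
Qed.

(** The involution is [carry C D] on the departure set in [C], [carry D C] on the one in [D], and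
    the identity elsewhere. *)
Lemma coding_swappable : swappable mu.
Proof.
move=> C D mC mD CD0 CD.
pose C0 := departure C D; pose D0 := departure D C.
have mC0 : measurable C0 by exact: measurable_carry.
have mD0 : measurable D0 by exact: measurable_carry.
have C0C : C0 `<=` C by move=> x [[[[[]]]]].
have D0D : D0 `<=` D by move=> x [[[[[]]]]].
have CD_ x : C0 x -> D0 x -> False.
  by move=> /C0C Cx /D0D Dx; have : (C `&` D) x by []; rewrite CD0.
pose s x := if pselect (C0 x) then carry C D x else if pselect (D0 x) then carry D C x else x.
have sC x : C0 x -> s x = carry C D x by rewrite /s; case: pselect.
have sD x : D0 x -> s x = carry D C x.
  by move=> Dx; rewrite /s; case: (pselect (C0 x)) => [/CD_/(_ Dx)//|nC]; case: (pselect (D0 x)).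
have sO x : ~ C0 x -> ~ D0 x -> s x = x.
  by move=> ? ?; rewrite /s; case: (pselect (C0 x)) => // nC; case: (pselect (D0 x)).
have funC x : C0 x -> D0 (s x) /\ s (s x) = x.
  by move=> Cx; rewrite (sC x Cx); have [Dx e] := carryK mC mD CD Cx; rewrite sD.
have funD x : D0 x -> C0 (s x) /\ s (s x) = x.
  by move=> Dx; rewrite (sD x Dx); have [Cx e] := carryK mD mC (esym CD) Dx; rewrite sC.
have sK : cancel s s.
  move=> x; have [Cx|Cx] := pselect (C0 x); first by case: (funC x Cx).
  have [Dx|Dx] := pselect (D0 x); first by case: (funD x Dx).
  by rewrite !(sO x).
pose O := ~` (C0 `|` D0).
have mO : measurable O by apply: measurableC; exact: measurableU.
have split_ A : measurable A ->
    mu A = (mu (A `&` C0) + mu (A `&` D0) + mu (A `&` O))%E.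
  move=> mA; rewrite -measureU; [|exact: measurableI|exact: measurableI|]; last first.
    by apply/seteqP; split=> // x [[_ ?] [_ ?]]; exact: (CD_ x).
  rewrite -setIUr -measureU; last first.
  - by apply/seteqP; split=> // x [[_ ?] [_ ?]].
  - exact: measurableI.
  - by apply: measurableI => //; exact: measurableU.
  by rewrite -setIUr setUv setIT.
have preC A : s @^-1` A `&` C0 = landing C D `&` carry C D @^-1` (A `&` D).
  apply/seteqP; split=> x.
    by move=> [/= Ax Cx]; rewrite (sC x Cx) in Ax; case: Cx => lx Dx; split.
  move=> [lx [Ax Dx]]; have Cx : C0 x by [].
  by split=> //=; rewrite sC.
have preD A : s @^-1` A `&` D0 = landing D C `&` carry D C @^-1` (A `&` C).
  apply/seteqP; split=> x.
    by move=> [/= Ax Cx]; rewrite (sD x Cx) in Ax; case: Cx => lx Dx; split.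
  move=> [lx [Ax Dx]]; have Cx : D0 x by [].
  by split=> //=; rewrite sD.
have preO A : s @^-1` A `&` O = A `&` O.
  by apply/seteqP; split=> x [/= Ax Ox]; split=> //=; move: Ax; rewrite sO// => ?; apply: Ox; [left|right|left|right].
have ms A : measurable A -> measurable (s @^-1` A).
  move=> mA; have -> : s @^-1` A = (s @^-1` A `&` C0) `|` (s @^-1` A `&` D0) `|` (s @^-1` A `&` O).
    by rewrite -!setIUr setUv setIT.
  rewrite preC preD preO; apply: measurableU; last exact: measurableI.
  by apply: measurableU; apply: measurable_carry => //; exact: measurableI.
have null_diff A E E0 : measurable A -> measurable E -> measurable E0 -> E0 `<=` E ->
    mu (E `\` E0) = 0%E -> mu (E `&` (A `&` E)) = mu (A `&` E0).
  move=> mA mE mE0 E0E z; apply: measure_eq_mod (negl0 (measurableD mE mE0) z) _.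
  - by apply: measurableI => //; exact: measurableI.
  - exact: measurableI.
  move=> x nx; split=> [[Ex [Ax _]]|[Ax Ex]].
    by split=> //; apply: contrapT => nE; apply: nx.
  by split; [exact: E0E|split=> //; exact: E0E].
exists s, C0, D0; split=> //.
- split=> //.
  + by move=> _ A mA; rewrite setTI; exact: ms.
  + by move=> _ A mA; rewrite setTI; exact: ms.
  + move=> A mA; rewrite (split_ _ (ms A mA)) (split_ _ mA) preC preD preO.
    rewrite measure_carry//; last exact: measurableI.
    rewrite measure_carry//; last exact: measurableI.
    rewrite (null_diff A D D0)//; last exact: departure_negligible (esym CD).
    rewrite (null_diff A C C0)//; last exact: departure_negligible CD.
    by congr (_ + _)%E; rewrite addeC.
- exact: departure_negligible CD.
- exact: departure_negligible (esym CD).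
- by move=> x /funC[].
- by move=> x /funD[].
Qed.

(** The sets are the rays [c <= q] with [q] rational. Independence of [C] from them extends to all
    rays by continuity of [cum], then to all Borel sets of values of [c], and so to [C] itself up to
    null sets: [m C] equals its own square. *)
Lemma coding_separating : exists A, separating mu A.
Proof.
pose q n : R := ratr (if @unpickle rat n is Some r then r else 0).
have mle t : measurable [set x | c x <= t].
  by apply: measurable_le_set => //; exact: measurable_cst.
exists (fun n => [set x | c x <= q n]); split; first by move=> i; exact: mle.
move=> C mC CA.
have mT := @measurableT _ X.
have cumE t : cum C t = m C * cum setT t.
  apply/eqP; rewrite -subr_eq0 -normr_le0; apply/ler_addgt0Pr => e e0; rewrite add0r.
  have e20 : 0 < (e : R) / 2 by rewrite divr_gt0.
  have /rat_in_itvoo[r] : t < t + (e : R) / 2 by rewrite ltrDl.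
  rewrite in_itv/= => /andP[tr re].
  have qE : cum C (ratr r) = m C * cum setT (ratr r).
    have := CA (pickle r); rewrite /q pickleK /cum setTI.
    by rewrite (mE mu mC) (mE mu (mle _)) (mE mu (measurableI _ _ mC (mle _))) -EFinM => -[].
  have l1 := cum_lipschitz cod mC (ltW tr).
  have l2 := cum_lipschitz cod mT (ltW tr).
  have n1 := cum_nondecreasing cod mC (ltW tr).
  have n2 := cum_nondecreasing cod mT (ltW tr).
  have c0 : 0 <= m C by exact: m_ge0.
  have c1 : m C <= 1 by exact: m_le1.
  have b1 : 0 <= m C * (cum setT (ratr r) - cum setT t) by rewrite mulr_ge0// subr_ge0.
  have b2 : m C * (cum setT (ratr r) - cum setT t) <= cum setT (ratr r) - cum setT t.
    by rewrite ler_piMl// subr_ge0.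
  rewrite mulrBr -qE in b1 b2.
  by rewrite ler_norml; apply/andP; split; lra.
have mlt t : measurable [set x | t < c x].
  by apply: measurable_lt_set => //; exact: measurable_cst.
have law B : measurable B -> mu (C `&` c @^-1` B) = ((m C)%:E * mu (c @^-1` B))%E.
  move=> mB; have c0 : 0 <= m C by exact: m_ge0.
  have := @ray_law R d X (mrestr mu mC) (mscale (NngNum c0) mu) c c mc mc.
  move=> /(_ _ _ B mB)/=; rewrite /mrestr /mscale ![_ `&` C]setIC; apply.
    by rewrite setIT -ge0_fin_numE// fin_mu.
  move=> t; rewrite [_ `&` C]setIC.
  suff : mu (C `&` [set x | t < c x]) = ((m C)%:E * mu [set x | (t < c x)%R])%E by [].
  rewrite (mE mu (mlt t)) (mE mu (measurableI _ _ mC (mlt t))) -EFinM.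
  rewrite (measure_above cod mC) -[[set x | t < c x]]setTI (measure_above cod mT) cumE.
  by congr EFin; rewrite probability_setT /= mulrBr mulr1.
have [B [N [mB mN N0 AB]]] := cod_approx cod mC.
have mcB : measurable (c @^-1` B) by rewrite -[X in measurable X]setTI; exact: mc.
have mcN : measurable (c @^-1` N) by rewrite -[X in measurable X]setTI; exact: mc.
have X0c : mu.-negligible (~` X0).
  by apply: negl0 (cod_null cod); apply: measurableC; exact: cod_X0 cod.
have CB x : ~ (~` X0 `|` c @^-1` N) x -> C x <-> B (c x).
  move=> nx; have Xx : X0 x by apply: contrapT => Xx; apply: nx; left.
  have := AB (c x) (cod_in cod Xx); rewrite (cod_K cod Xx); apply.
  by move=> Nx; apply: nx; right.
have e1 : mu C = mu (c @^-1` B).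
  by apply: measure_eq_mod (negligibleU X0c (negl0 mcN N0)) CB.
have e2 : mu (C `&` c @^-1` B) = mu C.
  apply: measure_eq_mod (negligibleU X0c (negl0 mcN N0)) _ => //.
    exact: measurableI.
  by move=> x /CB h; split=> [[]//|Cx]; split=> //; apply/h.
have := law B mB; rewrite e2 -e1 (mE mu mC) -EFinM => -[] e.
have /eqP : m C * (1 - m C) = 0 by rewrite mulrBr mulr1 -e subrr.
rewrite mulf_eq0 subr_eq0 => /orP[/eqP->|/eqP<-]; by [left|right].
Qed.

End Transport.

Section StandardSpaces.
Context {R : realType} {d : measure_display} {X : measurableType d}.
Variable mu : probability X R.

Lemma coding_intro (phi : X -> R) (psi : R -> X) (X0 : set X) (Y0 : set R) :
  measurable X0 -> mu (~` X0) = 0%E -> measurable Y0 -> (forall y, Y0 y -> 0 <= y <= 1) ->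
  (forall B, measurable B -> measurable (X0 `&` phi @^-1` B)) ->
  (forall x, X0 x -> Y0 (phi x)) -> (forall y, Y0 y -> X0 (psi y)) ->
  (forall x, X0 x -> psi (phi x) = x) -> (forall y, Y0 y -> phi (psi y) = y) ->
  (forall s t, s <= t -> (mu (X0 `&` [set x | (s < phi x <= t)%R]) <= (t - s)%:E)%E) ->
  (forall A, measurable A -> exists2 B, measurable B &
      forall y, Y0 y -> A (psi y) <-> B y) \/
    (forall A, measurable A -> exists B N, [/\ measurable B, measurable N,
      mu (X0 `&` phi @^-1` N) = 0%E & forall y, Y0 y -> ~ N y -> A (psi y) <-> B y]) /\
    (forall M Z, measurable M -> mu M = 0%E -> M `<=` X0 -> Z `<=` M -> measurable Z) ->
  exists c, coding mu c psi X0 Y0.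
Proof.
move=> mX0 X00 mY0 Y01 mphi XY YX K K' law sets.
pose c x := if pselect (X0 x) then phi x else 0.
have cE x : X0 x -> c x = phi x by rewrite /c; case: pselect.
have cN x : ~ X0 x -> c x = 0 by rewrite /c; case: pselect.
have mnX0 : measurable (~` X0) by exact: measurableC.
have mc : measurable_fun setT c.
  move=> _ B mB; rewrite setTI.
  have -> : c @^-1` B = (X0 `&` phi @^-1` B) `|` (~` X0 `&` [set _ | B 0]).
    apply/seteqP; split=> x /=.
      by have [Xx|Xx] := pselect (X0 x); [rewrite cE//; left|rewrite cN//; right].
    by move=> [[Xx Bx]|[Xx Bx]]; [rewrite cE|rewrite cN].
  apply: measurableU; first exact: mphi.
  have [B0|B0] := pselect (B 0).
    by rewrite (_ : [set _ | _] = setT) ?setIT//; apply/seteqP; split.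
  by rewrite (_ : [set _ | _] = set0) ?setI0//; apply/seteqP; split.
have null A : measurable A -> measurable (X0 `&` A) -> (mu A <= mu (X0 `&` A))%E.
  move=> mA mXA; have -> : mu (X0 `&` A) = (mu (~` X0) + mu (X0 `&` A))%E by rewrite X00 add0e.
  apply: le_trans (measureU2 _ mnX0 mXA); apply: le_measure; rewrite ?inE//.
    exact: measurableU.
  by move=> x Ax; have [Xx|Xx] := pselect (X0 x); [right|left].
exists c; split=> //.
- move=> x; have [Xx|Xx] := pselect (X0 x); last by rewrite cN// lexx ler01.
  by rewrite cE//; apply: Y01; exact: XY.
- by move=> x Xx; rewrite cE//; exact: XY.
- by move=> x Xx; rewrite cE// K.
- by move=> y Yy; rewrite cE ?K'//; exact: YX.
- move=> s t st; have e : X0 `&` [set x | s < c x <= t] = X0 `&` [set x | s < phi x <= t].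
    by apply/seteqP; split=> x [Xx] /=; rewrite cE.
  have mst : measurable [set x | s < c x <= t].
    have := mc measurableT _ (measurable_itv `]s, t]); rewrite setTI.
    by rewrite (_ : _ @^-1` _ = [set x | s < c x <= t]).
  by apply: le_trans (law s t st); rewrite -e; apply: null => //; exact: measurableI.
case: sets => [h|[h1 h2]]; [by left|right; split=> // A /h1[B [N [mB mN N0 AB]]]].
exists B, N; split=> //; apply/eqP; rewrite eq_le measure_ge0 andbT -N0.
have e : X0 `&` phi @^-1` N = X0 `&` c @^-1` N.
  by apply/seteqP; split=> x [Xx] /=; rewrite cE.
have mcN : measurable (c @^-1` N) by rewrite -[X in measurable X]setTI; exact: mc.
by rewrite e; apply: null => //; exact: measurableI.
Qed.

Lemma borel_coding : isomorphic_mod0 mu setT (@lebesgue_measure R) (`[0, 1] : set R) ->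
  exists c psi X0 Y0, coding mu c psi X0 Y0.
Proof.
move=> [N1 [N2 [phi [psi [[mN1 _ N10] [mN2 _ N20] [fphi fpsi K K'] [mphi mpsi] law]]]]].
rewrite setTD in fphi fpsi K mphi law.
have mX0 : measurable (~` N1) by exact: measurableC.
have mY0 : measurable (`[0, 1] `\` N2 : set (measurableTypeR R)) by exact: measurableD.
have [c cod] : exists c, coding mu c psi (~` N1) (`[0, 1] `\` N2); last by exists c, psi, (~` N1), (`[0, 1] `\` N2).
apply: (@coding_intro phi) => //.
- by rewrite setCK.
- by move=> y [] /=; rewrite in_itv.
- by move=> B mB; exact: mphi.
- move=> s t st; have -> : ~` N1 `&` [set x | s < phi x <= t] =
      ~` N1 `&` phi @^-1` (`]s, t] `&` (`[0, 1] `\` N2)).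
    apply/seteqP; split=> x [Nx]; last by move=> [/=]; rewrite in_itv.
    by move=> stx; split=> //; split; [rewrite /= in_itv|exact: fphi].
  have mst : measurable (`]s, t] `&` (`[0, 1] `\` N2) : set (measurableTypeR R)) by exact: measurableI.
  rewrite law//; apply: (@le_trans _ _ (@lebesgue_measure R `]s, t])).
    by apply: le_measure; rewrite ?inE.
  by rewrite lebesgue_measure_itv/= lte_fin; case: ifP => // _; rewrite lee_fin subr_ge0.
left=> A mA; exists ((`[0, 1] `\` N2) `&` psi @^-1` A); first exact: mpsi.
by move=> y Yy; split=> [Ay|[]].
Qed.

Lemma lebesgue_coding :
  isomorphic_mod0 mu setT (@completed_lebesgue_measure R) (`[0, 1] : set R) ->
  exists c psi X0 Y0, coding mu c psi X0 Y0.
Proof.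
pose L := caratheodory_type (@wlength R idfun)^*%mu.
pose lam := @lebesgue_measure R; pose clam := @completed_lebesgue_measure R.
have borel (B : set R) : measurable B -> measurable (B : set L) by exact: sub_caratheodory.
have approx (A : set L) : measurable A -> exists B N : set R,
    [/\ measurable B, measurable N, lam N = 0%E & forall y, ~ N y -> A y <-> B y].
  move=> mA; have : (completed_algebra_gen lam).-sigma.-measurable A.
    by rewrite completed_caratheodory_measurable.
  rewrite g_sigma_completed_algebra_genE => -[B mB [Z [N [mN N0 ZN]] <-]].
  exists B, N; split=> // y Ny; split=> [[//|/ZN//]|By]; by left.
have le_clam (A B : set L) : A `<=` B -> (clam A <= clam B)%E.
  by move=> AB; apply: (@le_outer_measure R _ (@wlength R idfun)^*%mu).
move=> [N1 [N2 [phi [psi [[mN1 _ N10] [mN2 _ N20] [fphi fpsi K K'] [mphi mpsi] law]]]]].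
rewrite setTD in fphi fpsi K mphi law.
have mX1 : measurable (~` N1) by exact: measurableC.
(* [N2] is Lebesgue measurable only; it is enlarged to a Borel null set so that [Y0] becomes Borel,
   and the points of [X] over the enlargement are discarded as well. *)
have [N [mN N0 N2N]] : exists N : set R, [/\ measurable N, lam N = 0%E & N2 `<=` N].
  have [B [N [mB mN N0 BN]]] := approx _ mN2; exists ((B `\` N) `|` N); split.
  - by apply: measurableU => //; exact: measurableD.
  - apply/eqP; rewrite eq_le measure_ge0 andbT.
    have mBN : measurable (B `\` N) by exact: measurableD.
    apply: (@le_trans _ _ (lam (B `\` N) + lam N)%E); first exact: measureU2.
    rewrite N0 adde0 -N20; apply: (le_clam (B `\` N) N2) => y [By Ny].
    by apply/(BN y).
  - move=> y N2y; have [Ny|Ny] := pselect (N y); first by right.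
    by left; split=> //; exact/(BN y).
pose D := `[0, 1] `\` N2 : set R.
have mD : measurable (D : set L).
  by apply: measurableD => //; apply: borel; exact: measurable_itv.
have pre0 (V : set R) : measurable V -> lam V = 0%E -> mu (~` N1 `&` phi @^-1` V) = 0%E.
  move=> mV V0; have -> : ~` N1 `&` phi @^-1` V = ~` N1 `&` phi @^-1` (V `&` D).
    by apply/seteqP; split=> x [Nx] => [Vx|[]//]; split=> //; split=> //; exact: fphi.
  rewrite law; [|by apply: measurableI => //; exact: borel|by move=> y []].
  apply/eqP; rewrite eq_le measure_ge0 andbT -V0.
  by apply: (le_clam (V `&` D) V) => y [].
have mpre (V : set R) : measurable V -> measurable (~` N1 `&` phi @^-1` V).
  by move=> mV; apply: mphi => //; exact: borel.
pose X0 := ~` N1 `&` phi @^-1` (~` N); pose Y0 := `[0, 1] `\` N : set R.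
have mX0 : measurable X0 by apply: mpre; exact: measurableC.
have mY0 : measurable Y0 by apply: measurableD => //; exact: measurable_itv.
have YD y : Y0 y -> D y by move=> [y1 Ny]; split=> // /N2N.
have [c cod] : exists c, coding mu c psi X0 Y0; last by exists c, psi, X0, Y0.
apply: (@coding_intro phi) => //.
- have -> : ~` X0 = N1 `|` (~` N1 `&` phi @^-1` N).
    apply/seteqP; split=> x.
      move=> nX; have [N1x|N1x] := pselect (N1 x); [by left|right; split=> //].
      by apply: contrapT => Nx; apply: nX.
    by move=> [N1x|[_ Nx]] [].
  apply/eqP; rewrite eq_le measure_ge0 andbT.
  apply: le_trans (measureU2 _ mN1 (mpre _ mN)) _.
  have -> : (0 = mu N1 + mu (~` N1 `&` phi @^-1` N))%E by rewrite N10 pre0// adde0.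
  exact: lexx.
- by move=> y [] /=; rewrite in_itv.
- move=> B mB; rewrite /X0 -setIA; have := mpre _ (measurableI _ _ (measurableC mN) mB).
  by rewrite preimage_setI.
- by move=> x [N1x Nx]; split=> //; have [] := fphi _ N1x.
- by move=> y Yy; split; [exact: fpsi _ (YD _ Yy)|rewrite /= K'; [case: Yy|exact: YD]].
- by move=> x [N1x _]; exact: K.
- by move=> y /YD; exact: K'.
- move=> s t st.
  pose I : set R := [set` `]s, t]].
  have mst : measurable I by exact: measurable_itv.
  apply: (@le_trans _ _ (mu (~` N1 `&` phi @^-1` (I `&` D)))).
    apply: le_measure; rewrite ?inE.
    - have := mpre _ (measurableI _ _ (measurableC mN) mst); rewrite preimage_setI setIA.
      by rewrite (_ : phi @^-1` I = [set x | s < phi x <= t]).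
    - by apply: mphi => //; apply: measurableI => //; exact: borel.
    - move=> x [[N1x _] stx]; split=> //; split; last exact: fphi.
      by rewrite /I /= in_itv.
  rewrite law; [|by apply: measurableI => //; exact: borel|by move=> y []].
  have h1 : (clam (I `&` D) <= lam I)%E by apply: (le_clam (I `&` D) I) => y [].
  apply: (le_trans h1).
  by rewrite /lam /I lebesgue_measure_itv/= lte_fin; case: ifP => // _; rewrite lee_fin subr_ge0.
right; split.
  move=> A mA; have [B [V [mB mV V0 BV]]] := approx _ (mpsi mD A mA).
  exists B, V; split=> //.
    apply/eqP; rewrite eq_le measure_ge0 andbT -(pre0 _ mV V0); apply: le_measure; rewrite ?inE.
    - rewrite /X0 -setIA; have := mpre _ (measurableI _ _ (measurableC mN) mV).
      by rewrite preimage_setI.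
    - exact: mpre.
    - by move=> x [[]].
  move=> y Yy Vy; have [h1 h2] := BV y Vy; split=> [Ay|By]; first by apply: h1; split=> //; exact: YD.
  by have [] := h2 By.
move=> M Z mM M0 MX ZM.
(* Completeness passes from the interval to [X]: the set corresponding to [Z] lies in a null set,
   hence is Lebesgue measurable, and [Z] is its preimage under [phi]. *)
pose V := D `&` psi @^-1` M; pose W := D `&` psi @^-1` Z.
have mV : measurable (V : set L) by exact: mpsi.
have V0 : clam V = 0%E.
  rewrite /clam -law//; last by move=> y [].
  apply/eqP; rewrite eq_le measure_ge0 andbT -M0; apply: le_measure; rewrite ?inE//.
    exact: mphi.
  by move=> x [N1x [_ /=]]; rewrite K.
have mW : measurable (W : set L).
  apply: negligible_sub_caratheodory; exists V; split=> //.
  by move=> y [Dy /ZM].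
have -> : Z = ~` N1 `&` phi @^-1` W.
  apply/seteqP; split=> x.
    move=> Zx; have [N1x _] := MX _ (ZM _ Zx); split=> //; split; first exact: fphi.
    by rewrite /= K.
  by move=> [N1x [_ /=]]; rewrite K.
exact: mphi.
Qed.

End StandardSpaces.

Lemma standard_coding (R : realType) (d : measure_display) (X : measurableType d)
    (mu : probability X R) : standard_probability_space mu ->
  exists c psi X0 Y0, coding mu c psi X0 Y0.
Proof. by case; [exact: borel_coding|exact: lebesgue_coding]. Qed.

(** * Unbounded functions *)

Section Thresholds.
Context {R : realType} {d : measure_display} {X : measurableType d}.
Variable mu : probability X R.
Local Notation m A := (fine (mu A)).

(** Both tails of [f] are treated at once, [t] telling whether the sign is reversed. *)
Definition signed (t : bool) (y : R) : R := if t then - y else y.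

Lemma signed_le t y : signed t y <= `|y|.
Proof. by rewrite /signed; case: t; rewrite ?ler_norm// -normrN ler_norm. Qed.

Lemma measurable_signed t (f : X -> R) : measurable_fun setT f ->
  measurable_fun setT (fun x => signed t (f x)).
Proof.
by move=> mf; case: t => //=; exact: measurable_funN.
Qed.

Lemma integ_signed t (f : X -> R) : integ mu f -> integ mu (fun x => signed t (f x)).
Proof. by case: t => // If; exact: integN. Qed.

(** The left side counts the partners that a point of value [y] may need, each of them lowering the
    sum by more than [c]. *)
Lemma count_levels (c W y : R) n : 0 < c -> 0 <= W ->
  \sum_(i < n) (W + i%:R * c < y)%R%:R <= (W < y)%R%:R * (y / c + 1).
Proof.
move=> c0 W0; elim: n => [|n IHn].
  rewrite big_ord0; case: ltP => Wy; rewrite ?mul0r// mul1r addr_ge0// divr_ge0// ltW//.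
  exact: le_lt_trans Wy.
rewrite big_ord_recr/=; case: (ltP (W + n%:R * c)) => h; last by rewrite addr0.
have nc : 0 <= n%:R * c by rewrite mulr_ge0// ltW.
have -> : (W < y) = true by apply: le_lt_trans h; rewrite lerDl.
rewrite mul1r lerD2r; apply: (@le_trans _ _ n%:R).
  elim: n {IHn h nc} => [|n IHn]; first by rewrite big_ord0.
  by rewrite big_ord_recr/= -natr1 lerD//; case: ltP.
rewrite ler_pdivlMr//; apply/ltW/(le_lt_trans _ h); rewrite lerDr//.
Qed.

Lemma positive_part_null (f : X -> R) t : integ mu f -> \int[mu]_x f x = 0 ->
  ~ (\forall x \ae mu, f x = 0) -> exists2 c, 0 < c & 0 < m [set x | c < signed t (f x)].
Proof.
move=> If f0 nf; apply: contrapT => nc; apply: nf.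
have mf := integ_measurable If.
have mlt c : measurable [set x | c < signed t (f x)].
  by apply: measurable_lt_set; [exact: measurable_cst|exact: measurable_signed].
have z n : mu [set x | n.+1%:R^-1 < signed t (f x)] = 0%E.
  rewrite (mE mu (mlt _)); congr EFin; apply/eqP; rewrite eq_le m_ge0 andbT leNgt.
  by apply/negP => h; apply: nc; exists n.+1%:R^-1 => //; rewrite invr_gt0.
have le0 : \forall x \ae mu, `|f x| = - signed t (f x).
  have neg : mu.-negligible (\bigcup_n [set x | n.+1%:R^-1 < signed t (f x)]).
    by apply: negligible_bigcup => n; exists [set x | n.+1%:R^-1 < signed t (f x)]; split; [exact: mlt|exact: z|].
  apply: negligibleS neg => x /= h; apply: contrapT => nx; apply: h.
  have : signed t (f x) <= 0.
    rewrite leNgt; apply/negP => p; apply: nx.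
    exists (Num.truncn (signed t (f x))^-1) => //=.
    by rewrite invf_plt ?posrE//; exact: truncnS_gt.
  by rewrite /signed; case: (t) => s0; [rewrite opprK ger0_norm//; lra|rewrite ler0_norm].
have mN : measurable_fun setT (fun x => - signed t (f x)).
  by apply: measurable_funN; exact: measurable_signed.
have Ia := integ_abs If.
have a0 : \int[mu]_x `|f x| = 0.
  rewrite (ae_Rintegral measurableT (integ_measurable Ia) mN le0).
  by rewrite (RintN (integ_signed t If)) /signed; case: (t); rewrite ?RintN// f0 !oppr0.
have : (\int[mu]_x `|(f x)%:E| = 0)%E.
  rewrite -[LHS]fineK; last exact: (integrable_fin_num measurableT Ia).
  by congr EFin.
move/(ae_eq_integral_abs _ measurableT (measurable_int _ If)).
by apply: filterS => x /(_ Logic.I)[].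
Qed.

Lemma tail_small (f : X -> R) (c a : R) : integ mu f -> 0 < c -> 0 < a ->
  exists2 W, c <= W & \int[mu]_x (\1_[set x | W < `|f x|] x * (`|f x| / c + 1)) <= a.
Proof.
move=> If c0 a0; have mf := integ_measurable If.
have Ig : integ mu (fun x => `|f x| / c + 1).
  apply: integD; last by apply: (@integ_bounded _ _ _ mu _ 1) => // x; rewrite normr1.
  have := integZ c^-1 (integ_abs If); congr integ; apply/funext => x /=.
  by rewrite mulrC.
have ma : measurable_fun setT (fun x => `|f x|) := integ_measurable (integ_abs If).
have mS W : measurable [set x | W < `|f x|].
  by apply: measurable_lt_set => //; exact: measurable_cst.
have g0 x : 0 <= `|f x| / c + 1 by rewrite addr_ge0// divr_ge0// ltW.
pose G n x : R := \1_[set x | n%:R < `|f x|] x * (`|f x| / c + 1).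
have IG n : integ mu (G n).
  have := integ_indic (mS n%:R) Ig; congr integ; apply/funext => x /=.
  by rewrite mulrC.
have [|||||_ _ lim_] := @dominated_convergence _ _ _ mu setT measurableT
  (fun n x => (G n x)%:E) (fun=> 0%E) (fun x => (`|f x| / c + 1)%:E).
- by move=> n; exact/measurable_EFinP/integ_measurable/IG.
- exact: measurable_cst.
- apply: aeW => x _; apply: cvg_near_cst; near=> n.
  rewrite /G indicE memNset ?mul0r// => /=; apply/negP; rewrite -leNgt.
  by near: n; exact: nbhs_infty_ger.
- exact: Ig.
- apply: aeW => x n _ /=; rewrite lee_fin /G indicE.
  by case: (x \in _) => /=; rewrite ?mul0r ?normr0 ?mul1r ?(ger0_norm (g0 x)).
rewrite integral0 in lim_.
have {}lim_ : (fun n => \int[mu]_x G n x) @ \oo --> (0 : R).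
  by have := fine_cvg lim_; apply.
have /cvgrPdist_le/(_ a a0)[N _ NP] := lim_.
pose n := maxn N (Num.truncn c).+1; exists n%:R.
  by apply/ltW/(lt_le_trans (truncnS_gt _)); rewrite ler_nat leq_maxr.
have := NP n (leq_maxl _ _); rewrite sub0r normrN.
by apply: le_trans; exact: ler_norm.
Unshelve. all: by end_near. Qed.

(** The left side is the demand for partners of the points beyond [W], the right side the supply of
    moderate values of the opposite sign. The demand is at most the integral of [|f| / c + 1] over
    [|f| > W], which tends to zero as [W] grows, while the supply stays bounded below because [f]
    has mean zero and is not null. *)
Lemma thresholds (f : X -> R) : integ mu f -> \int[mu]_x f x = 0 ->
  ~ (\forall x \ae mu, f x = 0) -> exists c W, [/\ 0 < c, c <= W &
    forall t n, \sum_(i < n) m [set x | W + i%:R * c < signed t (f x)] <=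
      m [set x | - W <= signed t (f x) < - c]].
Proof.
move=> If f0 nf; have mf := integ_measurable If.
have mlt t c : measurable [set x | c < signed t (f x)].
  by apply: measurable_lt_set; [exact: measurable_cst|exact: measurable_signed].
have [c1 c10 p1] := positive_part_null true If f0 nf.
have [c2 c20 p2] := positive_part_null false If f0 nf.
pose c := Num.min c1 c2; have c0 : 0 < c by rewrite lt_min c10.
have p t : 0 < m [set x | c < signed t (f x)].
  case: t; [apply: lt_le_trans p1 _|apply: lt_le_trans p2 _]; apply: m_le => // x /=.
    by apply: le_lt_trans; rewrite ge_min lexx.
  by apply: le_lt_trans; rewrite ge_min lexx orbT.
(* Half the measure of the smaller tail beyond [c]. Demand is kept below [a]; the values beyond [W],
   also of measure at most [a], are removed from a tail of measure at least [2 * a], which leaves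
   enough supply. *)
pose a := Num.min (m [set x | c < signed true (f x)]) (m [set x | c < signed false (f x)]) / 2.
have a0 : 0 < a by rewrite divr_gt0// lt_min !p.
have ap t : 2 * a <= m [set x | c < signed t (f x)].
  by rewrite /a mulrC divfK//; case: t; rewrite ge_min lexx ?orbT.
have [W cW tail] := tail_small If c0 a0.
exists c, W; split=> // t n.
have W0 : 0 <= W by lra.
have Ig : integ mu (fun x => `|f x| / c + 1).
  apply: integD; last by apply: (@integ_bounded _ _ _ mu _ 1) => // x; rewrite normr1.
  have := integZ c^-1 (integ_abs If); congr integ; apply/funext => x /=.
  by rewrite mulrC.
have ma : measurable_fun setT (fun x => `|f x|) := integ_measurable (integ_abs If).
have mS : measurable [set x | W < `|f x|].
  by apply: measurable_lt_set => //; exact: measurable_cst.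
have IG : integ mu (fun x => \1_[set x | W < `|f x|] x * (`|f x| / c + 1)).
  have := integ_indic mS Ig; congr integ; apply/funext => x /=.
  by rewrite mulrC.
have sums u k : \sum_(i < k) m [set x | W + i%:R * c < signed u (f x)] <= a.
  apply: le_trans tail.
  pose F i x : R := \1_[set x | W + i%:R * c < signed u (f x)] x.
  have IF i : integ mu (F i) by exact: integ_indicator.
  have -> : \sum_(i < k) m [set x | W + i%:R * c < signed u (f x)] =
      \int[mu]_x \sum_(i < k) F i x.
    rewrite (integ_sum k IF).2; apply: eq_bigr => i _.
    by rewrite -(Rintegral_indicator mu (mlt u (W + i%:R * c))).
  apply: Rint_le => //; first exact: (integ_sum k IF).1.
  move=> x; apply: (@le_trans _ _ ((W < signed u (f x))%R%:R * (signed u (f x) / c + 1))).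
    have := @count_levels c W (signed u (f x)) k c0 W0; apply: le_trans.
    rewrite le_eqVlt; apply/orP; left; apply/eqP/eq_bigr => i _; rewrite /F indicE.
    by congr (_%:R); congr nat_of_bool; apply/idP/idP; rewrite inE.
  rewrite indicE; have fu := signed_le u (f x).
  case: (ltP W (signed u (f x))) => h; last first.
    by rewrite mul0r mulr_ge0// addr_ge0// divr_ge0// ltW.
  rewrite mem_set /=; last exact: lt_le_trans fu.
  by rewrite !mul1r lerD2r ler_pM2r ?invr_gt0.
apply: le_trans (sums t n) _.
have := sums t 1%N; rewrite big_ord1 mul0r addr0 => tW.
have tW' : m [set x | signed t (f x) < - W] <= a.
  have := sums (~~ t) 1%N; rewrite big_ord1 mul0r addr0; apply: le_trans.
  rewrite le_eqVlt; apply/orP; left; apply/eqP; congr (m _); apply/seteqP; split=> x /=.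
    by rewrite /signed; case: (t) => /=; lra.
  by rewrite /signed; case: (t) => /=; lra.
have apt := ap (~~ t).
have mgt (b : R) : measurable [set x | signed t (f x) < b].
  by apply: measurable_lt_set; [exact: measurable_signed|exact: measurable_cst].
have e1 : m [set x | - W <= signed t (f x) < - c] =
    m [set x | signed t (f x) < - c] - m [set x | signed t (f x) < - W].
  rewrite -mD//; last by move=> x /=; lra.
  congr (m _); apply/seteqP; split=> x /=.
    by move=> /andP[h1 h2]; split=> //; apply/negP; rewrite -leNgt.
  by move=> [h1 /negP]; rewrite -leNgt h1 => ->.
have e2 : m [set x | c < signed (~~ t) (f x)] = m [set x | signed t (f x) < - c].
  congr (m _); apply/seteqP; split=> x /=; rewrite /signed; case: (t) => /=; lra.
by rewrite e1 -e2; lra.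
Qed.

End Thresholds.

Section Partners.
Context {R : realType} {d : measure_display} {X : measurableType d}.
Variable mu : probability X R.
Local Notation m A := (fine (mu A)).
Variables (f : X -> R) (c W : R).
Hypotheses (If : integ mu f) (c0 : 0 < c) (cW : c <= W).

(** The points that may need partner number [i], counted from [0]: the first [i] partners have
    lowered the value by more than [i%:R * c]. *)
Definition raw t i := [set x | W + i%:R * c < signed t (f x)].
Definition low t := [set x | - W <= signed t (f x) < - c].

Let mf : measurable_fun setT f := integ_measurable If.

Let W0 : 0 < W. Proof. exact: lt_le_trans cW. Qed.

Lemma measurable_raw t i : measurable (raw t i).
Proof. by apply: measurable_lt_set; [exact: measurable_cst|exact: measurable_signed]. Qed.

Lemma measurable_low t : measurable (low t).
Proof.
rewrite (_ : low t = [set x | - W <= signed t (f x)] `&` [set x | signed t (f x) < - c]).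
  apply: measurableI.
    by apply: measurable_le_set; [exact: measurable_cst|exact: measurable_signed].
  by apply: measurable_lt_set; [exact: measurable_signed|exact: measurable_cst].
by apply/seteqP; split=> x /=; [move/andP|move=> ?; exact/andP].
Qed.

Lemma raw_gt t i x : raw t i x -> W < signed t (f x).
Proof. by apply: le_lt_trans; rewrite lerDl mulr_ge0// ltW. Qed.

Lemma partners : swappable mu -> splittable mu ->
  (forall t n, \sum_(i < n) m (raw t i) <= m (low t)) ->
  exists (V : bool -> nat -> set X) (s : bool -> nat -> X -> X) (C D : bool -> nat -> set X),
    [/\ forall t i, swap mu (raw t i) (V t i) (s t i) (C t i) (D t i),
        forall t i, V t i `<=` low t & forall t, trivIset setT (V t)].
Proof.
move=> sw sp rl.
have /choice[V VP] : forall t, exists V : nat -> set X,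
    [/\ forall i, measurable (V i), trivIset setT V, forall i, V i `<=` low t &
        forall i, mu (V i) = (m (raw t i))%:E].
  move=> t; apply: sp; [exact: measurable_low|by move=> i; exact: m_ge0|move=> n].
  by rewrite (mE mu (measurable_low t)) lee_fin.
have /choice[S SP] : forall ti : bool * nat, exists S : (X -> X) * set X * set X,
    swap mu (raw ti.1 ti.2) (V ti.1 ti.2) S.1.1 S.1.2 S.2.
  move=> [t i] /=; have [mV _ Vl Vm] := VP t.
  have [||s [C0 [D0 h]]] := sw _ _ (measurable_raw t i) (mV i).
  - apply/seteqP; split=> // x [/raw_gt h /Vl /= /andP[_ h']].
    have := lt_trans h h'; rewrite ltNge => /negP; apply.
    by apply: le_trans (ltW W0); rewrite oppr_le0 ltW.
  - by rewrite Vm -mE//; exact: measurable_raw.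
  by exists (s, C0, D0).
exists V, (fun t i => (S (t, i)).1.1), (fun t i => (S (t, i)).1.2), (fun t i => (S (t, i)).2).
split=> [t i|t i|t]; first exact: (SP (t, i)).
  by have [_ _ + _] := VP t; apply.
by have [] := VP t.
Qed.

Variables (V : bool -> nat -> set X) (sn : bool -> nat -> X -> X) (Cn Dn : bool -> nat -> set X).
Hypotheses (sws : forall t i, swap mu (raw t i) (V t i) (sn t i) (Cn t i) (Dn t i))
  (Vlow : forall t i, V t i `<=` low t) (Vtriv : forall t, trivIset setT (V t)).

Definition psum t i b := signed t (f b + \sum_(j < i) f (sn t j b)).

(* [b] collects [sn t 0 b], [sn t 1 b], ... as long as the sum exceeds [W] in absolute value. *)
Definition attached t i b := forall j, (j <= i)%N -> Cn t j b /\ W < psum t j b.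

Let signedD t (x y : R) : signed t (x + y) = signed t x + signed t y.
Proof. by rewrite /signed; case: t; rewrite ?opprD. Qed.

Lemma psumS t i b : psum t i.+1 b = psum t i b + signed t (f (sn t i b)).
Proof. by rewrite /psum big_ord_recr/= addrA; exact: signedD. Qed.

Lemma partner_low t i b : Cn t i b -> - W <= signed t (f (sn t i b)) < - c.
Proof. by move=> Cb; apply/Vlow/(swap_subr (sws t i))/(swap_funl (sws t i)). Qed.

Lemma psum_le t i b : (forall j, (j < i)%N -> Cn t j b) ->
  psum t i b <= signed t (f b) - i%:R * c.
Proof.
elim: i => [|i IHi] Cb; first by rewrite /psum big_ord0 addr0 mul0r subr0.
rewrite psumS -natr1 mulrDl mul1r opprD addrA lerD//.
  by apply: IHi => j ji; apply: Cb; exact: ltnW.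
by have /andP[_ /ltW] := partner_low (Cb i (ltnSn _)).
Qed.

Lemma attached_level t i b : attached t i b -> W + i%:R * c < `|f b|.
Proof.
move=> a; have [_ h] := a i (leqnn _).
have := @psum_le t i b; move=> /(_ _)/wrap[].
  by move=> j ji; have [] := a j (ltnW ji).
by move=> h2; have := signed_le t (f b); lra.
Qed.

Lemma attached_sign t i b : attached t i b -> W < signed t (f b).
Proof. by move=> /(_ 0%N isT)[/(swap_subl (sws t 0))/raw_gt]. Qed.

(** Partners are taken in order, and each lowers the sum by at least [c], so their number is at most
    [|f b| / c + 1]. This is the source of the factor [|f|] in [column_integral]. *)
Lemma attached_prefix t b : exists N, (forall i, attached t i b <-> (i < N)%N) /\
  N%:R * c <= `|f b| + c.
Proof.
have ex : exists i, `[< ~ attached t i b >].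
  exists (Num.truncn (`|f b| / c)).+1; apply/asboolP => /attached_level h.
  have := truncnS_gt (`|f b| / c); rewrite ltr_pdivrMr//.
  by set k := _%:R * c in h *; have := W0; lra.
case: (ex_minnP ex) => N /asboolP nN Nmin; exists N; split.
  move=> j; split=> [aj|jN].
    by rewrite ltnNge; apply/negP => Nj; apply: nN => k kN; apply: aj; exact: leq_trans Nj.
  by apply: contrapT => /asboolP /Nmin; rewrite leqNgt jN.
case: N nN Nmin => [|N] nN Nmin; first by rewrite mul0r addr_ge0// ltW.
have : attached t N b by apply: contrapT => /asboolP /Nmin; rewrite ltnn.
by move/attached_level; rewrite -natr1 mulrDl mul1r; have := W0; lra.
Qed.

(* The parity of the index encodes the sign of the collecting points. *)
Definition sl l := sn (odd l) l./2.
Definition Dl l := Dn (odd l) l./2.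
Definition El l := attached (odd l) l./2.
Definition column := assign_map sl Dl El.
Definition column_base := assign_base setT sl Dl El.

Let U := [set x | W < `|f x|].

Let sa l : aut mu (sl l) (sl l). Proof. exact: swap_aut (sws _ _). Qed.

Let EC l : El l `<=` Cn (odd l) l./2.
Proof. by move=> b /(_ _ (leqnn _))[]. Qed.

Let CU l : Cn (odd l) l./2 `<=` U.
Proof.
move=> b /(swap_subl (sws _ _))/raw_gt h; apply: lt_le_trans h _; exact: signed_le.
Qed.

Let DU l x : Dl l x -> ~ U x.
Proof.
move=> /(swap_subr (sws _ _))/Vlow /= /andP[h1 h2]; rewrite /U /=; apply/negP; rewrite -leNgt.
by have := W0; have := c0; move: h1 h2; rewrite /signed ler_norml; case: (odd l) => ? ? ? ?; apply/andP; split; lra.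
Qed.

Let sC l x : Cn (odd l) l./2 x -> Dl l (sl l x).
Proof. exact: swap_funl (sws _ _) _. Qed.

Let tD i j x : Dl i x -> Dl j x -> i = j.
Proof.
move=> /(swap_subr (sws _ _)) Vi /(swap_subr (sws _ _)) Vj.
have oij : odd i = odd j.
  have := Vlow Vi; have := Vlow Vj; rewrite /low /= /signed.
  by case: (odd i); case: (odd j) => // /andP[? ?] /andP[? ?]; have := c0; lra.
rewrite -(odd_double_half i) -(odd_double_half j) oij; congr (_ + _.*2)%N.
rewrite oij in Vi; apply: contrapT => /eqP ij.
by have /trivIsetP/(_ _ _ Logic.I Logic.I ij) h := @Vtriv (odd j); have : (set0 : set X) x by rewrite -h.
Qed.

Let Efin x : exists N, forall l, (N <= l)%N -> ~ El l x.
Proof.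
have [N1 [h1 _]] := attached_prefix true x; have [N2 [h2 _]] := attached_prefix false x.
exists (N1 + N2).*2 => l Nl; rewrite /El => a.
have hl : (N1 + N2 <= l./2)%N by rewrite -[X in (X <= _)%N]doubleK half_leq.
have lt1 : (l./2 < N1 + N2)%N.
  case: (odd l) a => [/h1|/h2] h; first by apply: leq_trans h (leq_addr _ _).
  by apply: leq_trans h (leq_addl _ _).
by rewrite ltnNge hl in lt1.
Qed.

Let mE_ l : measurable (El l).
Proof.
rewrite (_ : El l = \bigcap_(j in [set j | (j <= l./2)%N])
  (Cn (odd l) j `&` [set x | W < psum (odd l) j x])); last first.
  apply/seteqP; split=> b h j jl; first exact: h.
  by have := h j jl.
apply: bigcap_measurable => [|j _]; first (by exists 0%N); apply: measurableI; first exact: swap_measl (sws _ _).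
apply: measurable_lt_set; first exact: measurable_cst.
apply: measurable_signed; apply: measurable_funD => //; apply: measurable_sum => i.
by apply: measurableT_comp => //; have [] := swap_aut (sws (odd l) i).
Qed.

Lemma column_tower : tower mu setT column_base column.
Proof.
apply: (@assign_tower _ _ _ mu setT U sl (fun l => Cn (odd l) l./2) Dl El) => //.
by move=> l; exact: swap_measr (sws _ _).
Qed.

Lemma column_out x : column x <> x -> `|f x| <= W.
Proof.
move=> nx; rewrite leNgt; apply/negP => Ux; apply: nx.
rewrite /column /assign_map; case e : (assign_lab _ _ _ x) => [//|l].
by have [/DU] := (assign_labS sl El tD x l).1 e.
Qed.

Lemma column_fibre b : column_base b -> exists (t : bool) (N : nat),
  [/\ (forall i, attached t i b <-> (i < N)%N),
  N%:R * c <= `|f b| + c, signed t (f b) = `|f b|,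
  (forall i, (i < N)%N -> column (sn t i b) = b) &
  forall g : X -> R, fsum column g b = g b + \sum_(i < N) g (sn t i b)].
Proof.
(* Only partners of sign opposite to [f b] are ever attached to [b], so the fibre is indexed by
   numbers of a single parity. *)
move=> bb; pose t := f b < 0; have [N [aN Nc]] := attached_prefix t b.
have tb : signed t (f b) = `|f b|.
  by rewrite /signed /t; case: ltP => h; [rewrite ltr0_norm|rewrite ger0_norm].
pose J := [seq (t + i.*2)%N | i <- iota 0 N].
have half_ i : (t + i.*2)./2 = i by rewrite half_bit_double.
have odd_ i : odd (t + i.*2) = t by rewrite oddD odd_double addbF oddb.
have uJ : uniq J by rewrite map_inj_uniq ?iota_uniq// => i j /(congr1 half); rewrite !half_.
have JE l : l \in J <-> El l b.
  split=> [/mapP[i]|a].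
    by rewrite mem_iota add0n => /andP[_ iN] ->; rewrite /El half_ odd_; exact/aN.
  have ot : odd l = t.
    have h := attached_sign a; rewrite /t; case: ltP => fb; have := W0; move: h;
      rewrite /signed; case: (odd l) => //; lra.
  apply/mapP; exists l./2; last by rewrite -ot odd_double_half.
  by rewrite mem_iota/= add0n; apply/aN; rewrite -ot.
exists t, N; split=> //.
  move=> i /aN a; have El_ : El (t + i.*2) b by rewrite /El half_ odd_.
  have := (assignP sa EC sC tD (sl (t + i.*2) b) bb).2; rewrite /sl half_ odd_; apply.
  by right; exists (t + i.*2)%N; rewrite /sl half_ odd_.
move=> g; rewrite /column (fsum_assign sa EC CU DU sC tD g bb uJ JE); congr (_ + _).
rewrite big_map -(big_mkord xpredT (fun i => g (sn t i b))) /index_iota subn0.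
by apply: eq_bigr => i _; rewrite /sl half_ odd_.
Qed.

(** Collecting stops because the sum has dropped to [W] or less: were it above [W] after [N]
    partners, then [b] would lie in [raw t N] and have a further partner. The last partner was added
    to a sum above [W] and is at least [- W], so the result is nonnegative. *)
Lemma column_sum_small b : column_base b -> (forall t i, raw t i b -> Cn t i b) ->
  `|fsum column f b| <= W.
Proof.
move=> bb good; have [t [N [aN Nc tb _ sumE]]] := column_fibre bb.
have ps : `|fsum column f b| = `|psum t N b|.
  by rewrite sumE /psum /signed; case: (t); rewrite ?normrN.
have psle : psum t N b <= W.
  rewrite leNgt; apply/negP => h; have : attached t N b; last by move/aN; rewrite ltnn.
  move=> j; rewrite leq_eqVlt => /orP[/eqP->|jN]; last by have /aN := jN; apply.
  split=> //; apply: good; rewrite /raw /=; apply: (lt_le_trans (y := psum t N b + N%:R * c)).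
    by rewrite ltrD2r.
  by rewrite -lerBrDr; apply: psum_le => i iN; have /aN := iN; move=> /(_ i (leqnn _))[].
rewrite ps; case: N aN Nc sumE ps psle => [|N] aN Nc sumE ps psle.
  by move: psle; rewrite /psum big_ord0 addr0 tb normr_id.
have /aN a := ltnSn N; have [Cb pN] := a N (leqnn _).
have /andP[lo _] := partner_low Cb; rewrite ger0_norm//.
by rewrite psumS; lra.
Qed.

Lemma good_ae : \forall b \ae mu, forall t i, raw t i b -> Cn t i b.
Proof.
suff h t i : \forall b \ae mu, raw t i b -> Cn t i b.
  have h1 := @ae_foralln _ _ _ mu _ (h true); have h2 := @ae_foralln _ _ _ mu _ (h false).
  by apply: filterS2 h1 h2 => b ? ? -[].
exists (raw t i `\` Cn t i); split.
- by apply: measurableD; [exact: measurable_raw|exact: swap_measl (sws t i)].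
- exact: swap_nulll (sws t i).
- by move=> b /= /not_implyP[].
Qed.

(** A column with [N] partners repeats the value of [g] at its base point [N + 1] times, and
    [N + 1 <= |f b| / c + 2]. *)
Lemma column_integral (g : X -> R) : measurable_fun setT g -> (forall x, 0 <= g x) ->
  (\int[mu]_x (g (column x))%:E <= \int[mu]_x (g x * (`|f x| / c + 2))%:E)%E.
Proof.
move=> mg g0; have t := column_tower.
have mgk : measurable_fun setT (g \o column).
  by apply: measurableT_comp => //; exact: (tower_fun t).
have := @fsum_ge0_integral _ _ _ mu _ _ _ (g \o column) setT t mgk (fun x => g0 _) measurableT.
rewrite preimage_setT /= => ->.
have [l [r [r' kl]]] := tower_lab t.
have w0 x : 0 <= `|f x| / c + 2 by rewrite addr_ge0// divr_ge0// ltW.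
apply: ge0_le_integral => //.
- by move=> x _; rewrite lee_fin; apply: (fsum_ge0 t kl) => y /=.
- by apply/measurable_EFinP; exact: measurable_fsum t mgk.
- apply/measurable_EFinP; apply: measurable_funM => //; apply: measurable_funD => //.
  by apply: measurable_funM => //; exact: measurableT_comp.
move=> b _; rewrite lee_fin.
have [bb|nb] := pselect (column_base b); last first.
  rewrite (fsum_out t _ nb); first exact: mulr_ge0.
  by move=> x nT; exfalso; exact: nT.
have [u [N [_ Nc _ kb sumE]]] := column_fibre bb.
rewrite sumE /= (tower_fix t bb) (eq_bigr (fun=> g b)); last by move=> i _ /=; rewrite kb.
rewrite sumr_const card_ord -[g b *+ N]mulr_natr -{1}[g b]mulr1 -mulrDr ler_wpM2l//.
have : N%:R <= `|f b| / c + 1 by rewrite -ler_pdivlMr// in Nc; move: Nc; rewrite mulrDl divff ?gt_eqF.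
lra.
Qed.

(** The columns are ordered with the bound [Num.max |f| W] taken at the base point: it controls the
    first term, all the partners and the column sum. *)
Lemma column_start : \int[mu]_x f x = 0 -> exists D : data, [/\ admissible mu f W D, measurable_fun setT (proj D),
  forall x, `|transfer D x| <= Num.max `|f (proj D x)| W &
  forall g : X -> R, measurable_fun setT g -> (forall x, 0 <= g x) ->
  (\int[mu]_x (g (proj D x))%:E <= \int[mu]_x (g x * (`|f x| / c + 2))%:E)%E] .
Proof.
move=> f0; have t := column_tower; have ps := pushes_fsum t If.
have mS := integ_measurable ps.1.
have out (g : X -> R) b : ~ column_base b -> fsum column g b = 0.
  by apply: (fsum_out t) => x nT; exfalso; exact: nT.
(* Column sums are bounded by [W] almost everywhere only; the other ones are put to [0]. *)
pose s b : R := fsum column f b * \1_[set b | `|fsum column f b| <= W] b.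
have sW b : `|s b| <= W.
  rewrite /s indicE; have [h|h] := boolP (`|fsum column f b| <= W).
    by rewrite mem_set// mulr1.
  by rewrite memNset ?mulr0 ?normr0 ?ltW//; exact/negP.
have ms : measurable_fun setT s.
  apply: measurable_funM => //; apply: measurable_indic; apply: measurable_le_set.
    exact: measurableT_comp.
  exact: measurable_cst.
have sE : \forall b \ae mu, fsum column f b = s b.
  apply: filterS good_ae => b good; rewrite /s indicE.
  have [bb|nb] := pselect (column_base b).
    by rewrite mem_set ?mulr1//; exact: column_sum_small.
  by rewrite out ?mul0r.
have ps' := pushes_ae ps ms sE.
have sB b : ~ column_base b -> s b = 0.
  by move=> nb; rewrite /s out ?mul0r.
have mbeta : measurable_fun setT (fun x => Num.max `|f x| W).
  by apply: measurable_maxr => //; exact: measurableT_comp.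
have fb x : `|f x| <= Num.max `|f (column x)| W.
  have [e|ne] := pselect (column x = x); first by rewrite e le_max lexx.
  by rewrite le_max (column_out ne) orbT.
have sb x : `|s x| <= Num.max `|f x| W by rewrite le_max sW orbT.
have [sg [sg' [u [[asg ksg mu_ ub] [u0 us all_u]]]]] := ordering t If ps' mbeta fb sb.
exists (Data sg sg' column column_base u s); split => //.
- split=> //=.
  + exact: (tower_meas t).
  + exact: (tower_fun t).
  + exact: (tower_fix t).
  + split=> //; last exact: ps'.1.
    by move=> x bx; apply: u0; exact: (tower_fix t).
  + by rewrite (pushes_mean ps').
  + move=> h Ih h0; have [v [mv v0 hv]] := all_u h Ih.
    have ph := pushes_fsum t Ih.
    exists v, (fsum column h); split; last by rewrite (pushes_mean ph).
    split=> //; last exact: ph.1.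
    * by move=> x bx; apply: v0; exact: (tower_fix t).
    * by move=> x nx; exact: out.
- exact: (tower_fun t).
- exact: column_integral.
Qed.

End Partners.

(** * Integrability of the transfer function *)

Section Exponents.
Context {R : realType} {d : measure_display} {X : measurableType d}.
Variable mu : probability X R.

Lemma Lfun_powR (q : R) (g : X -> R) : measurable_fun setT g ->
  (\int[mu]_x (`|g x| `^ q)%:E < +oo)%E -> g \in Lfun mu q%:E.
Proof.
move=> mg gq; rewrite inE; apply/andP; split; first by rewrite inE.
by rewrite inE /= /finite_norm unlock /=; exact: poweR_lty.
Qed.

Lemma measurable_powR_abs (q : R) (g : X -> R) : measurable_fun setT g ->
  measurable_fun setT (fun x => `|g x| `^ q).
Proof.
move=> mg; apply: (measurableT_comp (measurable_powR q)).
by apply: measurableT_comp.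
Qed.

Lemma Lclass_bounded (q : \bar R) (g : X -> R) (M : R) : (0 <= q)%E ->
  measurable_fun setT g -> (forall x, `|g x| <= M) -> Lclass mu q g.
Proof.
move=> q0 mg gM; rewrite /Lclass; case: eqP => // _.
have M0 : 0 <= M.
  rewrite leNgt; apply/negP => Mn; have /eqP := @probability_setT _ _ _ mu.
  rewrite (_ : [set: X] = set0) ?measure0; first by rewrite eq_sym onee_eq0.
  apply/seteqP; split=> // x _.
  by have := le_lt_trans (gM x) Mn; rewrite ltNge normr_ge0.
case: q q0 => [q q0| _|//].
  apply: Lfun_powR => //.
  apply: (@le_lt_trans _ _ (\int[mu]_x (M `^ q)%:E)%E).
    apply: ge0_le_integral => //.
    - by apply/measurable_EFinP; exact: measurable_powR_abs.
    - by move=> x _; rewrite lee_fin ge0_ler_powR// nnegrE.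
  by rewrite integral_cst// [X in (_ * X)%E]probability_setT mule1 ltry.
rewrite inE; apply/andP; split; first by rewrite inE.
rewrite inE /= /finite_norm unlock /= probability_setT lte01.
apply: (@le_lt_trans _ _ M%:E); last by rewrite ltry.
by apply/ess_supP; apply: aeW => x /=; rewrite lee_fin.
Qed.

(** The power [r - 1] of [|g|] is dominated by that of [3 * Num.max |f| W] at the base point.
    Integrating over columns multiplies it by [|f| / c + 2], which has the order of one more power
    of [|f|], and the [r]-th power of [|f|] is integrable. *)
Lemma Lfun_column (r c W : R) (f g : X -> R) (k : X -> X) : 1 < r -> 0 < c -> 0 < W ->
  f \in Lfun mu r%:E -> measurable_fun setT k -> measurable_fun setT g ->
  (forall x, `|g x| <= 3 * Num.max `|f (k x)| W) ->
  (forall h : X -> R, measurable_fun setT h -> (forall x, 0 <= h x) ->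
    (\int[mu]_x (h (k x))%:E <= \int[mu]_x (h x * (`|f x| / c + 2))%:E)%E) ->
  g \in Lfun mu (r - 1)%:E.
Proof.
move=> r1 c0 W0 fr mk mg gf kint.
have mf : measurable_fun setT f by move: fr; rewrite inE => /andP[/[!inE]].
have mabs : measurable_fun setT (fun x => `|f x|) by exact: measurableT_comp.
have q0 : 0 < r - 1 by rewrite subr_gt0.
apply: Lfun_powR => //.
pose M x := Num.max `|f x| W.
have mM : measurable_fun setT M by apply: measurable_maxr => //; exact: measurable_cst.
have WM x : W <= M x by rewrite le_max lexx orbT.
have fM x : `|f x| <= M x by rewrite le_max lexx.
have M0 x : 0 < M x by exact: lt_le_trans (WM x).
pose h x := (3 * M x) `^ (r - 1).
have mh : measurable_fun setT h.
  by apply: (measurableT_comp (measurable_powR (r - 1))); exact: measurable_funM.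
have h0 x : 0 <= h x by exact: powR_ge0.
apply: (@le_lt_trans _ _ (\int[mu]_x (h (k x))%:E)%E).
  apply: ge0_le_integral => //.
  - by apply/measurable_EFinP; exact: measurable_powR_abs.
  - by apply/measurable_EFinP; exact: (measurableT_comp mh mk).
  - move=> x _; rewrite lee_fin; apply: ge0_ler_powR; rewrite ?nnegrE ?gf//.
      exact: ltW.
    by rewrite mulr_ge0// ltW.
apply: le_lt_trans (kint h mh h0) _.
(* As [M x] is at least [|f x|] and at least [W], the factor [|f x| / c + 2] is at most
   [(c^-1 + 2 / W) * M x]. *)
pose K := 3 `^ (r - 1) * (c^-1 + 2 / W).
have K0 : 0 <= K.
  by rewrite mulr_ge0 ?powR_ge0// addr_ge0 ?invr_ge0 ?divr_ge0// ltW.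
have Ir : integ mu (fun x => K * (`|f x| `^ r + W `^ r)).
  apply: integZ; apply: integD; first exact: Lfun_integrable (ltW r1) fr.
  by apply: (@integ_bounded _ _ _ mu _ `|W `^ r|).
apply: (@le_lt_trans _ _ (\int[mu]_x (K * (`|f x| `^ r + W `^ r))%:E)%E).
  apply: ge0_le_integral => //.
  - by move=> x _; rewrite lee_fin mulr_ge0// addr_ge0// divr_ge0// ltW.
  - apply/measurable_EFinP; apply: measurable_funM => //; apply: measurable_funD => //.
    by apply: measurable_funM.
  - exact: measurable_int Ir.
  move=> x _; rewrite lee_fin /h powRM ?(ltW (M0 x))// /K -!mulrA ler_wpM2l ?powR_ge0//.
  apply: (@le_trans _ _ ((c^-1 + 2 / W) * M x `^ r)).
    have -> : M x `^ r = M x `^ (r - 1) * M x.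
      by rewrite mulrC mulr_powRB1 ?(ltW (M0 x))// (lt_trans ltr01).
    rewrite mulrCA ler_wpM2l ?powR_ge0// mulrDl lerD//.
      by rewrite mulrC ler_wpM2l// invr_ge0 ltW.
    by rewrite mulrAC ler_pdivlMr// ler_wpM2l.
  rewrite ler_wpM2l//; first by rewrite addr_ge0 ?invr_ge0 ?divr_ge0// ltW.
  rewrite /M; case: (leP `|f x| W) => _; first by rewrite lerDr powR_ge0.
  by rewrite lerDl powR_ge0.
by have /integrableP[_] := Ir; apply: le_lt_trans; apply: ge0_le_integral => //;
  [move=> x _; rewrite lee_fin mulr_ge0// addr_ge0// powR_ge0
  |exact: measurable_int Ir
  |by apply: measurableT_comp => //; exact: measurable_int Ir
  |by move=> x _ /=; rewrite lee_fin ler_norm].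
Qed.

Lemma bounded_start (f : X -> R) (M : R) : 0 < M -> integ mu f -> \int[mu]_x f x = 0 ->
  (\forall x \ae mu, `|f x| <= M) ->
  exists D : data, admissible mu f M D /\ forall x, transfer D x = 0.
Proof.
move=> M0 If f0 fM; have mf := integ_measurable If.
pose f1 x : R := f x * \1_[set x | `|f x| <= M] x.
have mM : measurable [set x | `|f x| <= M].
  by apply: measurable_le_set; [exact: measurableT_comp|exact: measurable_cst].
have mf1 : measurable_fun setT f1 by apply: measurable_funM => //; exact: measurable_indic.
have f1M x : `|f1 x| <= M.
  rewrite /f1 indicE; have [h|h] := boolP (`|f x| <= M).
    by rewrite mem_set// mulr1.
  by rewrite memNset ?mulr0 ?normr0 ?ltW//; exact/negP.
have fE : \forall x \ae mu, f x = f1 x.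
  by apply: filterS fM => x h; rewrite /f1 indicE mem_set// mulr1.
exists (Data id id id setT (fun=> 0) f1); split=> //; split=> //=.
- split=> //.
  + by move=> x nT; exfalso; exact: nT.
  + exact: (@integ_bounded _ _ _ mu _ M).
  + by apply: filterS fE => x ->; rewrite subrr add0r.
- by split=> // x nT; exfalso; exact: nT.
- by rewrite -f0; apply/esym; exact: ae_Rintegral.
move=> h Ih h0; exists (fun=> 0), h; split=> //; split=> //.
- by move=> x nT; exfalso; exact: nT.
- by apply: aeW => x; rewrite subrr add0r.
Qed.

(** For [p] infinite or [f] null, the trivial columns of [bounded_start] give a bounded [g]; null
    functions are set apart because [thresholds] needs both tails of [f] to be nonzero. For finite
    [p] the columns over large values are used; when [p = 1] the claim is mere measurability, and
    otherwise the error [2 W] plus the bound on the transfer function gives the constant [3] in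
    [Lfun_column]. *)
Lemma cobounding_start (p : \bar R) (f : X -> R) : swappable mu -> splittable mu ->
  (1 <= p)%E -> f \in Lfun mu p -> \int[mu]_x f x = 0 ->
  exists (e : R) (D : data), [/\ 0 < e, admissible mu f e D &
    forall g : X -> R, measurable_fun setT g -> (forall x, `|g x - transfer D x| <= 2 * e) ->
    Lclass mu (p - 1)%E g].
Proof.
move=> sw sp p1 fp f0.
have If : integ mu f.
  apply/Lfun1_integrable; apply: (Lfun_subset (lexx _) p1 _ p1) fp.
  by rewrite fin_num_measure.
have q0 : (0 <= p - 1)%E by rewrite sube_ge0.
have bdd M : 0 < M -> (\forall x \ae mu, `|f x| <= M) -> exists (e : R) (D : data),
    [/\ 0 < e, admissible mu f e D &
    forall g : X -> R, measurable_fun setT g -> (forall x, `|g x - transfer D x| <= 2 * e) ->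
    Lclass mu (p - 1)%E g].
  move=> M0 fM; have [D [aD tD]] := bounded_start M0 If f0 fM.
  exists M, D; split=> // g mg gt; apply: (Lclass_bounded q0 mg (M := 2 * M)) => x.
  by have := gt x; rewrite tD subr0.
have [fz|nfz] := pselect (\forall x \ae mu, f x = 0).
  by apply: (bdd 1) => //; apply: filterS fz => x ->; rewrite normr0.
case: p p1 fp q0 bdd => [r r1 fr _ _|_ foo _ bdd|//].
  have [c [W [c0 cW lev]]] := thresholds If f0 nfz.
  have W0 : 0 < W by exact: lt_le_trans cW.
  have [V [s [C [D [sws Vl Vt]]]]] := partners If c0 cW sw sp lev.
  have [D1 [aD mD tD kD]] := column_start If c0 cW sws Vl Vt f0.
  exists W, D1; split=> // g mg gt.
  rewrite /Lclass -EFinB eqe subr_eq0; case: eqP => [//|/eqP rn1].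
  have rgt : 1 < r by rewrite lt_neqAle eq_sym rn1.
  apply: (Lfun_column rgt c0 W0 fr mD mg _ kD) => x.
  have := gt x; have := tD x; set Mx := Num.max _ W => h1 h2.
  have WM : W <= Mx by rewrite le_max lexx orbT.
  have -> : g x = (g x - transfer D1 x) + transfer D1 x by rewrite subrK.
  by apply: le_trans (ler_normD _ _) _; lra.
have : (ess_sup mu (abse \o (EFin \o f)) < +oo)%E.
  by move: foo; rewrite inE => /andP[_]; rewrite inE /= /finite_norm unlock /= probability_setT lte01.
move=> ess; have [M0 essM] : exists M : R, (ess_sup mu (abse \o (EFin \o f)) <= M%:E)%E.
  case: (ess_sup _ _) ess => [M _|//|_]; [by exists M; exact: lexx|by exists 0; exact: leNye].
apply: (bdd (Num.max M0 1)); first by rewrite lt_max ltr01 orbT.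
move/ess_supP : essM; apply: filterS => x /=; rewrite lee_fin => h.
by rewrite le_max h.
Qed.

End Exponents.

Theorem theorem1p1 (R : realType) (d : measure_display) (X : measurableType d)
    (mu : probability X R) (Xstd : standard_probability_space mu)
    (p : \bar R) (p1 : (1 <= p)%E) (f : X -> R) (fLp0 : Lclass0 mu p f) :
  exists T : X -> X,
    [/\ invertible_measure_preserving mu T, ergodic mu T &
      exists2 g : X -> R, Lclass mu (p - 1)%E g &
        \forall x \ae mu, f x = g x - g (T x)].
Proof.
have [c [psi [X0 [Y0 cod]]]] := standard_coding Xstd.
have sw := coding_swappable cod; have sp := coding_splittable cod.
have [A sepA] := coding_separating cod.
have [fp f0] : f \in Lfun mu p /\ \int[mu]_x f x = 0.
  case: fLp0 => + fi; rewrite /Lclass gt_eqF; last exact: lt_le_trans p1.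
  by split=> //; rewrite /Rintegral fi.
have [e [D [e0 aD Lg]]] := cobounding_start sw sp p1 fp f0.
have [S [S' [g [[mS mS' SK S'K muS] erg mg gD fg]]]] := ergodic_cobounding sw sp e0 aD sepA.
exists S; split=> //; last by exists g => //; exact: Lg.
by split=> //; exists S'.
Qed.
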